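(* Let $L$ be a holomorphic line bundle on $\Delta^*$ and let $h$ be a smooth Hermitian metric on $L$ such that $-C\,\omega_P\le\sqrt{-1}\,\Theta_h(L)\le C\,\omega_P$ on $\Delta^*$ for some constant $C>0$; that is, writing $\sqrt{-1}\,\Theta_h(L)=f(z)\,\omega_P$, one has $|f(z)|\le C$ on $\Delta^*$. Then ${}_aL$ is a holomorphic line bundle on $\Delta$ for every $a\in\mathbb{R}$.
   Context: $\Delta=\{z\in\mathbb{C}: |z|<1\}$, $\Delta^*=\Delta\setminus\{0\}$, $\omega_P=\frac{\sqrt{-1}\,dz\wedge d\bar z}{|z|^2(-\log|z|^2)^2}$ is the Poincaré metric on $\Delta^*$, and $\Theta_h(L)$ is the curvature of the Chern connection of $(L,h)$. For $a\in\mathbb{R}$, ${}_aL$ is the sheaf of $\mathcal{O}_\Delta$-modules defined for open $U\subset\Delta$ by ${}_aL(U)=\{f\in L(U\setminus\{0\}) : |f|_h=O(|z|^{-(a+\varepsilon)})\text{ for every }\varepsilon>0\}$ (a growth condition as $z\to0$, vacuous if $0\notin U$). Holomorphic line bundles and locally free sheaves of rank one are identified. *)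

(* Defs.v *)
From Stdlib Require Import Reals Lra.
From Coquelicot Require Import Coquelicot.
Open Scope R_scope.

(** A function or section over a set is a total function of which only the
    values on that set matter; equality of sections is equality on that set. *)

Definition disk (z : C) : Prop := Cmod z < 1.
Definition punctured_disk (z : C) : Prop := Cmod z < 1 /\ z <> RtoC 0.

Definition open_in (X U : C -> Prop) : Prop :=
  open U /\ forall z, U z -> X z.

Definition meet (U V : C -> Prop) : C -> Prop := fun z => U z /\ V z.

Definition holomorphic_on (U : C -> Prop) (f : C -> C) : Prop :=
  forall z : C, U z -> @ex_derive C_AbsRing C_NormedModule f z.

(** [ex_diff_n f n x y] is of class C^n at (x, y); U is meant to be open. *)
Definition smooth_on (U : C -> Prop) (f : C -> R) : Prop :=
  forall (n : nat) (z : C), U z ->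
    ex_diff_n (fun x y => f (x, y)) n (Re z) (Im z).

(** * Wirtinger derivatives *)

Definition partial_x (f : C -> C) (z : C) : C :=
  (Derive (fun t => Re (f (t, Im z))) (Re z),
   Derive (fun t => Im (f (t, Im z))) (Re z)).

Definition partial_y (f : C -> C) (z : C) : C :=
  (Derive (fun t => Re (f (Re z, t))) (Im z),
   Derive (fun t => Im (f (Re z, t))) (Im z)).

Definition d_z (f : C -> C) (z : C) : C :=
  ((partial_x f z - Ci * partial_y f z) / RtoC 2)%C.

Definition d_zbar (f : C -> C) (z : C) : C :=
  ((partial_x f z + Ci * partial_y f z) / RtoC 2)%C.

(** * Holomorphic line bundles and Hermitian metrics *)

(** A holomorphic line bundle on the open set X: a family of fibres with an
    atlas of local frames whose transition functions are holomorphic.  The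
    cocycle condition and the non-vanishing of the transition functions follow
    from the frames being bases; fibres outside X are irrelevant. *)
Record line_bundle (X : C -> Prop) : Type := {
  fibre : C -> ModuleSpace C_Ring;
  chart : Type;
  chart_dom : chart -> C -> Prop;
  frame : chart -> forall z : C, fibre z;
  chart_open : forall i, open_in X (chart_dom i);
  chart_cover : forall z, X z -> exists i, chart_dom i z;
  frame_basis : forall i z, chart_dom i z ->
    forall v : fibre z, exists! c : C, v = scal (c : C_Ring) (frame i z);
  transition_holomorphic : forall i j, exists g : C -> C,
    holomorphic_on (meet (chart_dom i) (chart_dom j)) g /\
    forall z, chart_dom i z -> chart_dom j z ->
      frame j z = scal (g z : C_Ring) (frame i z)
}.

Arguments fibre {X} l z.
Arguments chart {X} l.
Arguments chart_dom {X} l i z.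
Arguments frame {X} l i z.

Definition holomorphic_section {X} (L : line_bundle X) (U : C -> Prop)
    (s : forall z, fibre L z) : Prop :=
  forall i : chart L, exists f : C -> C,
    holomorphic_on (meet U (chart_dom L i)) f /\
    forall z, U z -> chart_dom L i z ->
      s z = scal (f z : C_Ring) (frame L i z).

Record hermitian_metric {X} (L : line_bundle X) : Type := {
  herm : forall z, fibre L z -> fibre L z -> C;
  herm_plus : forall z, X z -> forall u v w : fibre L z,
    herm z (plus u v) w = (herm z u w + herm z v w)%C;
  herm_scal : forall z, X z -> forall (c : C) (u v : fibre L z),
    herm z (scal (c : C_Ring) u) v = (c * herm z u v)%C;
  herm_conj : forall z, X z -> forall u v : fibre L z,
    herm z v u = Cconj (herm z u v);
  herm_pos : forall z, X z -> forall u : fibre L z,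
    u <> zero -> 0 < Re (herm z u u);
  herm_smooth : forall i : chart L,
    smooth_on (chart_dom L i) (fun z => Re (herm z (frame L i z) (frame L i z)))
}.

Arguments herm {X L} h z u v : rename.

Definition hnorm {X} {L : line_bundle X} (h : hermitian_metric L) (z : C)
    (v : fibre L z) : R :=
  sqrt (Re (herm h z v v)).

(** * Chern connection and curvature *)

Definition frame_weight {X} {L : line_bundle X} (h : hermitian_metric L)
    (i : chart L) (z : C) : R :=
  Re (herm h z (frame L i z) (frame L i z)).

(** The Chern connection is D e = theta e for a holomorphic frame e, where
    theta is of type (1,0) (compatibility with dbar) and, with H = h(e,e),
    dH = theta H + conj(theta) H (compatibility with h).  Hence theta is
    (dH/dz) / H times dz; see [chern_formP]. *)
Definition chern_form {X} {L : line_bundle X} (h : hermitian_metric L)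
    (i : chart L) (z : C) : C :=
  (d_z (fun w => RtoC (frame_weight h i w)) z / RtoC (frame_weight h i z))%C.

(** Coefficient of sqrt(-1) Theta_h(L) with respect to sqrt(-1) dz /\ dzbar:
    Theta = d theta = (d theta_z / d zbar) dzbar /\ dz. *)
Definition curvature_coef {X} {L : line_bundle X} (h : hermitian_metric L)
    (i : chart L) (z : C) : C :=
  (- d_zbar (chern_form h i) z)%C.

(** Coefficient of omega_P with respect to sqrt(-1) dz /\ dzbar. *)
Definition poincare_coef (z : C) : R :=
  / ((Cmod z) ^ 2 * (- ln ((Cmod z) ^ 2)) ^ 2).

Definition curvature_bounded (L : line_bundle punctured_disk)
    (h : hermitian_metric L) (K : R) : Prop :=
  exists f : C -> R,
    (forall (i : chart L) (z : C), chart_dom L i z ->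
       curvature_coef h i z = RtoC (f z * poincare_coef z)) /\
    (forall z, punctured_disk z -> Rabs (f z) <= K).

(** * Sheaves of modules over the structure sheaf *)

(** A presheaf of O-modules whose sections over U are functions on the part of
    U lying in [pts], with values in a family of complex vector spaces. *)
Record presheaf : Type := {
  value : C -> ModuleSpace C_Ring;
  pts : C -> Prop;
  sec : (C -> Prop) -> (forall z, value z) -> Prop
}.

Definition sec_eq (F : presheaf) (U : C -> Prop) (s t : forall z, value F z)
    : Prop :=
  forall z, U z -> pts F z -> s z = t z.

Definition sec_plus {F : presheaf} (s t : forall z, value F z)
    : forall z, value F z := fun z => plus (s z) (t z).

Definition sec_scal {F : presheaf} (f : C -> C) (s : forall z, value F z)
    : forall z, value F z := fun z => scal (f z : C_Ring) (s z).

Record is_module_sheaf (X : C -> Prop) (F : presheaf) : Prop := {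
  sheaf_ext : forall U, open_in X U -> forall s t,
    sec_eq F U s t -> sec F U s -> sec F U t;
  sheaf_zero : forall U, open_in X U -> sec F U (fun z => zero);
  sheaf_plus : forall U, open_in X U -> forall s t,
    sec F U s -> sec F U t -> sec F U (sec_plus s t);
  sheaf_scal : forall U, open_in X U -> forall f s,
    holomorphic_on U f -> sec F U s -> sec F U (sec_scal f s);
  sheaf_restrict : forall U V, open_in X U -> open_in U V -> forall s,
    sec F U s -> sec F V s;
  sheaf_glue : forall (J : Type) (U : J -> C -> Prop)
      (s : J -> forall z, value F z),
    (forall j, open_in X (U j)) ->
    (forall j, sec F (U j) (s j)) ->
    (forall j k, sec_eq F (meet (U j) (U k)) (s j) (s k)) ->
    exists t, sec F (fun z => exists j, U j z) t /\
              forall j, sec_eq F (U j) t (s j)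
}.

(** [phi W] is the component over W of an isomorphism O|_V -> F|_V of sheaves
    of O|_V-modules. *)
Record is_iso_from_O (V : C -> Prop) (F : presheaf)
    (phi : (C -> Prop) -> (C -> C) -> forall z, value F z) : Prop := {
  iso_sec : forall W, open_in V W -> forall f,
    holomorphic_on W f -> sec F W (phi W f);
  iso_ext : forall W, open_in V W -> forall f g,
    holomorphic_on W f -> holomorphic_on W g ->
    (forall z, W z -> f z = g z) -> sec_eq F W (phi W f) (phi W g);
  iso_plus : forall W, open_in V W -> forall f g,
    holomorphic_on W f -> holomorphic_on W g ->
    sec_eq F W (phi W (fun z => f z + g z)%C) (sec_plus (phi W f) (phi W g));
  iso_scal : forall W, open_in V W -> forall c f,
    holomorphic_on W c -> holomorphic_on W f ->
    sec_eq F W (phi W (fun z => c z * f z)%C) (sec_scal c (phi W f));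
  iso_restrict : forall W W', open_in V W -> open_in W W' -> forall f,
    holomorphic_on W f -> sec_eq F W' (phi W' f) (phi W f);
  iso_inj : forall W, open_in V W -> forall f g,
    holomorphic_on W f -> holomorphic_on W g ->
    sec_eq F W (phi W f) (phi W g) -> forall z, W z -> f z = g z;
  iso_surj : forall W, open_in V W -> forall s, sec F W s ->
    exists f, holomorphic_on W f /\ sec_eq F W (phi W f) s
}.

Definition locally_free_rank_one (X : C -> Prop) (F : presheaf) : Prop :=
  forall p, X p -> exists V, open_in X V /\ V p /\ exists phi, is_iso_from_O V F phi.

(** A holomorphic line bundle on X, as a locally free sheaf of rank one. *)
Definition is_holomorphic_line_bundle (X : C -> Prop) (F : presheaf) : Prop :=
  is_module_sheaf X F /\ locally_free_rank_one X F.

(** * The prolongation of L by growth conditions *)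

Definition growth_at_0 {L : line_bundle punctured_disk}
    (h : hermitian_metric L) (a : R) (s : forall z, fibre L z) : Prop :=
  forall eps : R, 0 < eps -> exists M : R,
    locally' (RtoC 0)
      (fun z : C => hnorm h z (s z) <= M * Rpower (Cmod z) (- (a + eps))).

Definition prolongation (L : line_bundle punctured_disk)
    (h : hermitian_metric L) (a : R) : presheaf := {|
  value := fibre L;
  pts := punctured_disk;
  sec := fun U s =>
    holomorphic_section L (meet U punctured_disk) s /\
    (U (RtoC 0) -> growth_at_0 h a s)
|}.

(** * Characterisation of the Chern connection form *)

Lemma frame_weight_pos {X} {L : line_bundle X} (h : hermitian_metric L)
    (i : chart L) (z : C) : chart_dom L i z -> 0 < frame_weight h i z.
Proof.
intros Hz.
apply (herm_pos _ h).
- exact (proj2 (chart_open _ L i) z Hz).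
- intros E.
  destruct (frame_basis _ L i z Hz zero) as [c [_ Hc]].
  assert (H : forall d : C, zero = scal (d : C_Ring) (frame L i z)).
  { intros d; rewrite E; symmetry; exact (@scal_zero_r C_Ring _ d). }
  apply C1_nz.
  now rewrite <- (Hc _ (H (RtoC 1))), <- (Hc _ (H (RtoC 0))).
Qed.

Lemma chern_formP {X} {L : line_bundle X} (h : hermitian_metric L)
    (i : chart L) (z theta : C) : chart_dom L i z ->
  let H := fun w => RtoC (frame_weight h i w) in
  (d_z H z = theta * H z /\ d_zbar H z = Cconj theta * H z)%C <->
  theta = chern_form h i z.
Proof.
intros Hz H.
assert (H0 : H z <> RtoC 0).
{ intros E; apply RtoC_inj in E.
  generalize (frame_weight_pos h i z Hz); lra. }
assert (Hb : d_zbar H z = Cconj (d_z H z)).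
{ unfold d_zbar, d_z, partial_x, partial_y, H; simpl.
  rewrite !Derive_const.
  apply injective_projections; simpl; field. }
assert (Hc : Cconj (H z) = H z).
{ unfold H; apply injective_projections; simpl; ring. }
unfold chern_form; fold H.
split.
- intros [E _]; rewrite E; unfold H in *; field; exact H0.
- intros E.
  assert (E' : d_z H z = (theta * H z)%C) by (rewrite E; unfold H in *; field; exact H0).
  split; [exact E'|].
  rewrite Hb, E'; rewrite <- Hc at 2.
  apply injective_projections; simpl; ring.
Qed.

(* Main.v *)
Require Import Defs.
From Stdlib Require Import Reals ZArith Lra Lia Classical ClassicalEpsilon.
From Coquelicot Require Import Coquelicot.
Open Scope R_scope.

(** Write the curvature form as F i dz dzbar, so that F is at most K times the
    Poincare density. The right-hand side z F(z) is small enough near 0 for the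
    equation d v / d zbar = z F to have a solution [v] continuous on a disk
    around 0: sum the Cauchy transforms of the pieces of z F on dyadic annuli.
    Adding v dz/z to the (1,0)-part of the Chern connection gives a holomorphic
    connection, whose local parallel frames [e] satisfy d log |e|^2 / dz = - v/z.
    They continue along w = log z over a half-plane, and multiplying by
    exp(- mu w) removes the monodromy. As v(z) tends to v(0), the resulting
    frame has norm |z|^(b + o(1)), where [b] can be shifted by any integer
    through [mu]. With b in [-a, -a + 1) this frame generates the prolongation:
    the coefficient of a section of moderate growth is o(1/|z|), so its
    singularity at 0 is removable. *)

(** The equation is solved for z F and not for F because F may grow like 1/(|z|^2 log^2 |z|). On the
    annulus |z| ~ 2^-n the function z F has size 2^n/n^2, and a Cauchy transform costs size times
    radius, here 1/n^2; with only a first power of the logarithm the series would diverge. The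
    missing factor 1/z returns as the logarithmic pole v dz/z, which on the cover w = log z is
    simply v dw. The solution v is obtained as a uniform limit, with no claim on its derivatives.
    Holomorphy of the corrected connection is therefore reached by passing to the limit in integrals
    over rectangles, and Goursat's theorem, primitives and removable singularities are built on
    integrals along sides of rectangles. As v is merely continuous at 0, the norm of the frame is
    known only up to factors |z|^eps and |z|^-eps, which the eps of the growth condition absorbs.
    The interval for b is closed at -a because that loss is harmless for the frame itself, and open
    at -a + 1 because z times a coefficient has to tend to 0. *)

Local Notation "c ** u" := (scal (c : C_Ring) u) (at level 40).

(** * Wirtinger calculus *)

Lemma Cmod_Im_le (z : C) : Rabs (Im z) <= Cmod z.
Proof.
eapply Rle_trans; [|apply Rmax_Cmod]; apply Rmax_r.
Qed.

Lemma Cmod_le_abs_sum (z : C) : Cmod z <= Rabs (Re z) + Rabs (Im z).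
Proof.
unfold Cmod; fold (Re z) (Im z).
rewrite <- (sqrt_Rsqr (Rabs (Re z) + Rabs (Im z))).
2: generalize (Rabs_pos (Re z)) (Rabs_pos (Im z)); lra.
apply sqrt_le_1_alt.
rewrite <- (pow2_abs (Re z)), <- (pow2_abs (Im z)).
unfold Rsqr.
generalize (Rabs_pos (Re z)) (Rabs_pos (Im z)); intros H1 H2.
assert (0 <= Rabs (Re z) * Rabs (Im z)) by now apply Rmult_le_pos.
nra.
Qed.

Lemma Cconj_RtoC (x : R) : Cconj (RtoC x) = RtoC x.
Proof. apply injective_projections; simpl; ring. Qed.

Lemma Cconj_Ci : Cconj Ci = (- Ci)%C.
Proof. apply injective_projections; simpl; ring. Qed.

Lemma Cmod_triangle_minus (x y : C) : Cmod (x - y) <= Cmod x + Cmod y.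
Proof.
unfold Cminus; eapply Rle_trans; [apply Cmod_triangle|].
rewrite Cmod_opp; lra.
Qed.

Lemma Cmod_minus_sym (x y : C) : Cmod (x - y) = Cmod (y - x).
Proof.
rewrite <- Cmod_opp; f_equal; ring.
Qed.

Lemma Cmod_triangle_inv (x y : C) : Cmod x - Cmod y <= Cmod (x - y).
Proof.
generalize (Cmod_triangle (x - y) y).
replace (x - y + y)%C with x by ring; lra.
Qed.

(** The balls behind [locally] on C are squares in the real and imaginary parts. The estimates below
    are in [Cmod], so discs are used, and [near_locally] compares the two. *)
Definition near (z : C) (P : C -> Prop) : Prop :=
  exists d, 0 < d /\ forall w, Cmod (w - z) < d -> P w.

Lemma near_locally (z : C) (P : C -> Prop) : near z P <-> locally z P.
Proof.
split.
- intros [d [d0 H]]; exists (mkposreal (d / 2) ltac:(lra)); intros w Hw.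
  apply H.
  destruct Hw as [H1 H2]; unfold AbsRing_ball, ball in H1, H2; simpl in *.
  unfold AbsRing_ball, abs, minus, plus, opp in H1, H2; simpl in *.
  eapply Rle_lt_trans; [apply Cmod_le_abs_sum|].
  unfold Re, Im; simpl; unfold Rminus in *; lra.
- intros [d H]; exists d; split; [apply cond_pos|]; intros w Hw.
  apply H; apply C_NormedModule_mixin_compat1; exact Hw.
Qed.

Lemma open_near (U : C -> Prop) : open U <-> forall z, U z -> near z U.
Proof.
split; intros H z Hz; apply near_locally, H, Hz.
Qed.

Lemma near_and (z : C) (P Q : C -> Prop) :
  near z P -> near z Q -> near z (fun w => P w /\ Q w).
Proof.
intros [d [d0 H]] [e [e0 G]]; exists (Rmin d e); split.
- now apply Rmin_pos.
- intros w Hw; split; [apply H|apply G]; eapply Rlt_le_trans; try exact Hw.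
  apply Rmin_l. apply Rmin_r.
Qed.

Lemma near_imp (z : C) (P Q : C -> Prop) :
  (forall w, P w -> Q w) -> near z P -> near z Q.
Proof.
intros I [d [d0 H]]; exists d; split; [exact d0|]; auto.
Qed.

Lemma near_self (z : C) (P : C -> Prop) : near z P -> P z.
Proof.
intros [d [d0 H]]; apply H.
replace (z - z)%C with (RtoC 0) by ring; now rewrite Cmod_0.
Qed.

Lemma near_near (z : C) (P : C -> Prop) : near z P -> near z (fun w => near w P).
Proof.
intros [d [d0 H]]; exists d; split; [exact d0|]; intros w Hw.
exists (d - Cmod (w - z)); split; [lra|]; intros u Hu; apply H.
replace (u - z)%C with ((u - w) + (w - z))%C by ring.
eapply Rle_lt_trans; [apply Cmod_triangle|]; lra.
Qed.

(** Real differentiability in Wirtinger form: [A] and [B] are the derivatives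
    of [f] with respect to z and to conj z. *)
Definition wd (f : C -> C) (z A B : C) : Prop :=
  forall eps, 0 < eps -> exists d, 0 < d /\ forall k, Cmod k < d ->
    Cmod (f (z + k)%C - f z - (A * k + B * Cconj k)) <= eps * Cmod k.

Definition ccont (f : C -> C) (z : C) : Prop :=
  forall eps, 0 < eps -> near z (fun w => Cmod (f w - f z) < eps).

Lemma wd_near (f : C -> C) (z A B : C) :
  wd f z A B <-> forall eps, 0 < eps -> near z (fun w =>
    Cmod (f w - f z - (A * (w - z) + B * Cconj (w - z))) <= eps * Cmod (w - z)).
Proof.
split; intros H eps e0; destruct (H eps e0) as [d [d0 G]]; exists d; split; auto.
- intros w Hw; specialize (G _ Hw).
  now replace (z + (w - z))%C with w in G by ring.
- intros k Hk; specialize (G (z + k)%C).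
  replace (z + k - z)%C with k in G by ring; auto.
Qed.

Lemma wd_ext (f g : C -> C) (z A B : C) :
  near z (fun w => f w = g w) -> wd f z A B -> wd g z A B.
Proof.
intros E H; apply wd_near; intros eps e0.
assert (H' := proj1 (wd_near _ _ _ _) H eps e0).
assert (E0 := near_self _ _ E); simpl in E0.
generalize (near_and _ _ _ E H'); apply near_imp.
intros w [E1 H1]; now rewrite <- E0, <- E1.
Qed.

Lemma wd_eq (f : C -> C) (z A B A' B' : C) :
  wd f z A B -> A = A' -> B = B' -> wd f z A' B'.
Proof. now intros H <- <-. Qed.

(** The constant 1 is the error term taken with eps = 1. This bound feeds the chain and product
    rules. *)
Lemma wd_lip (f : C -> C) (z A B : C) :
  wd f z A B -> near z (fun w =>
    Cmod (f w - f z) <= (1 + Cmod A + Cmod B) * Cmod (w - z)).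
Proof.
intros H; generalize (proj1 (wd_near _ _ _ _) H 1 Rlt_0_1); apply near_imp.
intros w Hw.
replace (f w - f z)%C with ((f w - f z - (A * (w - z) + B * Cconj (w - z)))
  + (A * (w - z) + B * Cconj (w - z)))%C by ring.
eapply Rle_trans; [apply Cmod_triangle|].
assert (Cmod (A * (w - z) + B * Cconj (w - z)) <= (Cmod A + Cmod B) * Cmod (w - z)).
{ eapply Rle_trans; [apply Cmod_triangle|].
  rewrite !Cmod_mult, Cmod_conj; lra. }
lra.
Qed.

Lemma wd_ccont (f : C -> C) (z A B : C) : wd f z A B -> ccont f z.
Proof.
intros H eps e0.
set (M := 1 + Cmod A + Cmod B).
assert (M0 : 0 < M) by (unfold M; generalize (Cmod_ge_0 A) (Cmod_ge_0 B); lra).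
assert (N : near z (fun w => Cmod (w - z) < eps / M)).
{ exists (eps / M); split; [now apply Rdiv_lt_0_compat|auto]. }
generalize (near_and _ _ _ (wd_lip _ _ _ _ H) N); apply near_imp.
intros w [H1 H2]; eapply Rle_lt_trans; [exact H1|]; fold M.
apply Rmult_lt_compat_l with (r := M) in H2; auto.
replace (M * (eps / M)) with eps in H2 by (field; lra); exact H2.
Qed.

Lemma wd_const (c z : C) : wd (fun _ => c) z 0 0.
Proof.
intros eps e0; exists 1; split; [lra|]; intros k _.
replace (c - c - (0 * k + 0 * Cconj k))%C with (RtoC 0) by ring.
rewrite Cmod_0; apply Rmult_le_pos; [lra|apply Cmod_ge_0].
Qed.

Lemma wd_id (z : C) : wd (fun w => w) z 1 0.
Proof.
intros eps e0; exists 1; split; [lra|]; intros k _.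
replace (z + k - z - (1 * k + 0 * Cconj k))%C with (RtoC 0) by ring.
rewrite Cmod_0; apply Rmult_le_pos; [lra|apply Cmod_ge_0].
Qed.

Lemma wd_conj (z : C) : wd Cconj z 0 1.
Proof.
intros eps e0; exists 1; split; [lra|]; intros k _.
rewrite Cplus_conj.
replace (Cconj z + Cconj k - Cconj z - (0 * k + 1 * Cconj k))%C with (RtoC 0) by ring.
rewrite Cmod_0; apply Rmult_le_pos; [lra|apply Cmod_ge_0].
Qed.

Lemma wd_plus (f g : C -> C) (z A B A' B' : C) :
  wd f z A B -> wd g z A' B' -> wd (fun w => f w + g w)%C z (A + A') (B + B').
Proof.
intros Hf Hg; apply wd_near; intros eps e0.
generalize (near_and _ _ _ (proj1 (wd_near _ _ _ _) Hf (eps / 2) ltac:(lra))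
  (proj1 (wd_near _ _ _ _) Hg (eps / 2) ltac:(lra))); apply near_imp.
intros w [H1 H2].
match goal with |- Cmod ?u <= _ => replace u with
 ((f w - f z - (A * (w - z) + B * Cconj (w - z))) +
  (g w - g z - (A' * (w - z) + B' * Cconj (w - z))))%C by ring end.
eapply Rle_trans; [apply Cmod_triangle|]; lra.
Qed.

(** The derivatives of conj h with respect to z and conj z are conj b and conj a, in swapped roles,
    whence the mixed terms. The error is that of [f] at h(z), controlled by the Lipschitz bound on
    [h], plus A and B applied to the error of [h]. *)
Lemma wd_comp (f h : C -> C) (z A B a b : C) :
  wd f (h z) A B -> wd h z a b ->
  wd (fun w => f (h w)) z (A * a + B * Cconj b) (A * b + B * Cconj a).
Proof.
intros Hf Hh; apply wd_near; intros eps e0.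
set (M := 1 + Cmod a + Cmod b).
assert (M0 : 0 < M) by (unfold M; generalize (Cmod_ge_0 a) (Cmod_ge_0 b); lra).
set (N := Cmod A + Cmod B + 1).
assert (N0 : 0 < N) by (unfold N; generalize (Cmod_ge_0 A) (Cmod_ge_0 B); lra).
assert (e1 : 0 < eps / (2 * M)) by (apply Rdiv_lt_0_compat; lra).
assert (e2 : 0 < eps / (2 * N)) by (apply Rdiv_lt_0_compat; lra).
destruct (proj1 (wd_near _ _ _ _) Hf _ e1) as [d [d0 F]].
generalize (near_and _ _ _ (wd_ccont _ _ _ _ Hh d d0)
  (near_and _ _ _ (wd_lip _ _ _ _ Hh) (proj1 (wd_near _ _ _ _) Hh _ e2))).
apply near_imp; intros w [H1 [H2 H3]].
specialize (F _ H1).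
match goal with |- Cmod ?u <= _ => replace u with
 ((f (h w) - f (h z) - (A * (h w - h z) + B * Cconj (h w - h z))) +
  (A * (h w - h z - (a * (w - z) + b * Cconj (w - z))) +
   B * Cconj (h w - h z - (a * (w - z) + b * Cconj (w - z)))))%C end.
2:{ rewrite !Cminus_conj, !Cplus_conj, !Cmult_conj, !Cminus_conj, !Cconj_conj; ring. }
eapply Rle_trans; [apply Cmod_triangle|].
assert (E1 : Cmod (f (h w) - f (h z) - (A * (h w - h z) + B * Cconj (h w - h z)))
  <= eps / 2 * Cmod (w - z)).
{ eapply Rle_trans; [exact F|].
  apply Rle_trans with (eps / (2 * M) * (M * Cmod (w - z))).
  - apply Rmult_le_compat_l; [lra|exact H2].
  - right; field; lra. }
set (q := (h w - h z - (a * (w - z) + b * Cconj (w - z)))%C) in *.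
assert (E2 : Cmod (A * q + B * Cconj q) <= eps / 2 * Cmod (w - z)).
{ eapply Rle_trans; [apply Cmod_triangle|].
  rewrite !Cmod_mult, Cmod_conj.
  apply Rle_trans with (N * Cmod q).
  - unfold N; generalize (Cmod_ge_0 q); lra.
  - apply Rle_trans with (N * (eps / (2 * N) * Cmod (w - z))).
    + apply Rmult_le_compat_l; [lra|exact H3].
    + right; field; lra. }
lra.
Qed.

Lemma wd_mult (f g : C -> C) (z A B A' B' : C) :
  wd f z A B -> wd g z A' B' ->
  wd (fun w => f w * g w)%C z (A * g z + f z * A') (B * g z + f z * B').
Proof.
intros Hf Hg; apply wd_near; intros eps e0.
set (M := 1 + Cmod A + Cmod B).
assert (M0 : 0 < M) by (unfold M; generalize (Cmod_ge_0 A) (Cmod_ge_0 B); lra).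
set (P := Cmod (f z) + 1). assert (P0 : 0 < P) by (unfold P; generalize (Cmod_ge_0 (f z)); lra).
set (Q := Cmod (g z) + 1). assert (Q0 : 0 < Q) by (unfold Q; generalize (Cmod_ge_0 (g z)); lra).
assert (e1 : 0 < eps / (3 * M)) by (apply Rdiv_lt_0_compat; lra).
assert (e2 : 0 < eps / (3 * Q)) by (apply Rdiv_lt_0_compat; lra).
assert (e3 : 0 < eps / (3 * P)) by (apply Rdiv_lt_0_compat; lra).
generalize (near_and _ _ _ (wd_ccont _ _ _ _ Hg _ e1)
 (near_and _ _ _ (wd_lip _ _ _ _ Hf)
 (near_and _ _ _ (proj1 (wd_near _ _ _ _) Hf _ e2) (proj1 (wd_near _ _ _ _) Hg _ e3)))).
apply near_imp; intros w [H1 [H2 [H3 H4]]].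
match goal with |- Cmod ?u <= _ => replace u with
 ((f w - f z) * (g w - g z) +
  ((f w - f z - (A * (w - z) + B * Cconj (w - z))) * g z +
   f z * (g w - g z - (A' * (w - z) + B' * Cconj (w - z)))))%C by ring end.
eapply Rle_trans; [apply Cmod_triangle|].
eapply Rle_trans; [apply Rplus_le_compat_l; apply Cmod_triangle|].
rewrite !Cmod_mult.
set (m := Cmod (w - z)) in *.
assert (X1 : Cmod (f w - f z) * Cmod (g w - g z) <= eps / 3 * m).
{ apply Rle_trans with ((M * m) * (eps / (3 * M))).
  - apply Rmult_le_compat; try apply Cmod_ge_0; [exact H2|lra].
  - right; field; lra. }
assert (X2 : Cmod (f w - f z - (A * (w - z) + B * Cconj (w - z))) * Cmod (g z) <= eps / 3 * m).
{ apply Rle_trans with ((eps / (3 * Q) * m) * Q).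
  - apply Rmult_le_compat; try apply Cmod_ge_0; [exact H3|unfold Q; lra].
  - right; field; lra. }
assert (X3 : Cmod (f z) * Cmod (g w - g z - (A' * (w - z) + B' * Cconj (w - z))) <= eps / 3 * m).
{ apply Rle_trans with (P * (eps / (3 * P) * m)).
  - apply Rmult_le_compat; try apply Cmod_ge_0; [unfold P; lra|exact H4].
  - right; field; lra. }
lra.
Qed.

Lemma wd_scal (c : C) (f : C -> C) (z A B : C) :
  wd f z A B -> wd (fun w => c * f w)%C z (c * A) (c * B).
Proof.
intros H; eapply wd_eq; [exact (wd_mult _ _ _ _ _ _ _ (wd_const c z) H)| |]; cbn beta; ring.
Qed.

Lemma wd_opp (f : C -> C) (z A B : C) :
  wd f z A B -> wd (fun w => - f w)%C z (- A) (- B).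
Proof.
intros H; eapply wd_eq.
- eapply wd_ext; [|exact (wd_scal (-1) _ _ _ _ H)].
  exists 1; split; [lra|]; intros; ring.
- ring.
- ring.
Qed.

Lemma wd_minus (f g : C -> C) (z A B A' B' : C) :
  wd f z A B -> wd g z A' B' -> wd (fun w => f w - g w)%C z (A - A') (B - B').
Proof.
intros Hf Hg; exact (wd_plus _ _ _ _ _ _ _ Hf (wd_opp _ _ _ _ Hg)).
Qed.

(** The exact remainder is k^2 / (z^2 (z + k)). One bound on |k| keeps |z + k| above |z|/2, the
    other makes the quotient at most eps |k|. *)
Lemma wd_Cinv (z : C) : z <> RtoC 0 -> wd Cinv z (- / (z * z)) 0.
Proof.
intros Hz eps e0.
assert (m0 := proj1 (Cmod_gt_0 z) Hz); set (m := Cmod z) in *.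
assert (m3 : 0 < m * m * m) by (repeat apply Rmult_lt_0_compat; auto).
exists (Rmin (m / 2) (eps * (m * m * m) / 2)); split.
{ apply Rmin_pos; [lra|]. apply Rdiv_lt_0_compat; [|lra]. now apply Rmult_lt_0_compat. }
intros k Hk.
assert (K1 : Cmod k < m / 2) by (eapply Rlt_le_trans; [exact Hk|apply Rmin_l]).
assert (K2 : Cmod k < eps * (m * m * m) / 2) by (eapply Rlt_le_trans; [exact Hk|apply Rmin_r]).
assert (L : m / 2 <= Cmod (z + k)).
{ generalize (Cmod_triangle_inv (z + k + (- k)) (- k)).
  replace (z + k + - k - - k)%C with (z + k)%C by ring.
  replace (z + k + - k)%C with z by ring. rewrite Cmod_opp; fold m; lra. }
assert (Hzk : (z + k)%C <> RtoC 0) by (apply Cmod_gt_0; lra).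
replace (/ (z + k) - / z - (- / (z * z) * k + 0 * Cconj k))%C
  with (k * k * / (z * z * (z + k)))%C by (field; split; auto).
rewrite Cmod_mult, Cmod_inv, !Cmod_mult by (repeat apply Cmult_neq_0; auto).
fold m.
assert (0 <= Cmod k) by apply Cmod_ge_0.
apply Rle_trans with (Cmod k * Cmod k * / (m * m * (m / 2))).
- apply Rmult_le_compat_l; [apply Rmult_le_pos; auto|].
  apply Rinv_le_contravar; [repeat apply Rmult_lt_0_compat; lra|].
  apply Rmult_le_compat_l; [apply Rmult_le_pos; lra|exact L].
- rewrite Rmult_assoc, (Rmult_comm eps); apply Rmult_le_compat_l; auto.
  apply Rmult_le_reg_r with (m * m * (m / 2)); [repeat apply Rmult_lt_0_compat; lra|].
  rewrite Rmult_assoc, Rinv_l; [lra|]. apply Rgt_not_eq; repeat apply Rmult_lt_0_compat; lra.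
Qed.

Lemma wd_inv (f : C -> C) (z A B : C) : f z <> RtoC 0 -> wd f z A B ->
  wd (fun w => / f w)%C z (- A / (f z * f z)) (- B / (f z * f z)).
Proof.
intros Hz H; eapply wd_eq; [exact (wd_comp _ _ _ _ _ _ _ (wd_Cinv _ Hz) H)| |];
 field; auto.
Qed.

(** The bridge to the complex derivative used by [holomorphic_on]: B = 0 is the Cauchy-Riemann
    equation. *)
Lemma is_derive_wd (f : C -> C) (z d : C) :
  @is_derive C_AbsRing C_NormedModule f z d <-> wd f z d 0.
Proof.
split.
- intros [_ H]; apply wd_near; intros eps e0.
  specialize (H z (fun P HP => HP) (mkposreal eps e0)).
  apply locally_C, near_locally in H; revert H; apply near_imp; intros w Hw.
  change (Cmod ((f w - f z) - (w - z) * d) <= eps * Cmod (w - z)) in Hw.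
  eapply Rle_trans; [|exact Hw]; right; f_equal; ring.
- intros H; split; [apply is_linear_scal_l|].
  intros x Hx; apply (@is_filter_lim_locally_unique C_AbsRing (AbsRing_NormedModule C_AbsRing)) in Hx; subst x.
  intros eps; apply locally_C, near_locally.
  generalize (proj1 (wd_near _ _ _ _) H eps (cond_pos eps)); apply near_imp; intros w Hw.
  change (Cmod ((f w - f z) - (w - z) * d) <= eps * Cmod (w - z)).
  eapply Rle_trans; [|exact Hw]; right; f_equal; ring.
Qed.

Lemma holomorphic_wd (U : C -> Prop) (f : C -> C) :
  holomorphic_on U f <-> forall z, U z -> exists d, wd f z d 0.
Proof.
split; intros H z Hz; destruct (H z Hz) as [d Hd]; exists d; now apply is_derive_wd.
Qed.

(** * Curves and integrals of complex-valued functions *)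

Definition rder (g : R -> C) (t : R) (d : C) : Prop :=
  forall eps, 0 < eps -> exists e, 0 < e /\ forall h, Rabs h < e ->
    Cmod (g (t + h) - g t - RtoC h * d) <= eps * Rabs h.

Definition rcont (g : R -> C) (t : R) : Prop :=
  forall eps, 0 < eps -> exists e, 0 < e /\ forall s, Rabs (s - t) < e ->
    Cmod (g s - g t) < eps.

Lemma is_derive_eps (f : R -> R) (t l : R) :
  is_derive f t l <-> forall eps, 0 < eps -> exists e, 0 < e /\
    forall h, Rabs h < e -> Rabs (f (t + h) - f t - h * l) <= eps * Rabs h.
Proof.
rewrite is_derive_Reals; split.
- intros H eps e0; destruct (H eps e0) as [d Hd]; exists d; split; [apply cond_pos|].
  intros h Hh; destruct (Req_dec h 0) as [->|h0].
  + rewrite Rplus_0_r, Rabs_R0. replace (f t - f t - 0 * l) with 0 by ring.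
    rewrite Rabs_R0; lra.
  + specialize (Hd h h0 Hh).
    replace (f (t + h) - f t - h * l) with (((f (t + h) - f t) / h - l) * h) by (field; auto).
    rewrite Rabs_mult; apply Rmult_le_compat_r; [apply Rabs_pos|lra].
- intros H eps e0; destruct (H (eps / 2) ltac:(lra)) as [d [d0 Hd]].
  exists (mkposreal d d0); intros h h0 Hh; specialize (Hd h Hh).
  assert (0 < Rabs h) by now apply Rabs_pos_lt.
  apply Rmult_lt_reg_r with (Rabs h); auto.
  rewrite <- Rabs_mult.
  replace (((f (t + h) - f t) / h - l) * h) with (f (t + h) - f t - h * l) by (field; auto).
  nra.
Qed.

Lemma rder_iff (g : R -> C) (t : R) (d : C) : rder g t d <->
  is_derive (fun s => Re (g s)) t (Re d) /\ is_derive (fun s => Im (g s)) t (Im d).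
Proof.
split.
- intros H; split; apply is_derive_eps; intros eps e0;
   destruct (H eps e0) as [e [p G]]; exists e; split; auto; intros h Hh;
   (eapply Rle_trans; [|apply (G h Hh)]).
  + eapply Rle_trans; [|apply re_le_Cmod]; right; f_equal.
    unfold Re, Cminus, Cmult, Cplus, Copp, RtoC; simpl; ring.
  + eapply Rle_trans; [|apply Cmod_Im_le]; right; f_equal.
    unfold Im, Cminus, Cmult, Cplus, Copp, RtoC; simpl; ring.
- intros [H1 H2] eps e0.
  destruct (proj1 (is_derive_eps _ _ _) H1 (eps / 2) ltac:(lra)) as [d1 [p1 G1]].
  destruct (proj1 (is_derive_eps _ _ _) H2 (eps / 2) ltac:(lra)) as [d2 [p2 G2]].
  exists (Rmin d1 d2); split; [now apply Rmin_pos|]; intros h Hh.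
  specialize (G1 h (Rlt_le_trans _ _ _ Hh (Rmin_l _ _))).
  specialize (G2 h (Rlt_le_trans _ _ _ Hh (Rmin_r _ _))).
  eapply Rle_trans; [apply Cmod_le_abs_sum|].
  replace (Re (g (t + h)%R - g t - RtoC h * d)%C) with (Re (g (t + h)) - Re (g t) - h * Re d).
  2: unfold Re, Cminus, Cmult, Cplus, Copp, RtoC; simpl; ring.
  replace (Im (g (t + h)%R - g t - RtoC h * d)%C) with (Im (g (t + h)) - Im (g t) - h * Im d).
  2: unfold Im, Cminus, Cmult, Cplus, Copp, RtoC; simpl; ring.
  lra.
Qed.

Lemma rcont_iff (g : R -> C) (t : R) : rcont g t <->
  continuous (fun s => Re (g s)) t /\ continuous (fun s => Im (g s)) t.
Proof.
assert (E : forall f : R -> R, continuous f t <-> forall eps, 0 < eps ->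
  exists e, 0 < e /\ forall s, Rabs (s - t) < e -> Rabs (f s - f t) < eps).
{ intros f; split.
  - intros H eps e0.
    destruct (proj1 (filterlim_locally f (f t)) H (mkposreal eps e0)) as [d Hd].
    exists d; split; [apply cond_pos|exact Hd].
  - intros H; apply filterlim_locally; intros eps.
    destruct (H eps (cond_pos eps)) as [e [e0 G]]; exists (mkposreal e e0); exact G. }
rewrite !E; split.
- intros H; split; intros eps e0; destruct (H eps e0) as [e [p G]]; exists e; split; auto;
   intros s Hs; (eapply Rle_lt_trans; [|apply (G s Hs)]).
  + eapply Rle_trans; [|apply re_le_Cmod]; right; f_equal.
  + eapply Rle_trans; [|apply Cmod_Im_le]; right; f_equal.
- intros [H1 H2] eps e0.
  destruct (H1 (eps / 2) ltac:(lra)) as [d1 [p1 G1]].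
  destruct (H2 (eps / 2) ltac:(lra)) as [d2 [p2 G2]].
  exists (Rmin d1 d2); split; [now apply Rmin_pos|]; intros h Hh.
  specialize (G1 h (Rlt_le_trans _ _ _ Hh (Rmin_l _ _))).
  specialize (G2 h (Rlt_le_trans _ _ _ Hh (Rmin_r _ _))).
  eapply Rle_lt_trans; [apply Cmod_le_abs_sum|].
  unfold Re, Im, Cminus, Cplus, Copp in *; simpl; unfold Rminus in *; lra.
Qed.

Lemma rder_rcont (g : R -> C) (t : R) (d : C) : rder g t d -> rcont g t.
Proof.
intros H; apply rder_iff in H; destruct H as [H1 H2]; apply rcont_iff; split;
 apply @ex_derive_continuous; eexists; eassumption.
Qed.

Lemma rder_eq (g : R -> C) (t : R) (d d' : C) : rder g t d -> d = d' -> rder g t d'.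
Proof. now intros H <-. Qed.

Lemma wd_rder (f : C -> C) (g : R -> C) (t : R) (A B d : C) :
  wd f (g t) A B -> rder g t d -> rder (fun s => f (g s)) t (A * d + B * Cconj d).
Proof.
intros Hf Hg eps e0.
set (M := 1 + Cmod d).
assert (M0 : 0 < M) by (unfold M; generalize (Cmod_ge_0 d); lra).
set (N := Cmod A + Cmod B + 1).
assert (N0 : 0 < N) by (unfold N; generalize (Cmod_ge_0 A) (Cmod_ge_0 B); lra).
assert (e1 : 0 < eps / (2 * M)) by (apply Rdiv_lt_0_compat; lra).
assert (e2 : 0 < eps / (2 * N)) by (apply Rdiv_lt_0_compat; lra).
destruct (proj1 (wd_near _ _ _ _) Hf _ e1) as [r [r0 F]].
destruct (rder_rcont _ _ _ Hg r r0) as [a [a0 G1]].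
destruct (Hg 1 Rlt_0_1) as [b [b0 G2]].
destruct (Hg _ e2) as [c [c0 G3]].
exists (Rmin a (Rmin b c)); split; [repeat apply Rmin_pos; auto|]; intros h Hh.
assert (h1 : Rabs h < a) by (eapply Rlt_le_trans; [exact Hh|apply Rmin_l]).
assert (h2 : Rabs h < Rmin b c) by (eapply Rlt_le_trans; [exact Hh|apply Rmin_r]).
specialize (G1 (t + h)). replace (t + h - t) with h in G1 by ring. specialize (G1 h1).
specialize (G2 h (Rlt_le_trans _ _ _ h2 (Rmin_l _ _))).
specialize (G3 h (Rlt_le_trans _ _ _ h2 (Rmin_r _ _))).
specialize (F _ G1).
set (w := g (t + h)) in *.
assert (G2' : Cmod (w - g t) <= M * Rabs h).
{ replace (w - g t)%C with ((w - g t - RtoC h * d) + RtoC h * d)%C by ring.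
  eapply Rle_trans; [apply Cmod_triangle|].
  rewrite Cmod_mult, Cmod_R; unfold M; lra. }
replace (f w - f (g t) - RtoC h * (A * d + B * Cconj d))%C with
 ((f w - f (g t) - (A * (w - g t) + B * Cconj (w - g t))) +
  (A * (w - g t - RtoC h * d) + B * Cconj (w - g t - RtoC h * d)))%C.
2: rewrite !Cminus_conj, !Cmult_conj, Cconj_RtoC; ring.
eapply Rle_trans; [apply Cmod_triangle|].
assert (E1 : Cmod (f w - f (g t) - (A * (w - g t) + B * Cconj (w - g t)))
  <= eps / 2 * Rabs h).
{ eapply Rle_trans; [exact F|].
  apply Rle_trans with (eps / (2 * M) * (M * Rabs h)).
  - apply Rmult_le_compat_l; [lra|exact G2'].
  - right; field; lra. }
set (q := (w - g t - RtoC h * d)%C) in *.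
assert (E2 : Cmod (A * q + B * Cconj q) <= eps / 2 * Rabs h).
{ eapply Rle_trans; [apply Cmod_triangle|].
  rewrite !Cmod_mult, Cmod_conj.
  apply Rle_trans with (N * Cmod q).
  - unfold N; generalize (Cmod_ge_0 q); lra.
  - apply Rle_trans with (N * (eps / (2 * N) * Rabs h)).
    + apply Rmult_le_compat_l; [lra|exact G3].
    + right; field; lra. }
lra.
Qed.

Lemma rcont_comp (f : C -> C) (g : R -> C) (t : R) :
  ccont f (g t) -> rcont g t -> rcont (fun s => f (g s)) t.
Proof.
intros Hf Hg eps e0; destruct (Hf eps e0) as [d [d0 F]].
destruct (Hg d d0) as [e [p G]]; exists e; split; auto.
Qed.

Lemma rder_const (c : C) (t : R) : rder (fun _ => c) t 0.
Proof.
intros eps e0; exists 1; split; [lra|]; intros h _.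
replace (c - c - RtoC h * 0)%C with (RtoC 0) by ring; rewrite Cmod_0.
apply Rmult_le_pos; [lra|apply Rabs_pos].
Qed.

Lemma rder_RtoC (t : R) : rder RtoC t 1.
Proof.
intros eps e0; exists 1; split; [lra|]; intros h _.
rewrite RtoC_plus; replace (RtoC t + RtoC h - RtoC t - RtoC h * 1)%C with (RtoC 0) by ring.
rewrite Cmod_0; apply Rmult_le_pos; [lra|apply Rabs_pos].
Qed.

Lemma rder_affine (c d : C) (t : R) : rder (fun s => c + RtoC s * d)%C t d.
Proof.
eapply rder_eq.
- apply (wd_rder (fun z => c + z * d)%C RtoC t d 0 1); [|apply rder_RtoC].
  eapply wd_eq; [apply (wd_plus (fun _ => c) (fun z => z * d)%C)|..].
  + apply wd_const.
  + apply (wd_mult (fun z => z) (fun _ => d)); [apply wd_id|apply wd_const].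
  + cbn beta; ring.
  + cbn beta; ring.
- ring.
Qed.

Lemma rcont_const (c : C) (t : R) : rcont (fun _ => c) t.
Proof. eapply rder_rcont, rder_const. Qed.

Lemma rcont_plus (f g : R -> C) (t : R) :
  rcont f t -> rcont g t -> rcont (fun s => f s + g s)%C t.
Proof.
rewrite !rcont_iff; intros [A B] [A' B']; split.
- apply (continuous_plus (fun s => Re (f s)) (fun s => Re (g s))); auto.
- apply (continuous_plus (fun s => Im (f s)) (fun s => Im (g s))); auto.
Qed.

Lemma rcont_mult (f g : R -> C) (t : R) :
  rcont f t -> rcont g t -> rcont (fun s => f s * g s)%C t.
Proof.
rewrite !rcont_iff; intros [A B] [A' B']; split.
- apply (continuous_minus (fun s => Re (f s) * Re (g s)) (fun s => Im (f s) * Im (g s)));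
   apply (continuous_mult (K := R_AbsRing)); auto.
- apply (continuous_plus (fun s => Re (f s) * Im (g s)) (fun s => Im (f s) * Re (g s)));
   apply (continuous_mult (K := R_AbsRing)); auto.
Qed.

Lemma rcont_scal (c : C) (f : R -> C) (t : R) :
  rcont f t -> rcont (fun s => c * f s)%C t.
Proof. intros H; apply rcont_mult; auto using rcont_const. Qed.

Lemma rcont_minus (f g : R -> C) (t : R) :
  rcont f t -> rcont g t -> rcont (fun s => f s - g s)%C t.
Proof.
rewrite !rcont_iff; intros [A B] [A' B']; split.
- apply (continuous_minus (fun s => Re (f s)) (fun s => Re (g s))); auto.
- apply (continuous_minus (fun s => Im (f s)) (fun s => Im (g s))); auto.
Qed.

(** The real mean value theorem is applied to the real and imaginary parts separately, at two
    different points, whence the factor 2. *)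
Lemma rder_mvt (g g' : R -> C) (a b eps : R) (c : C) :
  (forall t, Rmin a b <= t <= Rmax a b -> rder g t (g' t)) ->
  (forall t, Rmin a b <= t <= Rmax a b -> Cmod (g' t - c) <= eps) ->
  Cmod (g b - g a - RtoC (b - a) * c) <= 2 * eps * Rabs (b - a).
Proof.
intros D E.
assert (D1 : forall t, Rmin a b <= t <= Rmax a b -> is_derive (fun s => Re (g s)) t (Re (g' t)))
 by (intros t Ht; apply (proj1 (rder_iff _ _ _) (D t Ht))).
assert (D2 : forall t, Rmin a b <= t <= Rmax a b -> is_derive (fun s => Im (g s)) t (Im (g' t)))
 by (intros t Ht; apply (proj1 (rder_iff _ _ _) (D t Ht))).
destruct (MVT_gen (fun s => Re (g s)) a b (fun t => Re (g' t))) as [x [Hx Ex]].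
{ intros x Hx; apply D1; lra. }
{ intros x Hx; apply continuity_pt_filterlim, @ex_derive_continuous; eexists; now apply D1. }
destruct (MVT_gen (fun s => Im (g s)) a b (fun t => Im (g' t))) as [y [Hy Ey]].
{ intros y Hy; apply D2; lra. }
{ intros y Hy; apply continuity_pt_filterlim, @ex_derive_continuous; eexists; now apply D2. }
eapply Rle_trans; [apply Cmod_le_abs_sum|].
replace (Re (g b - g a - RtoC (b - a)%R * c)%C) with (Re (g' x - c)%C * (b - a)).
2:{ transitivity ((Re (g b) - Re (g a)) - (b - a) * Re c).
  - rewrite Ex; unfold Re, Cminus, Cplus, Copp; simpl; ring.
  - unfold Re, Cminus, Cplus, Copp, Cmult, RtoC; simpl; ring. }
replace (Im (g b - g a - RtoC (b - a)%R * c)%C) with (Im (g' y - c)%C * (b - a)).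
2:{ transitivity ((Im (g b) - Im (g a)) - (b - a) * Im c).
  - rewrite Ey; unfold Im, Cminus, Cplus, Copp; simpl; ring.
  - unfold Im, Cminus, Cplus, Copp, Cmult, RtoC; simpl; ring. }
rewrite !Rabs_mult.
assert (X := Rle_trans _ _ _ (re_le_Cmod _) (E x Hx)).
assert (Y := Rle_trans _ _ _ (Cmod_Im_le _) (E y Hy)).
assert (0 <= Rabs (b - a)) by apply Rabs_pos.
nra.
Qed.

Lemma rder_zero_const (g : R -> C) (a b : R) :
  (forall t, Rmin a b <= t <= Rmax a b -> rder g t 0) -> g a = g b.
Proof.
intros H.
assert (E := rder_mvt g (fun _ => RtoC 0) a b 0 0 H).
assert (Cmod (g b - g a - RtoC (b - a) * 0) <= 2 * 0 * Rabs (b - a)).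
{ apply E; intros; replace (RtoC 0 - RtoC 0)%C with (RtoC 0) by ring; rewrite Cmod_0; lra. }
symmetry; apply Ceq_minus, Cmod_eq_0.
replace (g b - g a)%C with (g b - g a - RtoC (b - a) * 0)%C by ring.
generalize (Cmod_ge_0 (g b - g a - RtoC (b - a) * 0)); lra.
Qed.

Definition CInt (f : R -> C) (a b : R) : C :=
  (RInt (fun t => Re (f t)) a b, RInt (fun t => Im (f t)) a b).

Definition rcont_on (f : R -> C) (a b : R) : Prop :=
  forall t, Rmin a b <= t <= Rmax a b -> rcont f t.

Lemma rcont_on_ex (f : R -> C) (a b : R) : rcont_on f a b ->
  ex_RInt (fun t => Re (f t)) a b /\ ex_RInt (fun t => Im (f t)) a b.
Proof.
intros H; split; apply (ex_RInt_continuous (V := R_CompleteNormedModule)); intros t Ht;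
 apply (proj1 (rcont_iff _ _) (H t Ht)).
Qed.

Lemma CInt_ext (f g : R -> C) (a b : R) :
  (forall t, Rmin a b < t < Rmax a b -> f t = g t) -> CInt f a b = CInt g a b.
Proof.
intros H; unfold CInt; f_equal; apply RInt_ext; intros t Ht; now rewrite (H t Ht).
Qed.

Lemma CInt_plus (f g : R -> C) (a b : R) : rcont_on f a b -> rcont_on g a b ->
  CInt (fun t => f t + g t)%C a b = (CInt f a b + CInt g a b)%C.
Proof.
intros Hf Hg; destruct (rcont_on_ex _ _ _ Hf) as [F1 F2], (rcont_on_ex _ _ _ Hg) as [G1 G2].
apply injective_projections.
- exact (RInt_plus (V := R_CompleteNormedModule) _ _ a b F1 G1).
- exact (RInt_plus (V := R_CompleteNormedModule) _ _ a b F2 G2).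
Qed.

Lemma CInt_scal (c : C) (f : R -> C) (a b : R) : rcont_on f a b ->
  CInt (fun t => c * f t)%C a b = (c * CInt f a b)%C.
Proof.
intros Hf; destruct (rcont_on_ex _ _ _ Hf) as [F1 F2].
assert (S : forall (k : R) (u : R -> R), ex_RInt u a b ->
  RInt (fun t => k * u t) a b = k * RInt u a b)
 by (intros k u; apply (RInt_scal (V := R_CompleteNormedModule))).
assert (X : forall (k : R) (u : R -> R), ex_RInt u a b -> ex_RInt (fun t => k * u t) a b)
 by (intros k u; apply (ex_RInt_scal (V := R_NormedModule))).
apply injective_projections.
- etransitivity.
  + exact (RInt_minus (V := R_CompleteNormedModule) _ _ a b (X (Re c) _ F1) (X (Im c) _ F2)).
  + rewrite !S; auto.
- etransitivity.
  + exact (RInt_plus (V := R_CompleteNormedModule) _ _ a b (X (Re c) _ F2) (X (Im c) _ F1)).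
  + rewrite !S; auto.
Qed.

Lemma CInt_minus (f g : R -> C) (a b : R) : rcont_on f a b -> rcont_on g a b ->
  CInt (fun t => f t - g t)%C a b = (CInt f a b - CInt g a b)%C.
Proof.
intros Hf Hg; destruct (rcont_on_ex _ _ _ Hf) as [F1 F2], (rcont_on_ex _ _ _ Hg) as [G1 G2].
apply injective_projections.
- exact (RInt_minus (V := R_CompleteNormedModule) _ _ a b F1 G1).
- exact (RInt_minus (V := R_CompleteNormedModule) _ _ a b F2 G2).
Qed.

(** The two parts are bounded separately, which costs a factor 2; [Rabs (b - a)] covers intervals
    traversed backwards. *)
Lemma CInt_bound (f : R -> C) (a b M : R) : rcont_on f a b ->
  (forall t, Rmin a b <= t <= Rmax a b -> Cmod (f t) <= M) ->
  Cmod (CInt f a b) <= 2 * M * Rabs (b - a).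
Proof.
intros Hf HM; destruct (rcont_on_ex _ _ _ Hf) as [F1 F2].
eapply Rle_trans; [apply Cmod_le_abs_sum|].
assert (A : forall u, ex_RInt u a b -> (forall t, Rmin a b <= t <= Rmax a b -> Rabs (u t) <= M) ->
  Rabs (RInt u a b) <= M * Rabs (b - a)).
{ clear; intros u U B; destruct (Rle_dec a b) as [ab|ab].
  - rewrite Rmin_left, Rmax_right in B by lra.
    rewrite (Rabs_right (b - a)), Rmult_comm by lra; now apply abs_RInt_le_const.
  - rewrite Rmin_right, Rmax_left in B by lra.
    rewrite <- opp_RInt_swap, (Rabs_left (b - a)) by (apply ex_RInt_swap, U || lra).
    change (Rabs (- RInt u b a) <= M * - (b - a)); rewrite Rabs_Ropp.
    replace (M * - (b - a)) with ((a - b) * M) by ring.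
    apply abs_RInt_le_const; auto; [lra|now apply ex_RInt_swap]. }
assert (A1 := A _ F1 (fun t Ht => Rle_trans _ _ _ (re_le_Cmod _) (HM t Ht))).
assert (A2 := A _ F2 (fun t Ht => Rle_trans _ _ _ (Cmod_Im_le _) (HM t Ht))).
change (Rabs (RInt (fun t => Re (f t)) a b) + Rabs (RInt (fun t => Im (f t)) a b)
  <= 2 * M * Rabs (b - a)); lra.
Qed.

Lemma CInt_Chasles (f : R -> C) (a b c : R) : rcont_on f a b -> rcont_on f b c ->
  (CInt f a b + CInt f b c)%C = CInt f a c.
Proof.
intros Hf Hg; destruct (rcont_on_ex _ _ _ Hf) as [F1 F2], (rcont_on_ex _ _ _ Hg) as [G1 G2].
apply injective_projections.
- exact (RInt_Chasles (V := R_CompleteNormedModule) _ a b c F1 G1).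
- exact (RInt_Chasles (V := R_CompleteNormedModule) _ a b c F2 G2).
Qed.

Lemma CInt_point (f : R -> C) (a : R) : CInt f a a = RtoC 0.
Proof.
unfold CInt; rewrite !RInt_point; reflexivity.
Qed.

Lemma CInt_const (c : C) (a b : R) : CInt (fun _ => c) a b = (RtoC (b - a)%R * c)%C.
Proof.
unfold CInt; rewrite !RInt_const; apply injective_projections; simpl;
 unfold scal; simpl; unfold mult; simpl; unfold Re, Im; ring.
Qed.

Lemma CInt_FTC (g g' : R -> C) (a b : R) :
  (forall t, Rmin a b <= t <= Rmax a b -> rder g t (g' t)) -> rcont_on g' a b ->
  CInt g' a b = (g b - g a)%C.
Proof.
intros D H; apply injective_projections; simpl; apply is_RInt_unique.
- apply (is_RInt_derive (V := R_CompleteNormedModule) (fun t => Re (g t))); intros t Ht.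
  + apply (proj1 (rder_iff _ _ _) (D t Ht)).
  + apply (proj1 (rcont_iff _ _) (H t Ht)).
- apply (is_RInt_derive (V := R_CompleteNormedModule) (fun t => Im (g t))); intros t Ht.
  + apply (proj1 (rder_iff _ _ _) (D t Ht)).
  + apply (proj1 (rcont_iff _ _) (H t Ht)).
Qed.

Lemma rder_CInt (f : R -> C) (a t : R) : (forall s, rcont f s) ->
  rder (fun x => CInt f a x) t (f t).
Proof.
intros H eps e0.
destruct (H t (eps / 2) ltac:(lra)) as [e [p G]].
exists e; split; auto; intros h Hh.
rewrite <- (CInt_Chasles f a t (t + h)) by (intros s _; apply H).
replace (RtoC h * f t)%C with (CInt (fun _ => f t) t (t + h)).
2:{ rewrite CInt_const; do 2 f_equal; ring. }
replace (CInt f a t + CInt f t (t + h) - CInt f a t - CInt (fun _ => f t) t (t + h))%C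
 with (CInt f t (t + h) - CInt (fun _ => f t) t (t + h))%C by ring.
rewrite <- CInt_minus by (intros s _; auto using rcont_const).
eapply Rle_trans; [apply (CInt_bound _ _ _ (eps / 2))|].
- intros s _; apply rcont_minus; auto using rcont_const.
- intros s Hs; left; apply G.
  eapply Rle_lt_trans; [|exact Hh].
  revert Hs; unfold Rmin, Rmax, Rabs; repeat destruct Rle_dec; repeat destruct Rcase_abs; lra.
- right; replace (t + h - t) with h by ring; field.
Qed.

(** Heine-Cantor on the compact square [-M, M]^2; only one of the two points is confined to the
    disc. *)
Lemma ccont_unif (f : C -> C) (M eps : R) : (forall z, ccont f z) -> 0 < eps ->
  exists d, 0 < d /\ forall z w, Cmod z <= M -> Cmod (w - z) < d -> Cmod (f w - f z) < eps.
Proof.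
intros H e0.
assert (D : forall z : C, { d : posreal | forall w, Cmod (w - z) < d -> Cmod (f w - f z) < eps / 2 }).
{ intros z; apply constructive_indefinite_description.
  destruct (H z (eps / 2) ltac:(lra)) as [d [d0 G]]; now exists (mkposreal d d0). }
assert (P : forall r : posreal, 0 < r / 4) by (intros r; generalize (cond_pos r); lra).
(* A quarter of the local modulus e leaves room: [z] is then within e/2 of the centre (u, v), and
   [w], at distance less than e/4 from [z], stays within e of it. *)
set (del := fun x y : R => mkposreal (proj1_sig (D (x, y)) / 4) (P _)).
destruct (compactness_value_2d (- M) M (- M) M del) as [d Hd].
exists d; split; [apply cond_pos|]; intros z w Hz Hw.
apply NNPP; intros N.
assert (Bx := Rle_trans _ _ _ (re_le_Cmod z) Hz).
assert (By := Rle_trans _ _ _ (Cmod_Im_le z) Hz).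
apply (Hd (Re z) (Im z)).
{ revert Bx; unfold Rabs; destruct Rcase_abs; lra. }
{ revert By; unfold Rabs; destruct Rcase_abs; lra. }
intros [u [v [_ [_ [H1 [H2 H3]]]]]]; apply N; clear N.
unfold del in *; simpl in *.
destruct (D (u, v)) as [e He]; simpl in *.
assert (Z : Cmod (z - (u, v)) < e / 2).
{ eapply Rle_lt_trans; [apply Cmod_le_abs_sum|].
  unfold Re, Im, Cminus, Cplus, Copp in *; simpl; unfold Rminus in *; lra. }
assert (W : Cmod (w - (u, v)) < e).
{ replace (w - (u, v))%C with ((w - z) + (z - (u, v)))%C by ring.
  eapply Rle_lt_trans; [apply Cmod_triangle|]; generalize (cond_pos e); lra. }
assert (A := He w W). assert (B : Cmod (f z - f (u, v)) < eps / 2) by (apply He; generalize (cond_pos e); lra).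
replace (f w - f z)%C with ((f w - f (u, v)) - (f z - f (u, v)))%C by ring.
eapply Rle_lt_trans; [apply Cmod_triangle_minus|]; lra.
Qed.

Lemma rcont_pair_l (y x : R) : rcont (fun t => (t, y)) x.
Proof.
intros eps e0; exists eps; split; auto; intros s Hs.
eapply Rle_lt_trans; [apply Cmod_le_abs_sum|].
unfold Re, Im; simpl; rewrite Rplus_opp_r, Rabs_R0; unfold Rminus in Hs; lra.
Qed.

Lemma rcont_pair_r (x y : R) : rcont (fun t => (x, t)) y.
Proof.
intros eps e0; exists eps; split; auto; intros s Hs.
eapply Rle_lt_trans; [apply Cmod_le_abs_sum|].
unfold Re, Im; simpl; rewrite Rplus_opp_r, Rabs_R0; unfold Rminus in Hs; lra.
Qed.

Lemma ccont_unif_strip (F : C -> C) (x c d eps : R) : (forall z, ccont F z) -> 0 < eps ->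
  exists e, 0 < e /\ forall x' y, Rmin c d <= y <= Rmax c d -> Rabs (x' - x) < e ->
    Cmod (F (x', y) - F (x, y)) < eps.
Proof.
intros H e0.
destruct (ccont_unif F (Rabs x + (Rabs c + Rabs d)) eps H e0) as [e [p G]].
exists e; split; auto; intros x' y Hy Hx; apply G.
- eapply Rle_trans; [apply Cmod_le_abs_sum|]; simpl; apply Rplus_le_compat_l.
  revert Hy; unfold Im, Rmin, Rmax, Rabs; simpl; repeat destruct Rle_dec; repeat destruct Rcase_abs; lra.
- eapply Rle_lt_trans; [apply Cmod_le_abs_sum|].
  unfold Re, Im; simpl; rewrite Rplus_opp_r, Rabs_R0; unfold Rminus in Hx; lra.
Qed.

Lemma rcont_CInt_param (F : C -> C) (c d x : R) : (forall z, ccont F z) ->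
  rcont (fun x => CInt (fun y => F (x, y)) c d) x.
Proof.
intros H eps e0.
set (M := 2 * Rabs (d - c) + 1).
assert (M0 : 0 < M) by (unfold M; generalize (Rabs_pos (d - c)); lra).
destruct (ccont_unif_strip F x c d (eps / M) H) as [e [p G]].
{ now apply Rdiv_lt_0_compat. }
assert (Hc : forall x, rcont_on (fun y => F (x, y)) c d)
  by (intros u t _; apply rcont_comp; [apply H|apply rcont_pair_r]).
exists e; split; auto; intros x' Hx.
rewrite <- CInt_minus by auto.
eapply Rle_lt_trans; [apply (CInt_bound _ _ _ (eps / M))|].
- intros t Ht; apply rcont_minus; apply Hc; auto.
- intros t Ht; left; now apply G.
- apply Rmult_lt_reg_r with M; auto.
  replace (2 * (eps / M) * Rabs (d - c) * M) with (eps * (2 * Rabs (d - c))) by (field; lra).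
  unfold M; lra.
Qed.

(** Differentiation under the integral sign: the mean value inequality turns uniform continuity of
    [F] across the segment into a bound on the difference quotients that is uniform in y. *)
Lemma rder_CInt_param (G F : C -> C) (c d x : R) :
  (forall x, rcont_on (fun y => G (x, y)) c d) -> (forall z, ccont F z) ->
  (forall x y, Rmin c d <= y <= Rmax c d -> rder (fun x => G (x, y)) x (F (x, y))) ->
  rder (fun x => CInt (fun y => G (x, y)) c d) x (CInt (fun y => F (x, y)) c d).
Proof.
intros HG HF D eps e0.
(* The 4 combines the factors 2 of [rder_mvt] and of [CInt_bound]; the added 1 keeps [M] positive
   when c = d. *)
set (M := 4 * Rabs (d - c) + 1).
assert (M0 : 0 < M) by (unfold M; generalize (Rabs_pos (d - c)); lra).
destruct (ccont_unif_strip F x c d (eps / M) HF) as [e [p U]].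
{ now apply Rdiv_lt_0_compat. }
assert (Fc : forall x, rcont_on (fun y => F (x, y)) c d)
  by (intros u t _; apply rcont_comp; [apply HF|apply rcont_pair_r]).
exists e; split; auto; intros h Hh.
rewrite <- CInt_minus, <- CInt_scal, <- CInt_minus; auto.
2:{ intros t Ht; apply rcont_minus; apply HG; auto. }
2:{ intros t Ht; apply rcont_scal, Fc; auto. }
eapply Rle_trans; [apply (CInt_bound _ _ _ (2 * (eps / M) * Rabs h))|].
- intros t Ht; apply rcont_minus; [apply rcont_minus; apply HG|apply rcont_scal, Fc]; auto.
- intros t Ht.
  assert (V := rder_mvt (fun x => G (x, t)) (fun x => F (x, t)) x (x + h) (eps / M) (F (x, t))).
  replace (x + h - x) with h in V by ring; apply V.
  + intros; now apply D.
  + intros s Hs; left; apply U; auto.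
    eapply Rle_lt_trans; [|exact Hh].
    revert Hs; unfold Rmin, Rmax, Rabs; repeat destruct Rle_dec; repeat destruct Rcase_abs; lra.
- replace (2 * (2 * (eps / M) * Rabs h) * Rabs (d - c)) with
   (eps * Rabs h * (4 * Rabs (d - c) / M)) by (field; lra).
  rewrite <- (Rmult_1_r (eps * Rabs h)) at 2; apply Rmult_le_compat_l.
  + apply Rmult_le_pos; [lra|apply Rabs_pos].
  + apply Rmult_le_reg_r with M; auto; unfold Rdiv; rewrite Rmult_assoc, Rinv_l by lra.
    unfold M; lra.
Qed.

Lemma ccont_swap (F : C -> C) : (forall z, ccont F z) ->
  forall z, ccont (fun z => F (Im z, Re z)) z.
Proof.
intros H z eps e0; destruct (H (Im z, Re z) eps e0) as [d [d0 G]].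
exists d; split; auto; intros w Hw; apply G.
replace (Cmod ((Im w, Re w) - (Im z, Re z))) with (Cmod (w - z)); auto.
unfold Cmod; f_equal; simpl; unfold Re, Im; ring.
Qed.

(** As functions of the upper limit b, both sides have the same derivative, by differentiation under
    the integral sign, and both vanish at b = a. *)
Lemma CInt_Fubini (F : C -> C) (a b c d : R) : (forall z, ccont F z) ->
  CInt (fun x => CInt (fun y => F (x, y)) c d) a b =
  CInt (fun y => CInt (fun x => F (x, y)) a b) c d.
Proof.
intros H.
assert (X : forall t y, rder (fun t => CInt (fun x => F (x, y)) a t) t (F (t, y))).
{ intros t y; apply (rder_CInt (fun x => F (x, y))).
  intros s; apply rcont_comp; [apply H|apply rcont_pair_l]. }
assert (Y : forall t, rder (fun t => CInt (fun y => CInt (fun x => F (x, y)) a t) c d) t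
   (CInt (fun y => F (t, y)) c d)).
{ intros t; apply (rder_CInt_param (fun z => CInt (fun x => F (x, Im z)) a (Re z)) F c d).
  - intros u s _; apply (rcont_CInt_param (fun z => F (Im z, Re z)) a u).
    exact (ccont_swap F H).
  - exact H.
  - intros u s _; exact (X u s). }
rewrite (CInt_FTC _ _ a b (fun t _ => Y t)).
- rewrite (CInt_ext (fun y => CInt (fun x => F (x, y)) a a) (fun _ => RtoC 0)).
  + rewrite CInt_const; ring.
  + intros; apply CInt_point.
- intros t _; now apply rcont_CInt_param.
Qed.

(** * The Cauchy transform *)

Lemma ccont_const (c z : C) : ccont (fun _ => c) z.
Proof. eapply wd_ccont, wd_const. Qed.

Lemma ccont_comp (f h : C -> C) (z : C) :
  ccont f (h z) -> ccont h z -> ccont (fun w => f (h w)) z.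
Proof.
intros Hf Hh eps e0; destruct (Hf eps e0) as [d [d0 F]].
generalize (Hh d d0); apply near_imp; auto.
Qed.

Lemma ccont_plus (f g : C -> C) (z : C) :
  ccont f z -> ccont g z -> ccont (fun w => f w + g w)%C z.
Proof.
intros Hf Hg eps e0.
generalize (near_and _ _ _ (Hf (eps / 2) ltac:(lra)) (Hg (eps / 2) ltac:(lra))).
apply near_imp; intros w [H1 H2].
replace (f w + g w - (f z + g z))%C with ((f w - f z) + (g w - g z))%C by ring.
eapply Rle_lt_trans; [apply Cmod_triangle|lra].
Qed.

Lemma ccont_mult (f g : C -> C) (z : C) :
  ccont f z -> ccont g z -> ccont (fun w => f w * g w)%C z.
Proof.
intros Hf Hg eps e0.
set (P := Cmod (f z) + 1). assert (P0 : 0 < P) by (unfold P; generalize (Cmod_ge_0 (f z)); lra).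
set (Q := Cmod (g z) + 1). assert (Q0 : 0 < Q) by (unfold Q; generalize (Cmod_ge_0 (g z)); lra).
assert (e1 : 0 < eps / (2 * P)) by (apply Rdiv_lt_0_compat; lra).
assert (e2 : 0 < eps / (2 * Q)) by (apply Rdiv_lt_0_compat; lra).
generalize (near_and _ _ _ (Hf _ e2) (near_and _ _ _ (Hg 1 Rlt_0_1) (Hg _ e1))).
apply near_imp; intros w [H1 [H2 H3]].
assert (W : Cmod (g w) <= Q).
{ generalize (Cmod_triangle (g w - g z) (g z)).
  replace (g w - g z + g z)%C with (g w) by ring; unfold Q; lra. }
replace (f w * g w - f z * g z)%C with ((f w - f z) * g w + f z * (g w - g z))%C by ring.
eapply Rle_lt_trans; [apply Cmod_triangle|]; rewrite !Cmod_mult.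
assert (X1 : Cmod (f w - f z) * Cmod (g w) <= Cmod (f w - f z) * Q)
  by (apply Rmult_le_compat_l; [apply Cmod_ge_0|exact W]).
assert (X2 : Cmod (f w - f z) * Q < eps / (2 * Q) * Q) by now apply Rmult_lt_compat_r.
replace (eps / (2 * Q) * Q) with (eps / 2) in X2 by (field; lra).
assert (X3 : Cmod (f z) * Cmod (g w - g z) <= P * (eps / (2 * P))).
{ apply Rmult_le_compat; try apply Cmod_ge_0; [unfold P|]; lra. }
replace (P * (eps / (2 * P))) with (eps / 2) in X3 by (field; lra).
lra.
Qed.

Lemma ccont_conj (f : C -> C) (z : C) : ccont f z -> ccont (fun w => Cconj (f w)) z.
Proof.
intros H; apply (ccont_comp Cconj); auto; eapply wd_ccont, wd_conj.
Qed.

Lemma ccont_scal (c : C) (f : C -> C) (z : C) : ccont f z -> ccont (fun w => c * f w)%C z.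
Proof. intros H; apply ccont_mult; auto using ccont_const. Qed.

Lemma ccont_opp (f : C -> C) (z : C) : ccont f z -> ccont (fun w => - f w)%C z.
Proof.
intros H eps e0; generalize (H eps e0); apply near_imp; intros w Hw.
rewrite Cmod_minus_sym; replace (- f z - - f w)%C with (f w - f z)%C by ring; auto.
Qed.

Lemma ccont_minus (f g : C -> C) (z : C) :
  ccont f z -> ccont g z -> ccont (fun w => f w - g w)%C z.
Proof. intros Hf Hg; apply ccont_plus; auto using ccont_opp. Qed.

Lemma ccont_ext (f g : C -> C) (z : C) :
  near z (fun w => f w = g w) -> ccont f z -> ccont g z.
Proof.
intros E H eps e0.
assert (E0 := near_self _ _ E); simpl in E0.
generalize (near_and _ _ _ E (H eps e0)); apply near_imp.
intros w [<- H1]; now rewrite <- E0.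
Qed.

Lemma ccont_Re (g : R -> C) (z : C) : rcont g (Re z) -> ccont (fun w => g (Re w)) z.
Proof.
intros H eps e0; destruct (H eps e0) as [e [p G]]; exists e; split; auto.
intros w Hw; apply G; eapply Rle_lt_trans; [|exact Hw].
eapply Rle_trans; [|apply re_le_Cmod]; right; f_equal.
Qed.

Lemma ccont_Im (g : R -> C) (z : C) : rcont g (Im z) -> ccont (fun w => g (Im w)) z.
Proof.
intros H eps e0; destruct (H eps e0) as [e [p G]]; exists e; split; auto.
intros w Hw; apply G; eapply Rle_lt_trans; [|exact Hw].
eapply Rle_trans; [|apply Cmod_Im_le]; right; f_equal.
Qed.

Definition cis (t : R) : C := (cos t, sin t).

Lemma rder_cis (t : R) : rder cis t (Ci * cis t).
Proof.
apply rder_iff; split; unfold cis, Re, Im; simpl; auto_derive; auto; ring.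
Qed.

Lemma rcont_cis (t : R) : rcont cis t.
Proof. eapply rder_rcont, rder_cis. Qed.

Lemma Cmod_cis (t : R) : Cmod (cis t) = 1.
Proof.
unfold Cmod, cis; simpl; rewrite !Rmult_1_r, <- sqrt_1; f_equal.
generalize (sin2_cos2 t); unfold Rsqr; lra.
Qed.

Lemma cis_conj (t : R) : (cis t * Cconj (cis t))%C = RtoC 1.
Proof.
rewrite <- Cmod2_conj, Cmod_cis; f_equal; ring.
Qed.

(** The polar coordinates (r, t) are packed into the single complex number [p], so that joint
    continuity in them is [ccont]. *)
Definition polar (z p : C) : C := (z - RtoC (Re p) * cis (Im p))%C.

Lemma ccont_polar (z p : C) : ccont (polar z) p.
Proof.
apply ccont_minus; [apply ccont_const|apply ccont_mult].
- apply ccont_Re; eapply rder_rcont, rder_RtoC.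
- apply ccont_Im, rcont_cis.
Qed.

Lemma polar_plus (z k p : C) : polar (z + k)%C p = (polar z p + k)%C.
Proof. unfold polar; ring. Qed.

Lemma Cmod_polar (z p : C) : 0 <= Re p <= 2 -> Cmod (polar z p) <= Cmod z + 2.
Proof.
intros H; unfold polar; eapply Rle_trans; [apply Cmod_triangle_minus|].
rewrite Cmod_mult, Cmod_cis, Cmod_R, Rabs_right; lra.
Qed.

(** The measure is dr dt without the Jacobian r, which the factor 1/r of the Cauchy kernel
    cancels. *)
Definition DInt (F : C -> C) : C :=
  CInt (fun r => CInt (fun t => F (r, t)) 0 (2 * PI)) 0 2.

Lemma rcont_on_slice (F : C -> C) (x a b : R) : (forall z, ccont F z) ->
  rcont_on (fun t => F (x, t)) a b.
Proof. intros H t _; apply rcont_comp; [apply H|apply rcont_pair_r]. Qed.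

Lemma DInt_minus (F G : C -> C) : (forall z, ccont F z) -> (forall z, ccont G z) ->
  DInt (fun p => F p - G p)%C = (DInt F - DInt G)%C.
Proof.
intros HF HG; unfold DInt; rewrite <- CInt_minus.
- apply CInt_ext; intros r _; apply CInt_minus; now apply rcont_on_slice.
- intros r _; now apply rcont_CInt_param.
- intros r _; now apply rcont_CInt_param.
Qed.

Lemma DInt_scal (c : C) (F : C -> C) : (forall z, ccont F z) ->
  DInt (fun p => c * F p)%C = (c * DInt F)%C.
Proof.
intros HF; unfold DInt; rewrite <- CInt_scal.
- apply CInt_ext; intros r _; apply CInt_scal; now apply rcont_on_slice.
- intros r _; now apply rcont_CInt_param.
Qed.

(** Each integral contributes twice the length of its interval: 4 for the radius, 4 pi for the
    angle. *)
Lemma DInt_bound (F : C -> C) (M : R) : (forall z, ccont F z) ->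
  (forall p, 0 <= Re p <= 2 -> Cmod (F p) <= M) -> Cmod (DInt F) <= 16 * PI * M.
Proof.
intros HF HM; generalize PI_RGT_0; intros P.
eapply Rle_trans; [apply (CInt_bound _ _ _ (2 * M * (2 * PI)))|].
- intros r _; now apply rcont_CInt_param.
- rewrite Rmin_left, Rmax_right by lra; intros r Hr.
  eapply Rle_trans; [apply (CInt_bound _ _ _ M)|].
  + now apply rcont_on_slice.
  + intros t _; apply HM; exact Hr.
  + rewrite Rminus_0_r, (Rabs_right (2 * PI)) by lra; lra.
- rewrite Rminus_0_r, (Rabs_right 2) by lra; right; ring.
Qed.

(** The Cauchy transform (1/pi) int g(w) / (z - w) dA(w) in polar coordinates
    w = z - r exp(it) centred at [z], where the kernel loses its singularity.
    Radii up to 2 suffice for [z] and the support of [g] in the unit disk. *)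
Definition cauchy_transform (g : C -> C) (z : C) : C :=
  (/ RtoC PI * DInt (fun p => g (polar z p) * Cconj (cis (Im p))))%C.

Lemma ccont_cauchy_integrand (g : C -> C) (z : C) : (forall z, ccont g z) ->
  forall p, ccont (fun p => g (polar z p) * Cconj (cis (Im p)))%C p.
Proof.
intros H p; apply ccont_mult.
- apply (ccont_comp g); [apply H|apply ccont_polar].
- apply ccont_conj, ccont_Im, rcont_cis.
Qed.

Lemma cauchy_transform_minus (f g : C -> C) (z : C) :
  (forall z, ccont f z) -> (forall z, ccont g z) ->
  cauchy_transform (fun w => f w - g w)%C z = (cauchy_transform f z - cauchy_transform g z)%C.
Proof.
intros Hf Hg; unfold cauchy_transform.
transitivity (/ RtoC PI * (DInt (fun p => f (polar z p) * Cconj (cis (Im p))) -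
   DInt (fun p => g (polar z p) * Cconj (cis (Im p)))))%C; [|ring].
rewrite <- DInt_minus by now apply ccont_cauchy_integrand.
f_equal; unfold DInt; apply CInt_ext; intros r _; apply CInt_ext; intros; ring.
Qed.

Lemma RtoC_neq0 (x : R) : x <> 0 -> RtoC x <> RtoC 0.
Proof. intros H E; apply H; now apply RtoC_inj. Qed.

(** In coordinates centred at [z], moving [z] by k translates the argument of [g] by k and leaves
    the kernel alone, so the derivatives fall on [g]. *)
Lemma wd_cauchy_transform (g ga gb : C -> C) (z : C) :
  (forall z, ccont g z) -> (forall z, ccont ga z) -> (forall z, ccont gb z) ->
  (forall z, wd g z (ga z) (gb z)) -> wd (cauchy_transform g) z (cauchy_transform ga z) (cauchy_transform gb z).
Proof.
intros Hg Ha Hb D eps e0; generalize PI_RGT_0; intros P.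
(* The integrand will be bounded by 4 (eps/64) |k|; the factor 16 pi of [DInt_bound] and the
   prefactor 1/pi bring this to eps |k|. *)
assert (e1 : 0 < eps / 64) by lra.
destruct (ccont_unif ga (Cmod z + 2) _ Ha e1) as [d1 [p1 U1]].
destruct (ccont_unif gb (Cmod z + 2) _ Hb e1) as [d2 [p2 U2]].
exists (Rmin d1 d2); split; [now apply Rmin_pos|]; intros k Hk.
set (I := fun (f : C -> C) p => (f (polar z p) * Cconj (cis (Im p)))%C).
assert (CI : forall f, (forall z, ccont f z) -> forall p, ccont (I f) p)
  by (intros; now apply ccont_cauchy_integrand).
assert (Hgk : forall w, ccont (fun w => g (w + k)%C) w).
{ intros w; apply (ccont_comp g); [apply Hg|apply ccont_plus; [|apply ccont_const]].
  eapply wd_ccont, wd_id. }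
set (h := fun w => (g (w + k)%C - g w - (k * ga w + Cconj k * gb w))%C).
assert (Hh : forall w, ccont h w).
{ intros w; unfold h; apply ccont_minus; [now apply ccont_minus|].
  apply ccont_plus; now apply ccont_scal. }
replace (cauchy_transform g (z + k) - cauchy_transform g z - (cauchy_transform ga z * k + cauchy_transform gb z * Cconj k))%C
 with (/ RtoC PI * DInt (I h))%C.
- rewrite Cmod_mult, Cmod_inv, Cmod_R, Rabs_right by (lra || (apply RtoC_neq0; lra)).
  assert (B : Cmod (DInt (I h)) <= 16 * PI * (4 * (eps / 64) * Cmod k)).
  { apply DInt_bound; auto; intros p Hp; unfold I.
    rewrite Cmod_mult, Cmod_conj, Cmod_cis, Rmult_1_r; unfold h.
    set (w := polar z p).
    assert (Hw : Cmod w <= Cmod z + 2) by now apply Cmod_polar.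
    assert (M := rder_mvt (fun s => g (w + RtoC s * k)%C)
      (fun s => ga (w + RtoC s * k) * k + gb (w + RtoC s * k) * Cconj k)%C 0 1
      (2 * (eps / 64) * Cmod k) (ga w * k + gb w * Cconj k)%C).
    rewrite Rminus_0_r, Rabs_R1 in M.
    replace (w + RtoC 1 * k)%C with (w + k)%C in M by ring.
    replace (w + RtoC 0 * k)%C with w in M by ring.
    replace (k * ga w + Cconj k * gb w)%C with (RtoC 1 * (ga w * k + gb w * Cconj k))%C by ring.
    replace (4 * (eps / 64) * Cmod k) with (2 * (2 * (eps / 64) * Cmod k) * 1) by ring.
    apply M.
    - intros t _; apply (wd_rder g (fun s => w + RtoC s * k)%C); auto using rder_affine.
    - rewrite Rmin_left, Rmax_right by lra; intros t Ht.
      assert (K : Cmod (w + RtoC t * k - w) < Rmin d1 d2).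
      { replace (w + RtoC t * k - w)%C with (RtoC t * k)%C by ring.
        rewrite Cmod_mult, Cmod_R, Rabs_right by lra.
        generalize (Cmod_ge_0 k); nra. }
      assert (V1 := U1 w _ Hw (Rlt_le_trans _ _ _ K (Rmin_l _ _))).
      assert (V2 := U2 w _ Hw (Rlt_le_trans _ _ _ K (Rmin_r _ _))).
      match goal with |- Cmod ?u <= _ => replace u with
       ((ga (w + RtoC t * k) - ga w) * k + (gb (w + RtoC t * k) - gb w) * Cconj k)%C by ring end.
      eapply Rle_trans; [apply Cmod_triangle|].
      rewrite !Cmod_mult, Cmod_conj; generalize (Cmod_ge_0 k); nra. }
  apply Rle_trans with (/ PI * (16 * PI * (4 * (eps / 64) * Cmod k))).
  + apply Rmult_le_compat_l; [left; now apply Rinv_0_lt_compat|exact B].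
  + right; field; lra.
- unfold cauchy_transform; fold (I g) (I ga) (I gb).
  transitivity (/ RtoC PI * (DInt (I (fun w => g (w + k)%C)) - DInt (I g)
    - (k * DInt (I ga) + Cconj k * DInt (I gb))))%C.
  + f_equal; rewrite <- !DInt_scal, <- !DInt_minus by auto.
    replace (DInt (fun p => k * I ga p)%C + DInt (fun p => Cconj k * I gb p)%C)%C with
     (DInt (fun p => k * I ga p)%C - DInt (fun p => - Cconj k * I gb p)%C)%C
     by (rewrite !DInt_scal by auto; ring).
    rewrite <- !DInt_minus by auto using ccont_scal, ccont_minus.
    unfold DInt; apply CInt_ext; intros r _; apply CInt_ext; intros t _; unfold I, h; ring.
  + replace (DInt (I (fun w => g (w + k)%C))) with
     (DInt (fun p => g (polar (z + k) p) * Cconj (cis (Im p)))%C); [ring|].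
    unfold DInt; apply CInt_ext; intros r _; apply CInt_ext; intros t _.
    now rewrite polar_plus.
Qed.

Lemma cis_2PI (t : R) : cis (t + 2 * PI) = cis t.
Proof. unfold cis; now rewrite cos_plus, sin_plus, cos_2PI, sin_2PI, !Rmult_1_r, !Rmult_0_r, Rminus_0_r, Rplus_0_r. Qed.

(** On the circle of radius r the angular derivative of [g] integrates to 0,
    so that the [ga] and [gb] contributions to the radial derivative of the
    circle mean agree; the radial integral then telescopes. *)
Lemma cauchy_transform_dbar (g ga gb : C -> C) (z : C) :
  (forall z, ccont g z) -> (forall z, ccont ga z) -> (forall z, ccont gb z) ->
  (forall z, wd g z (ga z) (gb z)) -> (forall w, 1 <= Cmod w -> g w = RtoC 0) ->
  Cmod z < 1 -> cauchy_transform gb z = g z.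
Proof.
intros Hg Ha Hb D S Hz; generalize PI_RGT_0; intros P.
set (J := fun (f e : C -> C) p => (f (polar z p) * e (cis (Im p)))%C).
assert (CJ : forall f e, (forall z, ccont f z) -> (forall z, ccont e z) -> forall p, ccont (J f e) p).
{ intros f e Hf He p; apply ccont_mult.
  - apply (ccont_comp f); [apply Hf|apply ccont_polar].
  - apply (ccont_comp e); [apply He|apply ccont_Im, rcont_cis]. }
assert (Cid : forall w, ccont (fun w => w) w) by (intros; eapply wd_ccont, wd_id).
assert (Ccj : forall w, ccont Cconj w) by (intros; eapply wd_ccont, wd_conj).
set (m := fun r => CInt (fun t => g (polar z (r, t))) 0 (2 * PI)).
set (A := fun r => CInt (fun t => J ga (fun w => w) (r, t)) 0 (2 * PI)).
set (B := fun r => CInt (fun t => J gb Cconj (r, t)) 0 (2 * PI)).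
assert (Dm : forall r, rder m r (- (A r + B r))).
{ intros r; eapply rder_eq.
  - apply (rder_CInt_param (fun p => g (polar z p))
      (fun p => - 1 * (J ga (fun w => w) p + J gb Cconj p))%C).
    + intros x; apply (rcont_on_slice (fun p => g (polar z p))); intros p.
      apply (ccont_comp g); [apply Hg|apply ccont_polar].
    + intros p; apply ccont_scal, ccont_plus; auto.
    + intros x y _; unfold J, polar; simpl.
      eapply rder_eq.
      * apply (wd_rder g (fun x => z - RtoC x * cis y)%C); [apply D|].
        eapply rder_eq with (d := (- cis y)%C); [|reflexivity].
        intros eps e0; destruct (rder_affine z (- cis y) x eps e0) as [d [d0 G]].
        exists d; split; auto; intros h Hh; specialize (G h Hh).
        eapply Rle_trans; [|exact G]; right; f_equal; ring.
      * rewrite Copp_conj; unfold Re, Im; simpl; ring.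
  - rewrite CInt_scal, CInt_plus; [unfold A, B; ring|..].
    + apply (rcont_on_slice (J ga (fun w => w))); auto.
    + apply (rcont_on_slice (J gb Cconj)); auto.
    + apply (rcont_on_slice (fun p => J ga (fun w => w) p + J gb Cconj p)%C).
      intros p; apply ccont_plus; auto. }
assert (AB : forall r, 0 < r -> A r = B r).
{ intros r Hr.
  assert (E : CInt (fun t => RtoC r * Ci * (J gb Cconj (r, t) - J ga (fun w => w) (r, t)))%C 0 (2 * PI)
    = RtoC 0).
  { rewrite (CInt_FTC (fun t => g (polar z (r, t)))).
    - replace (polar z (r, 2 * PI)) with (polar z (r, 0)); [ring|].
      unfold polar, Im; simpl; replace (2 * PI) with (0 + 2 * PI) by ring; now rewrite cis_2PI.
    - intros t _; eapply rder_eq.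
      + apply (wd_rder g (fun t => polar z (r, t))); [apply D|].
        eapply (rder_eq _ _ _ (- (RtoC r * (Ci * cis t)))%C).
        * apply (wd_rder (fun w => z - RtoC r * w)%C cis); [|apply rder_cis].
          apply (wd_minus (fun _ => z) (fun w => RtoC r * w)%C);
            [apply wd_const|apply wd_scal, wd_id].
        * ring.
      + unfold J; simpl; rewrite Copp_conj, !Cmult_conj, Cconj_Ci, Cconj_RtoC.
        unfold Im; simpl; ring.
    - apply (rcont_on_slice (fun p => RtoC r * Ci * (J gb Cconj p - J ga (fun w => w) p))%C).
      intros p; apply ccont_scal, ccont_minus; auto. }
  rewrite CInt_scal, CInt_minus in E.
  - fold (A r) (B r) in E.
    assert (N : (RtoC r * Ci)%C <> RtoC 0) by (apply Cmult_neq_0; [apply RtoC_neq0; lra|apply Ci_nz]).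
    assert (X : (B r - A r)%C = RtoC 0).
    { transitivity (/ (RtoC r * Ci) * (RtoC r * Ci * (B r - A r)))%C.
      - field; split; [apply Ci_nz|apply RtoC_neq0; lra].
      - rewrite E; ring. }
    symmetry; now apply Ceq_minus.
  - apply (rcont_on_slice (J gb Cconj)); auto.
  - apply (rcont_on_slice (J ga (fun w => w))); auto.
  - apply (rcont_on_slice (fun p => J gb Cconj p - J ga (fun w => w) p)%C).
      intros p; apply ccont_minus; auto. }
assert (E : CInt (fun r => - (A r + B r))%C 0 2 = (m 2 - m 0)%C).
{ apply CInt_FTC; [intros t _; apply Dm|].
  intros t _; apply (rcont_comp Copp (fun r => A r + B r)%C).
  - apply (ccont_opp (fun w => w)), Cid.
  - apply rcont_plus; apply rcont_CInt_param; auto. }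
(* With A = B the radial derivative of [m] is -2 B, so -2 times the radial integral of B equals m(2)
   - m(0), which is - 2 pi g(z). *)
rewrite (CInt_ext _ (fun r => - (2) * B r)%C) in E.
2:{ rewrite Rmin_left, Rmax_right by lra; intros t Ht; rewrite AB by lra; ring. }
rewrite CInt_scal in E by (intros t _; apply rcont_CInt_param; auto).
assert (M0 : m 0 = (RtoC (2 * PI) * g z)%C).
{ unfold m; rewrite (CInt_ext _ (fun _ => g z)).
  - rewrite CInt_const; do 2 f_equal; ring.
  - intros t _; f_equal; unfold polar, Re; simpl; ring. }
assert (M2 : m 2 = RtoC 0).
(* Since |z| < 1, the circle of radius 2 about [z] lies where [g] vanishes. *)
{ unfold m; rewrite (CInt_ext _ (fun _ => RtoC 0)); [rewrite CInt_const; ring|].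
  intros t _; apply S; unfold polar; rewrite Cmod_minus_sym.
  eapply Rle_trans; [|apply Cmod_triangle_inv].
  rewrite Cmod_mult, Cmod_cis, Cmod_R; unfold Re, Im; simpl; rewrite Rabs_right; lra. }
rewrite M0, M2 in E.
change (cauchy_transform gb z) with (/ RtoC PI * CInt B 0 2)%C.
rewrite RtoC_mult in E.
assert (N : RtoC PI <> RtoC 0) by (apply RtoC_neq0; lra).
replace (CInt B 0 2) with (- / RtoC 2 * (- RtoC 2 * CInt B 0 2))%C by (field; auto).
replace (- RtoC 2 * CInt B 0 2)%C with (RtoC 0 - RtoC 2 * RtoC PI * g z)%C by (symmetry; exact E).
field; auto.
Qed.

(** For integrands with a peaked majorant, where the sup bound times the length is too weak; the
    majorant enters through its primitive [m]. *)
Lemma CInt_bound_derive (f : R -> C) (m m' : R -> R) (a b : R) : a <= b ->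
  rcont_on f a b -> (forall t, is_derive m t (m' t)) -> (forall t, continuous m' t) ->
  (forall t, a <= t <= b -> Cmod (f t) <= m' t) -> Cmod (CInt f a b) <= 2 * (m b - m a).
Proof.
intros ab Hf D Cm B; destruct (rcont_on_ex _ _ _ Hf) as [F1 F2].
assert (I : is_RInt m' a b (m b - m a))
 by (apply (is_RInt_derive (V := R_CompleteNormedModule) m m'); auto).
assert (A : forall u, ex_RInt u a b -> (forall t, a <= t <= b -> Rabs (u t) <= m' t) ->
  Rabs (RInt u a b) <= m b - m a).
{ intros u U V; eapply Rle_trans; [now apply abs_RInt_le|].
  rewrite <- (is_RInt_unique _ _ _ _ I); apply RInt_le; auto.
  - now apply (ex_RInt_norm u a b).
  - eexists; exact I.
  - intros t Ht; apply V; lra. }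
assert (A1 := A _ F1 (fun t Ht => Rle_trans _ _ _ (re_le_Cmod _) (B t Ht))).
assert (A2 := A _ F2 (fun t Ht => Rle_trans _ _ _ (Cmod_Im_le _) (B t Ht))).
eapply Rle_trans; [apply Cmod_le_abs_sum|].
change (Rabs (RInt (fun t => Re (f t)) a b) + Rabs (RInt (fun t => Im (f t)) a b)
  <= 2 * (m b - m a)); lra.
Qed.

(** Along each ray from [z] the integrand is supported on a chord of the disk
    of radius [rho]; a Poisson kernel dominates the indicator of that chord. *)
Lemma cauchy_transform_bound (g : C -> C) (z : C) (B rho : R) : (forall z, ccont g z) -> 0 < rho ->
  (forall w, Cmod (g w) <= B) -> (forall w, rho <= Cmod w -> g w = RtoC 0) ->
  Cmod (cauchy_transform g z) <= 16 * PI * B * rho.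
Proof.
intros Hg r0 HB S; generalize PI_RGT_0; intros P.
assert (B0 : 0 <= B) by (eapply Rle_trans; [apply Cmod_ge_0|apply (HB z)]).
(* The order is exchanged so that the radius is integrated first, along a ray of fixed angle. *)
unfold cauchy_transform, DInt; rewrite (CInt_Fubini (fun p => g (polar z p) * Cconj (cis (Im p)))%C)
 by now apply ccont_cauchy_integrand.
rewrite Cmod_mult, Cmod_inv, Cmod_R, Rabs_right by (lra || (apply RtoC_neq0; lra)).
match goal with |- _ * Cmod ?u <= _ => assert (X : Cmod u <= 2 * (4 * PI * B * rho) * Rabs (2 * PI - 0)) end.
{ assert (Hc := ccont_cauchy_integrand g z Hg).
  apply CInt_bound.
  - intros t _.
    apply (rcont_CInt_param (fun q => g (polar z (Im q, Re q)) * Cconj (cis (Re q)))%C 0 2 t).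
    exact (ccont_swap _ Hc).
  - intros t _.
    (* [x] is the radius at which the line carrying the ray is closest to 0. The modulus at radius r
       is at least |r - x|, so the chord lies in |r - x| < rho, where the majorant 2B / (1 + ((r -
       x)/rho)^2) is at least B. Its primitive is an arctangent and varies by at most 2 pi B rho. *)
    set (x := Re (z * Cconj (cis t))%C).
    eapply Rle_trans; [apply (CInt_bound_derive _ (fun r => 2 * B * rho * atan ((r - x) / rho))
      (fun r => 2 * B / (1 + ((r - x) / rho) ^ 2)))|].
    + lra.
    + intros r _; apply (rcont_comp (fun p => g (polar z p) * Cconj (cis (Im p)))%C (fun r => (r, t))); [apply Hc|apply rcont_pair_l].
    + intros r; auto_derive; auto; unfold Rsqr; field; split; try lra.
      apply Rgt_not_eq; generalize (pow2_ge_0 ((r - x) / rho)).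
      replace (rho ^ 2 + (r - x) ^ 2) with (rho ^ 2 * (1 + ((r - x) / rho) ^ 2)) by (field; lra).
      intros; apply Rmult_lt_0_compat; [nra|lra].
    + intros r; apply @ex_derive_continuous; auto_derive.
      generalize (pow2_ge_0 ((r - x) / rho)); simpl; unfold Rdiv, Rminus; lra.
    + intros r _; rewrite Cmod_mult, Cmod_conj, Cmod_cis, Rmult_1_r.
      generalize (pow2_ge_0 ((r - x) / rho)); intros Q.
      destruct (Rlt_le_dec (Cmod (polar z (r, t))) rho) as [L|L].
      * eapply Rle_trans; [apply HB|].
        assert (Y : Rabs (r - x) < rho).
        { eapply Rle_lt_trans; [|exact L].
          replace (Cmod (polar z (r, t))) with (Cmod (Cconj (cis t) * polar z (r, t)))
            by (rewrite Cmod_mult, Cmod_conj, Cmod_cis; ring).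
          eapply Rle_trans; [|apply re_le_Cmod]; right; rewrite <- Rabs_Ropp; f_equal.
          unfold polar.
          replace (Cconj (cis t) * (z - RtoC (Re (r, t)) * cis (Im (r, t))))%C with
           (z * Cconj (cis t) - RtoC r * (cis t * Cconj (cis t)))%C by (unfold Re, Im; simpl; ring).
          rewrite cis_conj; unfold x.
          unfold Re, Cminus, Cplus, Copp; simpl; ring. }
        assert (Y2 : ((r - x) / rho) ^ 2 <= 1).
        { apply Rle_trans with (Rabs ((r - x) / rho) ^ 2); [right; symmetry; apply pow2_abs|].
          replace 1 with (1 ^ 2) by ring; apply pow_incr; split; [apply Rabs_pos|].
          unfold Rdiv; rewrite Rabs_mult, (Rabs_right (/ rho)).
          2: apply Rle_ge; left; now apply Rinv_0_lt_compat.
          apply Rmult_le_reg_r with rho; auto.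
          rewrite Rmult_assoc, Rinv_l by lra; lra. }
        apply Rmult_le_reg_r with (1 + ((r - x) / rho) ^ 2); [lra|].
        unfold Rdiv at 2; rewrite Rmult_assoc, Rinv_l by lra; nra.
      * rewrite S, Cmod_0 by auto.
        apply Rmult_le_pos; [lra|left; apply Rinv_0_lt_compat; lra].
    + cbn beta.
      generalize (atan_bound ((2 - x) / rho)) (atan_bound ((0 - x) / rho)); intros [A1 A2] [A3 A4].
      assert (0 <= B * rho) by (apply Rmult_le_pos; lra).
      assert (B * rho * (atan ((2 - x) / rho) - atan ((0 - x) / rho)) <= B * rho * PI)
       by (apply Rmult_le_compat_l; lra).
      lra. }
rewrite Rminus_0_r, (Rabs_right (2 * PI)) in X by lra.
apply Rle_trans with (/ PI * (2 * (4 * PI * B * rho) * (2 * PI))).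
- apply Rmult_le_compat_l; [left; now apply Rinv_0_lt_compat|exact X].
- right; field; lra.
Qed.

(** * Goursat's theorem and primitives *)

Lemma nested_intervals (u l : nat -> R) :
  (forall n, u n <= u (S n)) -> (forall n, u (S n) + l (S n) <= u n + l n) ->
  (forall n, 0 <= l n) -> exists x, forall n, u n <= x <= u n + l n.
Proof.
intros H1 H2 H3.
assert (U : forall n k, u n <= u (n + k)%nat).
{ intros n k; induction k; [rewrite Nat.add_0_r; lra|].
  rewrite Nat.add_succ_r; generalize (H1 (n + k)%nat); lra. }
assert (V : forall n k, u (n + k)%nat + l (n + k)%nat <= u n + l n).
{ intros n k; induction k; [rewrite Nat.add_0_r; lra|].
  rewrite Nat.add_succ_r; generalize (H2 (n + k)%nat); lra. }
assert (W : forall m n, u m <= u n + l n).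
{ intros m n; destruct (Nat.le_gt_cases m n) as [L|L].
  - generalize (U m (n - m)%nat) (H3 n); replace (m + (n - m))%nat with n by lia; lra.
  - generalize (V n (m - n)%nat) (H3 m); replace (n + (m - n))%nat with m by lia; lra. }
destruct (completeness (fun x => exists n, x = u n)) as [x [X1 X2]].
- exists (u O + l O); intros y [n ->]; apply W.
- exists (u O); now exists O.
- exists x; intros n; split; [apply X1; now exists n|].
  apply X2; intros y [m ->]; apply W.
Qed.

Lemma pow_half_lt (L e : R) : 0 <= L -> 0 < e -> exists n, L * (/ 2) ^ n < e.
Proof.
intros L0 e0.
destruct (pow_lt_1_zero (/ 2) ltac:(rewrite Rabs_right; lra) (e / (L + 1))) as [n Hn].
{ apply Rdiv_lt_0_compat; lra. }
exists n; specialize (Hn n (le_n n)); rewrite Rabs_right in Hn by (apply Rle_ge, pow_le; lra).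
assert (0 <= (/ 2) ^ n) by (apply pow_le; lra).
apply Rmult_lt_compat_l with (r := L + 1) in Hn; [|lra].
replace ((L + 1) * (e / (L + 1))) with e in Hn by (field; lra); nra.
Qed.

(** Cousin's lemma for rectangles of a fixed shape. *)
Lemma rect_induction (P : R -> R -> R -> R -> Prop) (a b c d : R) :
  a < b -> c < d ->
  (forall a' b' c' d', a <= a' -> a' <= b' -> b' <= b -> c <= c' -> c' <= d' -> d' <= d ->
    let m := (a' + b') / 2 in let n := (c' + d') / 2 in
    P a' m c' n -> P m b' c' n -> P a' m n d' -> P m b' n d' -> P a' b' c' d') ->
  (forall x y, a <= x <= b -> c <= y <= d -> exists e, 0 < e /\
    forall a' b' c' d', a <= a' <= x -> x <= b' <= b -> c <= c' <= y -> y <= d' <= d ->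
      a' < b' -> c' < d' ->
      b' - a' < e -> d' - c' < e -> (b' - a') * (d - c) = (d' - c') * (b - a) ->
      P a' b' c' d') ->
  P a b c d.
Proof.
intros ab cd quad loc; apply NNPP; intros NP.
set (L := fun n => (b - a) * (/ 2) ^ n); set (H := fun n => (d - c) * (/ 2) ^ n).
assert (p2 : forall n, 0 < (/ 2) ^ n) by (intros; apply pow_lt; lra).
assert (L0 : forall n, 0 < L n) by (intros; apply Rmult_lt_0_compat; auto; lra).
assert (H0 : forall n, 0 < H n) by (intros; apply Rmult_lt_0_compat; auto; lra).
assert (LS : forall n, L n = L (S n) + L (S n)) by (intros; unfold L; simpl; field).
assert (HS : forall n, H n = H (S n) + H (S n)) by (intros; unfold H; simpl; field).
(* A stage is stored by its lower left corner alone: the side lengths depend only on n, which keeps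
   all rectangles similar to the first. *)
set (Bad := fun n (q : R * R) => a <= fst q /\ fst q + L n <= b /\ c <= snd q /\
  snd q + H n <= d /\ ~ P (fst q) (fst q + L n) (snd q) (snd q + H n)).
assert (step : forall n q, Bad n q -> exists q', Bad (S n) q' /\
  (fst q <= fst q' <= fst q + L (S n)) /\ (snd q <= snd q' <= snd q + H (S n))).
{ intros n [x y] [B1 [B2 [B3 [B4 B5]]]]; simpl in *.
  apply NNPP; intros N; apply B5.
  assert (K : forall x' y', x <= x' <= x + L (S n) -> y <= y' <= y + H (S n) ->
    P x' (x' + L (S n)) y' (y' + H (S n))).
  { intros x' y' X Y; apply NNPP; intros NP'; apply N; exists (x', y').
    unfold Bad; simpl; rewrite LS in B2; rewrite HS in B4.
    repeat split; try lra; exact NP'. }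
  assert (l0 := L0 (S n)); assert (h0 := H0 (S n)).
  assert (E1 : (x + (x + L n)) / 2 = x + L (S n)) by (rewrite LS; field).
  assert (E2 : (y + (y + H n)) / 2 = y + H (S n)) by (rewrite HS; field).
  assert (E3 : x + L n = x + L (S n) + L (S n)) by (rewrite LS; ring).
  assert (E4 : y + H n = y + H (S n) + H (S n)) by (rewrite HS; ring).
  apply quad; try lra; cbv zeta; rewrite ?E1, ?E2.
  - apply K; lra.
  - rewrite E3; apply K; lra.
  - rewrite E4; apply K; lra.
  - rewrite E3, E4; apply K; lra. }
assert (B0 : Bad O (a, c)).
{ unfold Bad, L, H; simpl; rewrite !Rmult_1_r.
  replace (a + (b - a)) with b by ring; replace (c + (d - c)) with d by ring.
  repeat split; try lra; exact NP. }
(* Dependent choice of a bad quarter inside each bad rectangle. The nested sequence shrinks to a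
   point, where [loc] gives the contradiction. *)
set (next := fun n (s : {q | Bad n q}) =>
  let t := constructive_indefinite_description _ (step n (proj1_sig s) (proj2_sig s)) in
  exist (Bad (S n)) (proj1_sig t) (proj1 (proj2_sig t))).
set (Q := fix Q n : {q | Bad n q} := match n with
  O => exist _ _ B0 | S m => next m (Q m) end).
set (u := fun n => fst (proj1_sig (Q n))); set (v := fun n => snd (proj1_sig (Q n))).
assert (N : forall n, (u n <= u (S n) <= u n + L (S n)) /\ (v n <= v (S n) <= v n + H (S n))).
{ intros n; unfold u, v; simpl; unfold next; simpl.
  destruct (constructive_indefinite_description _ _) as [q Hq]; simpl; exact (proj2 Hq). }
destruct (nested_intervals u L) as [x Hx].
{ intros n; apply N. }
{ intros n; rewrite (LS n); generalize (N n); lra. }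
{ intros n; generalize (L0 n); lra. }
destruct (nested_intervals v H) as [y Hy].
{ intros n; apply N. }
{ intros n; rewrite (HS n); generalize (N n); lra. }
{ intros n; generalize (H0 n); lra. }
assert (BQ : forall n, Bad n (u n, v n)).
{ intros n; generalize (proj2_sig (Q n)); unfold u, v; now destruct (proj1_sig (Q n)). }
assert (Hx0 := Hx O). assert (Hy0 := Hy O).
destruct (loc x y) as [e [e0 G]].
{ destruct (BQ O) as [K1 [K2 _]]; simpl in *; lra. }
{ destruct (BQ O) as [_ [_ [K1 [K2 _]]]]; simpl in *; lra. }
destruct (pow_half_lt (b - a + (d - c)) e) as [n Hn]; [lra|exact e0|].
destruct (BQ n) as [K1 [K2 [K3 [K4 K5]]]]; simpl in *; apply K5.
generalize (Hx n) (Hy n) (L0 n) (H0 n); intros.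
apply G; try lra.
- unfold L in *; generalize (p2 n); nra.
- unfold H in *; generalize (p2 n); nra.
- unfold L, H; ring.
Qed.

(** The counterclockwise boundary integral, with dz = dx on horizontal and dz = i dy on vertical
    sides. The formula is also applied with a > b or c > d, which changes its sign. *)
Definition rect_int (f : C -> C) (a b c d : R) : C :=
  (CInt (fun x => f (x, c)) a b + Ci * CInt (fun y => f (b, y)) c d
   - CInt (fun x => f (x, d)) a b - Ci * CInt (fun y => f (a, y)) c d)%C.

Definition in_rect (a b c d : R) (z : C) : Prop := a <= Re z <= b /\ c <= Im z <= d.

Lemma rcont_on_hor (f : C -> C) (a b c d y a' b' : R) :
  (forall z, in_rect a b c d z -> ccont f z) -> c <= y <= d -> a <= a' <= b -> a <= b' <= b ->
  rcont_on (fun x => f (x, y)) a' b'.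
Proof.
intros H Hy Ha Hb t Ht; apply rcont_comp; [apply H|apply rcont_pair_l].
split; simpl; auto; revert Ht; unfold Re, Rmin, Rmax; simpl; repeat destruct Rle_dec; lra.
Qed.

Lemma rcont_on_ver (f : C -> C) (a b c d x c' d' : R) :
  (forall z, in_rect a b c d z -> ccont f z) -> a <= x <= b -> c <= c' <= d -> c <= d' <= d ->
  rcont_on (fun y => f (x, y)) c' d'.
Proof.
intros H Hy Ha Hb t Ht; apply rcont_comp; [apply H|apply rcont_pair_r].
split; simpl; auto; revert Ht; unfold Im, Rmin, Rmax; simpl; repeat destruct Rle_dec; lra.
Qed.

Lemma rect_int_splitx (f : C -> C) (a b c d m : R) :
  (forall z, in_rect a b c d z -> ccont f z) -> a <= m <= b -> c <= d ->
  rect_int f a b c d = (rect_int f a m c d + rect_int f m b c d)%C.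
Proof.
intros H Hm Hc; unfold rect_int.
rewrite <- (CInt_Chasles (fun x => f (x, c)) a m b), <- (CInt_Chasles (fun x => f (x, d)) a m b);
 try (apply (rcont_on_hor _ a b c d); auto; lra); ring.
Qed.

Lemma rect_int_splity (f : C -> C) (a b c d m : R) :
  (forall z, in_rect a b c d z -> ccont f z) -> c <= m <= d -> a <= b ->
  rect_int f a b c d = (rect_int f a b c m + rect_int f a b m d)%C.
Proof.
intros H Hm Hc; unfold rect_int.
rewrite <- (CInt_Chasles (fun y => f (a, y)) c m d), <- (CInt_Chasles (fun y => f (b, y)) c m d);
 try (apply (rcont_on_ver _ a b c d); auto; lra); ring.
Qed.

Lemma rect_int_quad (f : C -> C) (a b c d m n : R) :
  (forall z, in_rect a b c d z -> ccont f z) -> a <= m <= b -> c <= n <= d ->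
  rect_int f a b c d = (rect_int f a m c n + rect_int f m b c n
    + rect_int f a m n d + rect_int f m b n d)%C.
Proof.
intros H Hm Hn; rewrite (rect_int_splity f a b c d n), (rect_int_splitx f a b c n m),
 (rect_int_splitx f a b n d m); auto; try lra; [ring| |];
 intros z Hz; apply H; unfold in_rect in *; lra.
Qed.

Lemma rect_int_bound (f : C -> C) (a b c d M : R) : a <= b -> c <= d ->
  (forall z, in_rect a b c d z -> ccont f z) ->
  (forall z, in_rect a b c d z -> Cmod (f z) <= M) ->
  Cmod (rect_int f a b c d) <= 4 * M * ((b - a) + (d - c)).
Proof.
intros ab cd H B; unfold rect_int.
assert (X : forall y, c <= y <= d -> Cmod (CInt (fun x => f (x, y)) a b) <= 2 * M * (b - a)).
{ intros y Hy; eapply Rle_trans; [apply CInt_bound|].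
  - apply (rcont_on_hor _ a b c d); auto; lra.
  - rewrite Rmin_left, Rmax_right by lra; intros x Hx; apply B; split; simpl; lra.
  - rewrite Rabs_right; lra. }
assert (Y : forall x, a <= x <= b -> Cmod (CInt (fun y => f (x, y)) c d) <= 2 * M * (d - c)).
{ intros y Hy; eapply Rle_trans; [apply CInt_bound|].
  - apply (rcont_on_ver _ a b c d); auto; lra.
  - rewrite Rmin_left, Rmax_right by lra; intros x Hx; apply B; split; simpl; lra.
  - rewrite Rabs_right; lra. }
eapply Rle_trans; [apply Cmod_triangle_minus|].
eapply Rle_trans; [apply Rplus_le_compat_r, Cmod_triangle_minus|].
eapply Rle_trans; [apply Rplus_le_compat_r, Rplus_le_compat_r, Cmod_triangle|].
rewrite !Cmod_mult, Cmod_Ci.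
generalize (X c ltac:(lra)) (X d ltac:(lra)) (Y a ltac:(lra)) (Y b ltac:(lra)); lra.
Qed.

Lemma rect_int_minus (f g : C -> C) (a b c d : R) : a <= b -> c <= d ->
  (forall z, in_rect a b c d z -> ccont f z) -> (forall z, in_rect a b c d z -> ccont g z) ->
  rect_int (fun z => f z - g z)%C a b c d = (rect_int f a b c d - rect_int g a b c d)%C.
Proof.
intros ab cd Hf Hg; unfold rect_int.
rewrite !(CInt_minus (fun x => f (x, _)) (fun x => g (x, _))).
rewrite !(CInt_minus (fun y => f (_, y)) (fun y => g (_, y))).
all: try (apply (rcont_on_ver _ a b c d); auto; lra).
all: try (apply (rcont_on_hor _ a b c d); auto; lra).
ring.
Qed.

Lemma rder_pair_l (y x : R) : rder (fun t => (t, y)) x 1.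
Proof.
intros eps e0; exists 1; split; [lra|]; intros h _.
replace (((x + h)%R, y) - (x, y) - RtoC h * 1)%C with (RtoC 0)
 by (apply injective_projections; simpl; ring).
rewrite Cmod_0; apply Rmult_le_pos; [lra|apply Rabs_pos].
Qed.

Lemma rder_pair_r (x y : R) : rder (fun t => (x, t)) y Ci.
Proof.
intros eps e0; exists 1; split; [lra|]; intros h _.
replace ((x, (y + h)%R) - (x, y) - RtoC h * Ci)%C with (RtoC 0)
 by (apply injective_projections; simpl; ring).
rewrite Cmod_0; apply Rmult_le_pos; [lra|apply Rabs_pos].
Qed.

Lemma rect_int_primitive (G g : C -> C) (a b c d : R) : a <= b -> c <= d ->
  (forall z, in_rect a b c d z -> ccont g z) ->
  (forall z, in_rect a b c d z -> wd G z (g z) 0) -> rect_int g a b c d = RtoC 0.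
Proof.
intros ab cd Hg D; unfold rect_int.
assert (X : forall y, c <= y <= d -> CInt (fun x => g (x, y)) a b = (G (b, y) - G (a, y))%C).
{ intros y Hy; apply (CInt_FTC (fun x => G (x, y))).
  - rewrite Rmin_left, Rmax_right by lra; intros x Hx.
    eapply rder_eq; [apply (wd_rder G (fun x => (x, y))); [apply D|apply rder_pair_l]|ring].
    split; simpl; lra.
  - apply (rcont_on_hor _ a b c d); auto; lra. }
assert (Y : forall x, a <= x <= b -> (Ci * CInt (fun y => g (x, y)) c d = G (x, d) - G (x, c))%C).
{ intros x Hx; rewrite <- CInt_scal by (apply (rcont_on_ver _ a b c d); auto; lra).
  apply (CInt_FTC (fun y => G (x, y))).
  - rewrite Rmin_left, Rmax_right by lra; intros y Hy.
    eapply rder_eq; [apply (wd_rder G (fun y => (x, y))); [apply D|apply rder_pair_r]|ring].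
    split; simpl; lra.
  - intros t Ht; apply rcont_scal; revert t Ht; apply (rcont_on_ver _ a b c d); auto; lra. }
rewrite !X, !Y by lra; ring.
Qed.

Lemma wd_affine (p A B z : C) : wd (fun w => A + B * (w - p))%C z B 0.
Proof.
eapply wd_eq; [apply (wd_plus (fun _ => A) (fun w => B * (w - p))%C);
 [apply wd_const|apply wd_scal, (wd_minus (fun w => w) (fun _ => p)); [apply wd_id|apply wd_const]]| |]; ring.
Qed.

(** The bisection argument as an induction on rectangles: the bound of |integral| L H by eps times
    the area adds up over quarters. On small rectangles the affine part of [f] has a primitive and
    integrates to 0, and the remainder is small compared with the diameter. *)
Lemma goursat (f : C -> C) (a b c d : R) : a <= b -> c <= d ->
  (forall z, in_rect a b c d z -> exists D, wd f z D 0) -> rect_int f a b c d = RtoC 0.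
Proof.
intros ab cd D.
assert (Hc : forall z, in_rect a b c d z -> ccont f z).
{ intros z Hz; destruct (D z Hz) as [A HA]; eapply wd_ccont, HA. }
destruct ab as [ab|<-].
2:{ unfold rect_int; rewrite !CInt_point; ring. }
destruct cd as [cd|<-].
2:{ unfold rect_int; rewrite !CInt_point; ring. }
set (L := b - a); set (H := d - c).
assert (LH : 0 < L * H) by (apply Rmult_lt_0_compat; unfold L, H; lra).
assert (X : forall eps, 0 < eps ->
  Cmod (rect_int f a b c d) * (L * H) <= eps * ((b - a) * (d - c))).
{ intros eps e0.
  apply (rect_induction (fun a' b' c' d' =>
    Cmod (rect_int f a' b' c' d') * (L * H) <= eps * ((b' - a') * (d' - c')))); auto.
  - intros a' b' c' d' A1 A2 A3 A4 A5 A6 m n.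
    rewrite (rect_int_quad f a' b' c' d' m n); try (unfold m, n; lra).
    2:{ intros z Hz; apply Hc; unfold in_rect in *; lra. }
    intros Q1 Q2 Q3 Q4.
    set (r1 := rect_int f a' m c' n) in *; set (r2 := rect_int f m b' c' n) in *;
    set (r3 := rect_int f a' m n d') in *; set (r4 := rect_int f m b' n d') in *.
    assert (T : Cmod (r1 + r2 + r3 + r4) <= Cmod r1 + Cmod r2 + Cmod r3 + Cmod r4).
    { eapply Rle_trans; [apply Cmod_triangle|]; apply Rplus_le_compat_r.
      eapply Rle_trans; [apply Cmod_triangle|]; apply Rplus_le_compat_r, Cmod_triangle. }
    apply Rle_trans with ((Cmod r1 + Cmod r2 + Cmod r3 + Cmod r4) * (L * H)).
    + apply Rmult_le_compat_r; lra.
    + unfold m, n in *; lra.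
  - intros x y Hx Hy.
    destruct (D (x, y)) as [A HA]; [split; simpl; lra|].
    assert (LH2 : 0 < 4 * (L + H) ^ 2) by (unfold L, H; nra).
    (* [rect_int_bound] costs 4 (L' + H') and the remainder another L' + H'. For similar rectangles
       (L' + H')^2 L H = (L + H)^2 L' H', so this constant leaves exactly eps times the area. *)
    assert (e1 : 0 < eps / (4 * (L + H) ^ 2)) by now apply Rdiv_lt_0_compat.
    destruct (proj1 (wd_near _ _ _ _) HA _ e1) as [e [p G]].
    exists (e / 2); split; [lra|].
    intros a' b' c' d' A1 A2 A3 A4 A5 A6 S1 S2 E.
    set (af := fun w : C => (f (x, y) + A * (w - (x, y)))%C).
    assert (Haf : forall z, ccont af z) by (intros z; eapply wd_ccont, wd_affine).
    assert (Hf : forall z, in_rect a' b' c' d' z -> ccont f z)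
      by (intros z Hz; apply Hc; unfold in_rect in *; lra).
    assert (R0 : rect_int af a' b' c' d' = RtoC 0).
    { apply (rect_int_primitive (fun w => f (x, y) * w + A * ((w - (x, y)) * (w - (x, y))) * / RtoC 2)%C);
        auto; try lra.
      intros z _; eapply wd_eq.
      - apply (wd_plus (fun w => f (x, y) * w)%C (fun w => A * ((w - (x, y)) * (w - (x, y))) * / RtoC 2)%C).
        + apply wd_scal, wd_id.
        + apply (wd_mult (fun w => A * ((w - (x, y)) * (w - (x, y))))%C (fun _ => / RtoC 2)%C);
           [apply wd_scal|apply wd_const].
          apply (wd_mult (fun w => w - (x, y))%C (fun w => w - (x, y))%C);
           apply (wd_minus (fun w => w) (fun _ => (x, y))); apply wd_id || apply wd_const.
      - unfold af; field; apply RtoC_neq0; lra.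
      - ring. }
    assert (E0 : rect_int f a' b' c' d' = rect_int (fun z => f z - af z)%C a' b' c' d').
    { rewrite rect_int_minus, R0 by (auto; lra); ring. }
    set (L' := b' - a') in *; set (H' := d' - c') in *.
    assert (B : Cmod (rect_int f a' b' c' d') <=
      4 * (eps / (4 * (L + H) ^ 2) * (L' + H')) * (L' + H')).
    { rewrite E0; apply rect_int_bound; try lra.
      - intros z Hz; apply ccont_minus; auto.
      - intros z Hz.
        assert (Bz : Cmod (z - (x, y)) <= L' + H').
        { eapply Rle_trans; [apply Cmod_le_abs_sum|].
          destruct Hz as [Z1 Z2]; unfold L', H', Re, Im, Cminus, Cplus, Copp in *; simpl.
          apply Rplus_le_compat; unfold Rabs; destruct Rcase_abs; lra. }
        eapply Rle_trans; [|apply Rmult_le_compat_l; [lra|exact Bz]].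
        eapply Rle_trans; [|apply G].
        + right; f_equal; unfold af; ring.
        + unfold L', H' in *; lra. }
    apply Rle_trans with (4 * (eps / (4 * (L + H) ^ 2) * (L' + H')) * (L' + H') * (L * H)).
    { apply Rmult_le_compat_r; lra. }
    fold L H in E.
    assert (K : (L' + H') * (L' + H') * (L * H) = (L + H) ^ 2 * (L' * H')).
    { replace ((L' + H') * (L' + H') * (L * H)) with
        (L' * L * (L' * H) + 2 * L' * H' * L * H + H' * H * (H' * L)) by ring.
      rewrite E at 1; replace (H' * L) with (L' * H) at 2 by exact E; ring. }
    right; transitivity (eps / (4 * (L + H) ^ 2) * 4 * ((L' + H') * (L' + H') * (L * H))); [ring|].
    rewrite K; field; unfold L, H; lra. }
apply Cmod_eq_0, Rle_antisym; [|apply Cmod_ge_0].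
apply Rnot_lt_le; intros N.
specialize (X (Cmod (rect_int f a b c d) / 2) ltac:(lra)); unfold L, H in *; nra.
Qed.

(** The exceptional point is isolated in a small rectangle, on which the
    integral is small because [f] is bounded there. *)
Lemma goursat_except (f : C -> C) (p : C) (a b c d : R) : a <= b -> c <= d ->
  (forall z, in_rect a b c d z -> ccont f z) ->
  (forall z, in_rect a b c d z -> z <> p -> exists D, wd f z D 0) ->
  rect_int f a b c d = RtoC 0.
Proof.
intros ab cd Hc D.
destruct (classic (in_rect a b c d p)) as [Hp|Hp].
2:{ apply goursat; auto; intros z Hz; apply D; auto; intros ->; auto. }
assert (Z : forall a' b' c' d', a <= a' -> a' <= b' -> b' <= b -> c <= c' -> c' <= d' -> d' <= d ->
  (a' = b' \/ c' = d' \/ ~ in_rect a' b' c' d' p) -> rect_int f a' b' c' d' = RtoC 0).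
{ intros a' b' c' d' A1 A2 A3 A4 A5 A6 [<-|[<-|N]].
  - unfold rect_int; rewrite !CInt_point; ring.
  - unfold rect_int; rewrite !CInt_point; ring.
  - apply goursat; auto; intros z Hz; apply D; [unfold in_rect in *; lra|intros ->; auto]. }
destruct (Hc p Hp 1 Rlt_0_1) as [e [e0 B]].
destruct p as [x0 y0]; destruct Hp as [Hx Hy]; simpl in Hx, Hy.
set (M := Cmod (f (x0, y0)) + 1).
assert (M0 : 0 < M) by (unfold M; generalize (Cmod_ge_0 (f (x0, y0))); lra).
assert (X : forall h, 0 < h < e / 4 -> Cmod (rect_int f a b c d) <= 16 * M * h).
{ intros h Hh.
  (* The small rectangle is clipped because [p] may lie on the boundary. Each of the four
     surrounding pieces is then either degenerate or free of [p], so its integral is 0. *)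
  set (x1 := Rmax a (x0 - h)); set (x2 := Rmin b (x0 + h)).
  set (y1 := Rmax c (y0 - h)); set (y2 := Rmin d (y0 + h)).
  assert (X1 : a <= x1 <= x0 /\ (x1 = a \/ x1 < x0) /\ x0 - h <= x1)
   by (unfold x1, Rmax; destruct Rle_dec; lra).
  assert (X2 : x0 <= x2 <= b /\ (x2 = b \/ x0 < x2) /\ x2 <= x0 + h)
   by (unfold x2, Rmin; destruct Rle_dec; lra).
  assert (Y1 : c <= y1 <= y0 /\ (y1 = c \/ y1 < y0) /\ y0 - h <= y1)
   by (unfold y1, Rmax; destruct Rle_dec; lra).
  assert (Y2 : y0 <= y2 <= d /\ (y2 = d \/ y0 < y2) /\ y2 <= y0 + h)
   by (unfold y2, Rmin; destruct Rle_dec; lra).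
  assert (Hsub : forall a' b' c' d', a <= a' -> b' <= b -> c <= c' -> d' <= d ->
    forall z, in_rect a' b' c' d' z -> ccont f z)
   by (intros; apply Hc; unfold in_rect in *; lra).
  rewrite (rect_int_splitx f a b c d x1), (rect_int_splitx f x1 b c d x2),
    (rect_int_splity f x1 x2 c d y1), (rect_int_splity f x1 x2 y1 d y2);
    try lra; try (apply Hsub; lra).
  rewrite (Z a x1 c d), (Z x2 b c d), (Z x1 x2 c y1), (Z x1 x2 y2 d); try lra;
   try (unfold in_rect; simpl; lra).
  match goal with |- Cmod ?u <= _ => replace u with (rect_int f x1 x2 y1 y2) by ring end.
  eapply Rle_trans; [apply (rect_int_bound _ _ _ _ _ M)|]; try lra.
  - apply Hsub; lra.
  - intros z [Z1 Z2].
    assert (Cmod (f z - f (x0, y0)) < 1).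
    { apply B; eapply Rle_lt_trans; [apply Cmod_le_abs_sum|].
      unfold Re, Im, Cminus, Cplus, Copp in *; simpl.
      apply Rlt_trans with (e / 2 + e / 4); [|lra].
      apply Rplus_lt_compat; unfold Rabs; destruct Rcase_abs; lra. }
    generalize (Cmod_triangle (f z - f (x0, y0)) (f (x0, y0))).
    replace (f z - f (x0, y0) + f (x0, y0))%C with (f z) by ring; unfold M; lra.
  - nra. }
apply Cmod_eq_0, Rle_antisym; [|apply Cmod_ge_0].
apply Rnot_lt_le; intros N.
set (r := Cmod (rect_int f a b c d)) in *.
assert (M1 : 0 < r / (32 * M)) by (apply Rdiv_lt_0_compat; lra).
set (h := Rmin (e / 8) (r / (32 * M))).
assert (h0 : 0 < h) by (apply Rmin_pos; lra).
assert (h1 : h <= e / 8) by apply Rmin_l.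
assert (h2 : h <= r / (32 * M)) by apply Rmin_r.
specialize (X h ltac:(lra)).
apply Rmult_le_compat_l with (r := 16 * M) in h2; [|lra].
replace (16 * M * (r / (32 * M))) with (r / 2) in h2 by (field; lra); lra.
Qed.

(** Squares instead of discs: a horizontal segment followed by a vertical one joins any two points
    inside. *)
Definition square (p : C) (e : R) (z : C) : Prop :=
  Rabs (Re z - Re p) < e /\ Rabs (Im z - Im p) < e.

Lemma square_near (p : C) (e : R) (z : C) : square p e z -> near z (square p e).
Proof.
intros [H1 H2].
set (m := Rmin (e - Rabs (Re z - Re p)) (e - Rabs (Im z - Im p))).
assert (m1 : m <= e - Rabs (Re z - Re p)) by apply Rmin_l.
assert (m2 : m <= e - Rabs (Im z - Im p)) by apply Rmin_r.
exists m; split; [apply Rmin_pos; lra|]; intros w Hw.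
assert (W1 := re_le_Cmod (w - z)); assert (W2 := Cmod_Im_le (w - z)).
unfold square, Re, Im, Cminus, Cplus, Copp in *; simpl in *.
split; revert W1 W2 H1 H2 m1 m2; unfold Rabs; repeat destruct Rcase_abs; lra.
Qed.

Lemma square_rect (p : C) (e a b c d : R) (z : C) :
  square p e (a, c) -> square p e (b, d) -> in_rect a b c d z -> square p e z.
Proof.
unfold square, in_rect, Re, Im; simpl; intros [A1 A2] [B1 B2] [Z1 Z2].
split; revert A1 A2 B1 B2; unfold Rabs; repeat destruct Rcase_abs; lra.
Qed.

Lemma CInt_swap (f : R -> C) (a b : R) : rcont_on f a b -> CInt f b a = (- CInt f a b)%C.
Proof.
intros H; assert (E : (CInt f a b + CInt f b a)%C = RtoC 0).
{ rewrite CInt_Chasles; auto using CInt_point.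
  intros t Ht; apply H; rewrite Rmin_comm, Rmax_comm; exact Ht. }
transitivity (CInt f a b + CInt f b a - CInt f a b)%C; [ring|rewrite E; ring].
Qed.

(** The primitive integrates from the centre along the horizontal axis and then vertically.
    Vanishing over rectangles makes the two ways around a corner agree, so an increment can be
    computed on an L-shaped path starting at the point itself. *)
Lemma primitive_on_square (g : C -> C) (p : C) (e : R) :
  (forall z, square p e z -> ccont g z) ->
  (forall a b c d, a <= b -> c <= d -> square p e (a, c) -> square p e (b, d) ->
    rect_int g a b c d = RtoC 0) ->
  exists G, forall z, square p e z -> wd G z (g z) 0.
Proof.
intros Hg R0; destruct p as [x0 y0].
assert (Hx : forall x x' y, square (x0, y0) e (x, y) -> square (x0, y0) e (x', y) ->
   rcont_on (fun t => g (t, y)) x x').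
{ intros x x' y S1 S2 t Ht; apply rcont_comp; [apply Hg|apply rcont_pair_l].
  revert S1 S2 Ht; unfold square, Re, Im, Rmin, Rmax, Rabs; simpl.
  repeat destruct Rle_dec; repeat destruct Rcase_abs; lra. }
assert (Hy : forall x y y', square (x0, y0) e (x, y) -> square (x0, y0) e (x, y') ->
   rcont_on (fun t => g (x, t)) y y').
{ intros x x' y S1 S2 t Ht; apply rcont_comp; [apply Hg|apply rcont_pair_r].
  revert S1 S2 Ht; unfold square, Re, Im, Rmin, Rmax, Rabs; simpl.
  repeat destruct Rle_dec; repeat destruct Rcase_abs; lra. }
assert (Mix : forall x y x' y', square (x0, y0) e (x, y) -> square (x0, y0) e (x', y') ->
  square (x0, y0) e (x, y')) by (intros x y x' y' [A1 A2] [B1 B2]; split; auto).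
(* The hypothesis is extended to corners in any order, since the point may lie on either side of the
   centre. *)
assert (Z : forall a b c d, square (x0, y0) e (a, c) -> square (x0, y0) e (b, d) ->
    rect_int g a b c d = RtoC 0).
{ assert (Z1 : forall a b c d, a <= b -> square (x0, y0) e (a, c) -> square (x0, y0) e (b, d) ->
    rect_int g a b c d = RtoC 0).
  { intros a b c d ab S1 S2; destruct (Rle_dec c d) as [cd|cd]; [now apply R0|].
    assert (T1 := Mix _ _ _ _ S1 S2); assert (T2 := Mix _ _ _ _ S2 S1).
    assert (E := R0 a b d c ab ltac:(lra) T1 T2); unfold rect_int in *.
    rewrite (CInt_swap (fun y => g (b, y)) c d), (CInt_swap (fun y => g (a, y)) c d) in E by auto.
    transitivity (- RtoC 0)%C; [rewrite <- E|]; ring. }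
  intros a b c d S1 S2; destruct (Rle_dec a b) as [ab|ab]; [now apply Z1|].
  assert (T1 := Mix _ _ _ _ S1 S2); assert (T2 := Mix _ _ _ _ S2 S1).
  assert (E := Z1 b a c d ltac:(lra) T2 T1); unfold rect_int in *.
  rewrite (CInt_swap (fun x => g (x, c)) a b), (CInt_swap (fun x => g (x, d)) a b) in E by auto.
  transitivity (- RtoC 0)%C; [rewrite <- E|]; ring. }
exists (fun z => CInt (fun t => g (t, y0)) x0 (Re z) + Ci * CInt (fun t => g (Re z, t)) y0 (Im z))%C.
intros [x y] Sz eps e0.
assert (e1 : 0 < eps / 4) by lra.
destruct (near_and _ _ _ (Hg _ Sz _ e1) (square_near _ _ _ Sz)) as [r [r0 G]].
exists (r / 2); split; [lra|]; intros [h k] Hk.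
change (Re (x, y)) with x; change (Im (x, y)) with y.
change ((x, y) + (h, k))%C with (x + h, y + k).
change (Re (x + h, y + k)) with (x + h); change (Im (x + h, y + k)) with (y + k).
assert (e2 : 0 < e) by (destruct Sz as [S1 _]; generalize (Rabs_pos (Re (x, y) - Re (x0, y0))); lra).
assert (S0 : square (x0, y0) e (x0, y0))
 by (split; rewrite Rminus_diag, Rabs_R0; lra).
assert (N : forall u v, Rabs u <= Rabs h -> Rabs v <= Rabs k ->
  Cmod (g (x + u, y + v) - g (x, y)) < eps / 4 /\ square (x0, y0) e (x + u, y + v)).
{ intros u v Hu Hv; apply (G (x + u, y + v)).
  assert (K1 := re_le_Cmod (h, k)); assert (K2 := Cmod_Im_le (h, k)).
  replace (((x + u)%R, (y + v)%R) - (x, y))%C with (u, v)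
   by (apply injective_projections; simpl; ring).
  eapply Rle_lt_trans; [apply Cmod_le_abs_sum|]; unfold Re, Im in *; simpl in *; lra. }
assert (Sxh : square (x0, y0) e (x + h, y + k)) by (apply N; lra).
assert (Shy : square (x0, y0) e (x + h, y)) by (eapply Mix; eauto).
assert (Sx0 : square (x0, y0) e (x, y0)) by (eapply Mix; eauto).
assert (Sh0 : square (x0, y0) e (x + h, y0)) by (eapply Mix; eauto).
(* This rectangle has its base on the axis through the centre; its relation trades the horizontal
   step on that axis for one at height y. *)
assert (E := Z x (x + h) y0 y Sx0 Shy); unfold rect_int in E.
rewrite <- (CInt_Chasles (fun t => g (t, y0)) x0 x (x + h)) by auto.
rewrite <- (CInt_Chasles (fun t => g (x + h, t)) y0 y (y + k)) by auto.
match goal with |- Cmod ?w <= _ => replace w with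
 ((CInt (fun t => g (t, y)) x (x + h) - RtoC h * g (x, y)) +
  Ci * (CInt (fun t => g ((x + h)%R, t)) y (y + k) - RtoC k * g (x, y)))%C end.
2:{ set (i1 := CInt (fun t => g (t, y0)) x0 x) in *.
  set (i2 := CInt (fun t => g (t, y0)) x (x + h)) in *.
  set (i3 := CInt (fun t => g ((x + h)%R, t)) y0 y) in *.
  set (i4 := CInt (fun t => g ((x + h)%R, t)) y (y + k)) in *.
  set (i5 := CInt (fun t => g (x, t)) y0 y) in *.
  set (i6 := CInt (fun t => g (t, y)) x (x + h)) in *.
  assert (E' : i6 = (i2 + Ci * i3 - Ci * i5)%C).
  { transitivity (i6 + RtoC 0)%C; [ring|]; rewrite <- E; ring. }
  rewrite E'.
  replace (h, k) with (RtoC h + Ci * RtoC k)%C by (apply injective_projections; simpl; ring).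
  ring. }
eapply Rle_trans; [apply Cmod_triangle|].
rewrite Cmod_mult, Cmod_Ci, Rmult_1_l.
assert (X1 : Cmod (CInt (fun t => g (t, y)) x (x + h) - RtoC h * g (x, y)) <= 2 * (eps / 4) * Rabs h).
{ replace (RtoC h * g (x, y))%C with (CInt (fun _ => g (x, y)) x (x + h))
   by (rewrite CInt_const; do 2 f_equal; ring).
  rewrite <- CInt_minus by (auto; intros t _; apply rcont_const).
  eapply Rle_trans; [apply (CInt_bound _ _ _ (eps / 4))|].
  - intros t Ht; apply (rcont_minus (fun t => g (t, y))); [apply (Hx _ _ _ Sz Shy t Ht)|apply rcont_const].
  - intros t Ht; left.
    replace (t, y) with (x + (t - x), y + 0) by (f_equal; ring).
    apply N; [|rewrite Rabs_R0; apply Rabs_pos].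
    revert Ht; unfold Rmin, Rmax, Rabs; repeat destruct Rle_dec; repeat destruct Rcase_abs; lra.
  - right; do 2 f_equal; ring. }
assert (X2 : Cmod (CInt (fun t => g ((x + h)%R, t)) y (y + k) - RtoC k * g (x, y)) <= 2 * (eps / 4) * Rabs k).
{ replace (RtoC k * g (x, y))%C with (CInt (fun _ => g (x, y)) y (y + k))
   by (rewrite CInt_const; do 2 f_equal; ring).
  rewrite <- CInt_minus by (auto; intros t _; apply rcont_const).
  eapply Rle_trans; [apply (CInt_bound _ _ _ (eps / 4))|].
  - intros t Ht; apply (rcont_minus (fun t => g (x + h, t))); [apply (Hy _ _ _ Shy Sxh t Ht)|apply rcont_const].
  - intros t Ht; left.
    replace (x + h, t) with (x + h, y + (t - y)) by (f_equal; ring).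
    apply N; [lra|].
    revert Ht; unfold Rmin, Rmax, Rabs; repeat destruct Rle_dec; repeat destruct Rcase_abs; lra.
  - right; do 2 f_equal; ring. }
assert (K1 := re_le_Cmod (h, k)); assert (K2 := Cmod_Im_le (h, k)).
unfold Re, Im in K1, K2; simpl in K1, K2.
assert (eps / 2 * Rabs h <= eps / 2 * Cmod (h, k)) by (apply Rmult_le_compat_l; lra).
assert (eps / 2 * Rabs k <= eps / 2 * Cmod (h, k)) by (apply Rmult_le_compat_l; lra).
lra.
Qed.

(** * Removable singularities *)

(** The derivatives along the directions 1 and i are A + B and i (A - B), which determine A and
    B. *)
Lemma wd_unique (f : C -> C) (z A B A' B' : C) :
  wd f z A B -> wd f z A' B' -> A = A' /\ B = B'.
Proof.
intros H H'.
assert (X : forall d, rder (fun s => z + RtoC s * d)%C 0 d) by (intros; apply rder_affine).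
assert (E : forall d : C, (A * d + B * Cconj d)%C = (A' * d + B' * Cconj d)%C).
{ intros d.
  assert (Z : z = (z + RtoC 0 * d)%C) by ring.
  rewrite Z in H, H'.
  assert (R1 := proj1 (rder_iff _ _ _) (wd_rder f _ 0 _ _ _ H (X d))).
  assert (R2 := proj1 (rder_iff _ _ _) (wd_rder f _ 0 _ _ _ H' (X d))).
  apply injective_projections.
  - transitivity (Derive (fun s => Re (f (z + RtoC s * d)%C)) 0);
     [symmetry|]; apply is_derive_unique; [apply R1|apply R2].
  - transitivity (Derive (fun s => Im (f (z + RtoC s * d)%C)) 0);
     [symmetry|]; apply is_derive_unique; [apply R1|apply R2]. }
assert (E1 := E 1); assert (E2 := E Ci).
rewrite Cconj_Ci in E2; rewrite Cconj_RtoC in E1.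
assert (E3 : (A - B)%C = (A' - B')%C).
{ transitivity (- Ci * (A * Ci + B * - Ci))%C.
  - transitivity (- (Ci * Ci) * (A - B))%C; [|ring].
    replace (Ci * Ci)%C with (- RtoC 1)%C by (apply injective_projections; simpl; ring).
    ring.
  - rewrite E2; transitivity (- (Ci * Ci) * (A' - B'))%C; [ring|].
    replace (Ci * Ci)%C with (- RtoC 1)%C by (apply injective_projections; simpl; ring).
    ring. }
split.
- transitivity (/ 2 * ((A * 1 + B * 1) + (A - B)))%C; [field; auto|rewrite E1, E3; field; auto].
- transitivity (/ 2 * ((A * 1 + B * 1) - (A - B)))%C; [field; auto|rewrite E1, E3; field; auto].
Qed.

Lemma holomorphic_primitive (f : C -> C) (p q : C) (e : R) :
  (forall z, square p e z -> ccont f z) ->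
  (forall z, square p e z -> z <> q -> exists D, wd f z D 0) ->
  exists G, forall z, square p e z -> wd G z (f z) 0.
Proof.
intros Hc D; apply primitive_on_square; auto.
intros a b c d ab cd S1 S2; apply (goursat_except f q); auto; intros z Hz;
 [apply Hc|intros; apply D; auto]; exact (square_rect p e a b c d z S1 S2 Hz).
Qed.

(** Differentiation under the integral sign for kernels whose second-order remainder is explicit, as
    for powers of the Cauchy kernel. The vanishing conj-z part makes the result complex
    differentiable. *)
Lemma wd_CInt_quadratic (h : C -> R -> C) (h' : R -> C) (z : C) (a b M e : R) :
  0 < e -> 0 <= M ->
  (forall k, Cmod k < e -> rcont_on (h (z + k)%C) a b) -> rcont_on h' a b ->
  (forall k t, Cmod k < e -> Rmin a b <= t <= Rmax a b ->
    Cmod (h (z + k)%C t - h z t - k * h' t) <= M * Cmod k * Cmod k) ->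
  wd (fun z => CInt (h z) a b) z (CInt h' a b) 0.
Proof.
intros e0 M0 Hh Hh' Q eps p.
set (N := 2 * M * Rabs (b - a) + 1).
assert (N0 : 0 < N).
{ unfold N; assert (0 <= M * Rabs (b - a)) by (apply Rmult_le_pos; auto; apply Rabs_pos); lra. }
exists (Rmin e (eps / N)); split; [apply Rmin_pos; auto; now apply Rdiv_lt_0_compat|].
intros k Hk.
assert (k1 : Cmod k < e) by (eapply Rlt_le_trans; [exact Hk|apply Rmin_l]).
assert (k2 : Cmod k < eps / N) by (eapply Rlt_le_trans; [exact Hk|apply Rmin_r]).
assert (H0 : rcont_on (h z) a b).
{ replace z with (z + RtoC 0)%C by ring; apply Hh; now rewrite Cmod_0. }
replace (CInt (h (z + k)%C) a b - CInt (h z) a b - (CInt h' a b * k + RtoC 0 * Cconj k))%C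
 with (CInt (fun t => h (z + k)%C t - h z t - k * h' t)%C a b).
- eapply Rle_trans; [apply (CInt_bound _ _ _ (M * Cmod k * Cmod k))|].
  + intros t Ht; apply rcont_minus; [apply rcont_minus|apply rcont_scal]; auto.
    now apply Hh.
  + intros t Ht; now apply Q.
  + apply Rmult_lt_compat_r with (r := N) in k2; auto.
    replace (eps / N * N) with eps in k2 by (field; lra).
    replace (2 * (M * Cmod k * Cmod k) * Rabs (b - a)) with ((2 * M * Rabs (b - a)) * Cmod k * Cmod k) by ring.
    apply Rmult_le_compat_r; [apply Cmod_ge_0|].
    generalize (Cmod_ge_0 k); unfold N in k2; lra.
- rewrite CInt_minus, CInt_minus, CInt_scal; auto; [ring| |].
  + intros t Ht; apply rcont_minus; auto; now apply Hh.
  + intros t Ht; apply rcont_scal; auto.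
Qed.

Lemma rcont_inv (f : R -> C) (t : R) : f t <> RtoC 0 -> rcont f t -> rcont (fun s => / f s)%C t.
Proof. intros N H; apply (rcont_comp Cinv); auto; eapply wd_ccont, wd_Cinv, N. Qed.

Lemma rcont_bounded (f : R -> C) (a b : R) : a <= b -> (forall t, rcont f t) ->
  exists B, forall t, a <= t <= b -> Cmod (f t) <= B.
Proof.
intros ab H; destruct (continuity_ab_maj (fun t => Cmod (f t)) a b ab) as [m [Hm _]].
- intros t _; apply continuity_pt_filterlim, filterlim_locally; intros eps.
  destruct (H t eps (cond_pos eps)) as [e [p G]]; exists (mkposreal e p); intros s Hs.
  change (Rabs (Cmod (f s) - Cmod (f t)) < eps).
  specialize (G s Hs); generalize (Cmod_triangle_inv (f s) (f t)) (Cmod_triangle_inv (f t) (f s)).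
  rewrite (Cmod_minus_sym (f t)); unfold Rabs; destruct Rcase_abs; lra.
- exists (Cmod (f m)); exact Hm.
Qed.

(** Two derivatives are taken because the derivative of a quotient of such integrals has to be
    differentiated once more in [derivative_holomorphic]. *)
Lemma wd_cauchy_kernel (phi gam : R -> C) (z : C) (a b r : R) :
  0 < r -> (forall t, rcont phi t) -> (forall t, rcont gam t) ->
  (exists M, forall t, Rmin a b <= t <= Rmax a b -> Cmod (phi t) <= M /\ Cmod (gam t) <= M) ->
  (forall t, r <= Cmod (gam t - z)) ->
  wd (fun z => CInt (fun t => phi t * / (gam t - z))%C a b) z
     (CInt (fun t => phi t * (/ (gam t - z) * / (gam t - z)))%C a b) 0 /\
  wd (fun z => CInt (fun t => phi t * (/ (gam t - z) * / (gam t - z)))%C a b) z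
     (CInt (fun t => 2 * phi t * (/ (gam t - z) * / (gam t - z) * / (gam t - z)))%C a b) 0.
Proof.
intros r0 Hp Hg [M HM] Hr.
assert (M0 : 0 <= M).
{ destruct (HM a) as [H _]; [split; [apply Rmin_l|apply Rmax_l]|].
  generalize (Cmod_ge_0 (phi a)); lra. }
assert (F : forall k t, Cmod k < r / 2 -> r / 2 <= Cmod (gam t - (z + k))).
{ intros k t Hk; generalize (Cmod_triangle_inv (gam t - z) k).
  replace (gam t - z - k)%C with (gam t - (z + k))%C by ring; generalize (Hr t); lra. }
assert (F0 : forall k t, Cmod k < r / 2 -> (gam t - (z + k))%C <> RtoC 0)
 by (intros k t Hk; apply Cmod_gt_0; generalize (F k t Hk); lra).
assert (G0 : forall t, (gam t - z)%C <> RtoC 0)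
 by (intros t; apply Cmod_gt_0; generalize (Hr t); lra).
assert (Ci : forall k t, Cmod k < r / 2 -> rcont (fun t => / (gam t - (z + k)))%C t)
 by (intros k t Hk; apply rcont_inv; auto; apply rcont_minus; auto using rcont_const).
assert (Ci0 : forall t, rcont (fun t => / (gam t - z))%C t)
 by (intros t; apply rcont_inv; auto; apply rcont_minus; auto using rcont_const).
assert (I0 : forall t, Cmod (/ (gam t - z)) <= 2 / r).
{ intros t; rewrite Cmod_inv by auto; unfold Rdiv.
  apply Rle_trans with (/ r); [apply Rinv_le_contravar; auto|].
  assert (0 < / r) by now apply Rinv_0_lt_compat. lra. }
assert (I1 : forall k t, Cmod k < r / 2 -> Cmod (/ (gam t - (z + k))) <= 2 / r).
{ intros k t Hk; rewrite Cmod_inv by auto.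
  apply Rle_trans with (/ (r / 2)); [apply Rinv_le_contravar; [lra|auto]|right; field; lra]. }
assert (s0 : 0 < 2 / r) by (apply Rdiv_lt_0_compat; lra).
set (s := 2 / r) in *.
split.
- apply (wd_CInt_quadratic (fun z t => phi t * / (gam t - z))%C _ z a b (M * (s * s * s)) (r / 2)); try lra.
  + repeat (apply Rmult_le_pos; try lra).
  + intros k Hk t _; apply rcont_mult; auto.
  + intros t _; apply rcont_mult; auto; apply rcont_mult; auto.
  + intros k t Hk Ht.
    replace (phi t * / (gam t - (z + k)) - phi t * / (gam t - z) - k * (phi t * (/ (gam t - z) * / (gam t - z))))%C
     with (phi t * (/ (gam t - z) * / (gam t - z) * / (gam t - (z + k))) * k * k)%C.
    2:{ field; split; auto. }
    rewrite !(Cmod_mult _ k).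
    apply Rmult_le_compat_r; [apply Cmod_ge_0|]; apply Rmult_le_compat_r; [apply Cmod_ge_0|].
    rewrite !Cmod_mult; repeat (apply Rmult_le_compat; auto using Cmod_ge_0, Rmult_le_pos).
    apply HM; auto.
- apply (wd_CInt_quadratic (fun z t => phi t * (/ (gam t - z) * / (gam t - z)))%C _ z a b
    (M * ((3 * (2 * M + Cmod z + r)) * (s * s * s * s * s))) (r / 2)); try lra.
  + generalize (Cmod_ge_0 z); intros; repeat (apply Rmult_le_pos; try lra).
  + intros k Hk t _; apply rcont_mult; auto; apply rcont_mult; auto.
  + intros t _; apply rcont_mult; auto; [apply rcont_scal; auto|].
    repeat apply rcont_mult; auto.
  + intros k t Hk Ht.
    (* With u = gam t - z, the remainder of 1/(u - k)^2 after 1/u^2 + 2k/u^3 is k^2 (3u - 2k) / (u^3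
       (u - k)^2). *)
    match goal with |- Cmod ?u <= _ => replace u with
     (phi t * ((3 * (gam t - z) - 2 * k) * (/ (gam t - z) * / (gam t - z) * / (gam t - z) *
        / (gam t - (z + k)) * / (gam t - (z + k)))) * k * k)%C end.
    2:{ field; split; auto. }
    rewrite !(Cmod_mult _ k).
    apply Rmult_le_compat_r; [apply Cmod_ge_0|]; apply Rmult_le_compat_r; [apply Cmod_ge_0|].
    rewrite (Cmod_mult (phi t)); apply Rmult_le_compat; auto using Cmod_ge_0; [apply HM; auto|].
    rewrite (Cmod_mult (3 * (gam t - z) - 2 * k)); apply Rmult_le_compat; auto using Cmod_ge_0.
    * eapply Rle_trans; [apply Cmod_triangle_minus|].
      rewrite !Cmod_mult, !Cmod_R, !Rabs_right by lra.
      generalize (Cmod_triangle_minus (gam t) z) (proj2 (HM t Ht)) (Cmod_ge_0 z); lra.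
    * rewrite !Cmod_mult; repeat (apply Rmult_le_compat; auto using Cmod_ge_0, Rmult_le_pos).
Qed.

(** The Cauchy formula, divided by the winding integral instead of evaluating
    it, exhibits [f] near [p] as a quotient of Cauchy-type integrals. *)
Lemma derivative_holomorphic (f g : C -> C) (p : C) (e : R) : 0 < e ->
  (forall z, square p e z -> wd f z (g z) 0) -> exists D, wd g p D 0.
Proof.
intros e0 Hf; generalize PI_RGT_0; intros P.
assert (Sp : forall z, Cmod (z - p) < e -> square p e z).
{ intros z Hz; split; (eapply Rle_lt_trans; [|exact Hz]).
  - eapply Rle_trans; [|apply re_le_Cmod]; right; f_equal.
  - eapply Rle_trans; [|apply Cmod_Im_le]; right; f_equal. }
set (r := e / 2).
set (gam := fun t => (p + RtoC r * cis t)%C).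
assert (Gr : forall t, Cmod (gam t - p) = r).
{ intros t; unfold gam; replace (p + RtoC r * cis t - p)%C with (RtoC r * cis t)%C by ring.
  rewrite Cmod_mult, Cmod_cis, Cmod_R, Rabs_right; unfold r; lra. }
assert (Gd : forall t, rder gam t (RtoC r * (Ci * cis t))).
{ intros t; eapply rder_eq.
  - apply (wd_rder (fun w => p + RtoC r * w)%C cis); [|apply rder_cis].
    apply (wd_plus (fun _ => p) (fun w => RtoC r * w)%C); [apply wd_const|apply wd_scal, wd_id].
  - ring. }
assert (Gc : forall t, rcont gam t) by (intros t; eapply rder_rcont, Gd).
assert (Gs : forall t, square p e (gam t)) by (intros t; apply Sp; rewrite Gr; unfold r; lra).
assert (Dc : forall t, rcont (fun t => RtoC r * (Ci * cis t))%C t)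
 by (intros t; apply rcont_scal, rcont_scal, rcont_cis).
set (phi1 := fun t => (RtoC r * (Ci * cis t))%C).
set (phi2 := fun t => (f (gam t) * phi1 t)%C).
set (I := fun z => CInt (fun t => phi1 t * / (gam t - z))%C 0 (2 * PI)).
set (N := fun z => CInt (fun t => phi2 t * / (gam t - z))%C 0 (2 * PI)).
set (I' := fun z => CInt (fun t => phi1 t * (/ (gam t - z) * / (gam t - z)))%C 0 (2 * PI)).
set (N' := fun z => CInt (fun t => phi2 t * (/ (gam t - z) * / (gam t - z)))%C 0 (2 * PI)).
assert (Fc : forall t, rcont (fun t => f (gam t)) t)
 by (intros t; apply rcont_comp; auto; eapply wd_ccont; auto).
assert (Pc2 : forall t, rcont phi2 t) by (intros t; apply rcont_mult; auto; apply Dc).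
assert (far : forall z t, Cmod (z - p) < r / 2 -> r / 2 <= Cmod (gam t - z)).
{ intros z t Hz; generalize (Cmod_triangle_inv (gam t - p) (z - p)).
  replace (gam t - p - (z - p))%C with (gam t - z)%C by ring; rewrite Gr; lra. }
assert (far0 : forall z t, Cmod (z - p) < r / 2 -> (gam t - z)%C <> RtoC 0).
{ intros z t Hz; apply Cmod_gt_0; generalize (far z t Hz); unfold r in *; lra. }
assert (P1 : forall t, Cmod (phi1 t) = r).
{ intros t; unfold phi1; rewrite !Cmod_mult, Cmod_Ci, Cmod_cis, Cmod_R, Rabs_right; unfold r; lra. }
assert (Gb : forall t, Cmod (gam t) <= Cmod p + r).
{ intros t; replace (gam t) with ((gam t - p) + p)%C by ring.
  eapply Rle_trans; [apply Cmod_triangle|]; rewrite Gr; lra. }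
assert (KN : forall z, Cmod (z - p) < r / 2 -> N z = (f z * I z)%C).
{ intros z Hz.
  (* The difference quotient of [f] at [z], completed by [g z]: continuous on the square and
     holomorphic off [z], so it has a primitive and integrates to 0 around the circle. This gives N
     = f I. *)
  set (q := fun w => match excluded_middle_informative (w = z) with
     | left _ => g z | right _ => ((f w - f z) * / (w - z))%C end).
  assert (Qz : q z = g z) by (unfold q; destruct excluded_middle_informative; tauto).
  assert (Qn : forall w, w <> z -> q w = ((f w - f z) * / (w - z))%C)
   by (intros w Hw; unfold q; destruct excluded_middle_informative; tauto).
  assert (Sz : square p e z) by (apply Sp; unfold r in *; lra).
  assert (Nq : forall w, w <> z -> near w (fun u => u <> z)).
  { intros w Hw; exists (Cmod (w - z)); split.
    - apply Cmod_gt_0; now apply Cminus_eq_contra.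
    - intros u Hu ->; rewrite Cmod_minus_sym in Hu; lra. }
  assert (Qd : forall w, square p e w -> w <> z -> exists D, wd q w D 0).
  { intros w Sw Hw; eexists; eapply wd_eq.
    - eapply wd_ext; [generalize (Nq w Hw); apply near_imp; intros u Hu; symmetry; apply (Qn u Hu)|].
      apply (wd_mult (fun w => f w - f z)%C (fun w => / (w - z))%C).
      + apply wd_minus; [apply (Hf w Sw)|apply wd_const].
      + apply (wd_inv (fun w => w - z)%C); [now apply Cminus_eq_contra|].
        apply (wd_minus (fun w => w)); [apply wd_id|apply wd_const].
    - reflexivity.
    - cbn beta; unfold Cdiv; ring. }
  assert (Qc : forall w, square p e w -> ccont q w).
  { intros w Sw; destruct (Ceq_dec w z) as [->|Hw].
    - intros eps p0.
      generalize (proj1 (wd_near _ _ _ _) (Hf z Sz) (eps / 2) ltac:(lra)); apply near_imp.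
      intros w Hw; rewrite Qz; destruct (Ceq_dec w z) as [->|Nw].
      + rewrite Qz; replace (g z - g z)%C with (RtoC 0) by ring; rewrite Cmod_0; lra.
      + rewrite Qn by auto.
        assert (W0 : (w - z)%C <> RtoC 0) by now apply Cminus_eq_contra.
        assert (W1 := proj1 (Cmod_gt_0 _) W0).
        apply Rle_lt_trans with (eps / 2); [|lra].
        apply Rmult_le_reg_r with (Cmod (w - z)); auto; rewrite <- Cmod_mult.
        eapply Rle_trans; [|exact Hw]; right; f_equal; field; auto.
    - destruct (Qd w Sw Hw) as [D HD]; eapply wd_ccont, HD. }
  destruct (holomorphic_primitive q p z e Qc Qd) as [G HG].
  assert (E : CInt (fun t => q (gam t) * phi1 t)%C 0 (2 * PI) = (G (gam (2 * PI)%R) - G (gam 0))%C).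
  { apply (CInt_FTC (fun t => G (gam t))).
    - intros t _; eapply rder_eq; [apply (wd_rder G gam); [apply HG, Gs|apply Gd]|unfold phi1; ring].
    - intros t _; apply rcont_mult; [apply rcont_comp; auto|apply Dc]. }
  replace (gam (2 * PI)) with (gam 0) in E.
  2:{ unfold gam; replace (2 * PI) with (0 + 2 * PI) by ring; now rewrite cis_2PI. }
  assert (E2 : CInt (fun t => q (gam t) * phi1 t)%C 0 (2 * PI) = (N z - f z * I z)%C).
  { unfold N, I; rewrite <- CInt_scal, <- CInt_minus.
    - apply CInt_ext; intros t _; rewrite Qn; [unfold phi2; ring|].
      intros E'; apply (far0 z t Hz); rewrite E'; ring.
    - intros t _; apply rcont_mult; auto; apply rcont_inv; auto; apply rcont_minus; auto using rcont_const.
    - intros t _; apply rcont_scal, rcont_mult; [apply Dc|]; apply rcont_inv; auto; apply rcont_minus; auto using rcont_const.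
    - intros t _; apply rcont_mult; [apply Dc|]; apply rcont_inv; auto; apply rcont_minus; auto using rcont_const. }
  apply Ceq_minus; rewrite <- E2, E; ring. }
assert (D1 : forall z, Cmod (z - p) < r / 2 -> wd I z (I' z) 0 /\ exists D, wd I' z D 0).
{ intros z Hz; destruct (wd_cauchy_kernel phi1 gam z 0 (2 * PI) (r / 2)) as [H1 H2]; auto.
  - unfold r; lra.
  - exists (Cmod p + r); intros t; rewrite P1; generalize (Cmod_ge_0 p) (Gb t); lra.
  - split; [exact H1|eexists; exact H2]. }
assert (D2 : forall z, Cmod (z - p) < r / 2 -> wd N z (N' z) 0 /\ exists D, wd N' z D 0).
{ intros z Hz; destruct (wd_cauchy_kernel phi2 gam z 0 (2 * PI) (r / 2)) as [H1 H2]; auto.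
  - unfold r; lra.
  - destruct (rcont_bounded phi2 0 (2 * PI)) as [B HB]; [lra|exact Pc2|].
    exists (Rmax B (Cmod p + r)); rewrite Rmin_left, Rmax_right by lra; intros t Ht; split.
    + eapply Rle_trans; [now apply HB|apply Rmax_l].
    + eapply Rle_trans; [apply Gb|apply Rmax_r].
  - split; [exact H1|eexists; exact H2]. }
(* Only at the centre is the winding integral computed, where its integrand is constantly i;
   continuity makes it nonzero nearby. *)
assert (Ip : I p = (RtoC (2 * PI) * Ci)%C).
{ unfold I; rewrite (CInt_ext _ (fun _ => Ci)).
  - rewrite CInt_const; do 2 f_equal; ring.
  - intros t _; unfold phi1, gam.
    assert (RtoC r <> RtoC 0) by (apply RtoC_neq0; unfold r; lra).
    assert (cis t <> RtoC 0) by (apply Cmod_gt_0; rewrite Cmod_cis; lra).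
    replace (p + RtoC r * cis t - p)%C with (RtoC r * cis t)%C by ring; field; auto. }
assert (I0 : I p <> RtoC 0).
{ rewrite Ip; apply Cmult_neq_0; [apply RtoC_neq0; lra|apply Ci_nz]. }
assert (pp : Cmod (p - p) < r / 2).
{ replace (p - p)%C with (RtoC 0) by ring; rewrite Cmod_0; unfold r; lra. }
assert (NI : near p (fun z => Cmod (z - p) < r / 2 /\ I z <> RtoC 0)).
{ apply near_and.
  - exists (r / 2); split; [unfold r; lra|auto].
  - assert (m0 := proj1 (Cmod_gt_0 _) I0).
    generalize (wd_ccont _ _ _ _ (proj1 (D1 p pp)) _ m0); apply near_imp; intros w Hw E.
    rewrite E in Hw; replace (RtoC 0 - I p)%C with (- I p)%C in Hw by ring.
    rewrite Cmod_opp in Hw; lra. }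
(* Near [p], [g] is the derivative of N/I by uniqueness of derivatives, and the quotient rule
   expresses it through functions that are again differentiable. *)
assert (Eg : near p (fun z => ((N' z * I z - N z * I' z) * (/ I z * / I z))%C = g z)).
{ generalize (near_near _ _ NI); apply near_imp; intros z Hz.
  destruct (near_self _ _ Hz) as [Z1 Z2].
  refine (proj1 (wd_unique f z _ 0 _ 0 _ (Hf z (Sp z _)))); [|unfold r in *; lra].
  eapply wd_eq.
  - apply (wd_ext (fun z => N z * / I z)%C).
    + revert Hz; apply near_imp; intros w [W1 W2]; rewrite KN by auto; field; auto.
    + apply wd_mult; [apply D2, Z1|apply wd_inv; [exact Z2|apply D1, Z1]].
  - cbn beta; field; auto.
  - cbn beta; field; auto. }
destruct (D1 p pp) as [A1 [B1 A2]], (D2 p pp) as [A3 [B2 A4]].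
eexists; eapply wd_eq.
- eapply wd_ext; [exact Eg|].
  apply wd_mult; [apply wd_minus; apply wd_mult; eassumption|].
  apply wd_mult; apply wd_inv; eassumption.
- reflexivity.
- cbn beta; field; auto.
Qed.

(** A continuous function holomorphic off [p] has a primitive, hence is holomorphic at [p] as well
    ([Step]). Applied to (z - p) f extended by 0, this gives a derivative v at [p], which is the
    limit of [f] there; applied again to [f] extended by v, it gives the claim. *)
Lemma removable_singularity (f : C -> C) (p : C) (e : R) : 0 < e ->
  (forall z, Cmod (z - p) < e -> z <> p -> exists D, wd f z D 0) ->
  (forall eps, 0 < eps -> near p (fun z => z <> p -> Cmod ((z - p) * f z) <= eps)) ->
  exists v, let g z := match excluded_middle_informative (z = p) with
      | left _ => v | right _ => f z end in
    forall z, Cmod (z - p) < e -> exists D, wd g z D 0.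
Proof.
intros e0 Hf Hb.
set (u := fun (v : C) (h : C -> C) (z : C) => match excluded_middle_informative (z = p) with
      | left _ => v | right _ => h z end).
assert (Up : forall v h, u v h p = v) by (intros; unfold u; destruct excluded_middle_informative; tauto).
assert (Un : forall v h z, z <> p -> u v h z = h z)
 by (intros; unfold u; destruct excluded_middle_informative; tauto).
assert (Nn : forall z, z <> p -> near z (fun w => w <> p)).
{ intros w Hw; exists (Cmod (w - p)); split.
  - apply Cmod_gt_0; now apply Cminus_eq_contra.
  - intros q Hq ->; rewrite Cmod_minus_sym in Hq; lra. }
assert (Ud : forall v h z, z <> p -> (exists D, wd h z D 0) -> exists D, wd (u v h) z D 0).
{ intros v h z Hz [D HD]; exists D; eapply wd_ext; [|exact HD].
  generalize (Nn z Hz); apply near_imp; intros w Hw; symmetry; now apply Un. }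
assert (Step : forall v h, (forall z, Cmod (z - p) < e -> z <> p -> exists D, wd h z D 0) ->
   ccont (u v h) p -> exists D, wd (u v h) p D 0).
{ intros v h Hh Hc.
  assert (S2 : forall z, square p (e / 2) z -> Cmod (z - p) < e).
  { intros z [Z1 Z2]; eapply Rle_lt_trans; [apply Cmod_le_abs_sum|].
    unfold Re, Im, Cminus, Cplus, Copp in *; simpl; unfold Rminus in *; lra. }
  destruct (holomorphic_primitive (u v h) p p (e / 2)) as [G HG].
  - intros z Sz; destruct (Ceq_dec z p) as [->|Nz]; auto.
    destruct (Ud v h z Nz (Hh z (S2 z Sz) Nz)) as [D HD]; eapply wd_ccont, HD.
  - intros z Sz Nz; apply Ud; auto.
  - apply (derivative_holomorphic G (u v h) p (e / 2)); [lra|exact HG]. }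
destruct (Step (RtoC 0) (fun z => (z - p) * f z)%C) as [v Hv].
- intros z Hz Nz; destruct (Hf z Hz Nz) as [D HD]; eexists; eapply wd_eq.
  + apply (wd_mult (fun z => z - p)%C f); [apply wd_minus; [apply wd_id|apply wd_const]|exact HD].
  + reflexivity.
  + cbn beta; ring.
- intros eps p0; generalize (Hb (eps / 2) ltac:(lra)); apply near_imp; intros z Hz.
  rewrite Up; replace (u (RtoC 0) (fun z => (z - p) * f z)%C z - RtoC 0)%C
   with (u (RtoC 0) (fun z => (z - p) * f z)%C z) by ring.
  destruct (Ceq_dec z p) as [->|Nz].
  + rewrite Up, Cmod_0; lra.
  + rewrite Un by auto; specialize (Hz Nz); lra.
- exists v; change (forall z, Cmod (z - p) < e -> exists D, wd (u v f) z D 0).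
  intros z Hz; destruct (Ceq_dec z p) as [->|Nz]; [|now apply Ud, Hf].
  apply Step; auto.
  intros eps p0; generalize (proj1 (wd_near _ _ _ _) Hv (eps / 2) ltac:(lra)); apply near_imp.
  intros w Hw; rewrite Up; destruct (Ceq_dec w p) as [->|Nw].
  + rewrite Up; replace (v - v)%C with (RtoC 0) by ring; rewrite Cmod_0; lra.
  + rewrite Un in * by auto; rewrite Up in Hw.
    assert (W1 : 0 < Cmod (w - p)) by (apply Cmod_gt_0; now apply Cminus_eq_contra).
    apply Rle_lt_trans with (eps / 2); [|lra].
    apply Rmult_le_reg_r with (Cmod (w - p)); auto; rewrite <- Cmod_mult.
    eapply Rle_trans; [|exact Hw]; right; f_equal; ring.
Qed.

(** * Smooth functions and cut-offs *)

Lemma wd_wirtinger (f : C -> C) (z A B : C) : wd f z A B -> d_z f z = A /\ d_zbar f z = B.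
Proof.
intros H.
assert (Px : partial_x f z = (A + B)%C).
{ assert (R1 : rder (fun t => f (t, Im z)) (Re z) (A * 1 + B * Cconj 1)).
  { apply (wd_rder f (fun t => (t, Im z))); [|apply rder_pair_l].
    now destruct z. }
  apply rder_iff in R1; destruct R1 as [R1 R2].
  apply injective_projections; unfold partial_x; simpl.
  - etransitivity; [apply is_derive_unique, R1|]; unfold Re; simpl; ring.
  - etransitivity; [apply is_derive_unique, R2|]; unfold Im; simpl; ring. }
assert (Py : partial_y f z = (Ci * (A - B))%C).
{ assert (R1 : rder (fun t => f (Re z, t)) (Im z) (A * Ci + B * Cconj Ci)).
  { apply (wd_rder f (fun t => (Re z, t))); [|apply rder_pair_r].
    now destruct z. }
  apply rder_iff in R1; destruct R1 as [R1 R2].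
  apply injective_projections; unfold partial_y; simpl.
  - etransitivity; [apply is_derive_unique, R1|]; unfold Re; simpl; ring.
  - etransitivity; [apply is_derive_unique, R2|]; unfold Im; simpl; ring. }
unfold d_z, d_zbar; rewrite Px, Py; split; apply injective_projections; simpl; field.
Qed.

Lemma wd_real (f : R -> R -> R) (z : C) (lx ly : R) :
  differentiable_pt_lim f (Re z) (Im z) lx ly ->
  wd (fun w => RtoC (f (Re w) (Im w))) z ((RtoC lx - Ci * RtoC ly) / 2) ((RtoC lx + Ci * RtoC ly) / 2).
Proof.
intros H; apply wd_near; intros eps e0.
destruct (H (mkposreal eps e0)) as [d Hd]; simpl in Hd.
exists d; split; [apply cond_pos|]; intros w Hw.
assert (K1 := re_le_Cmod (w - z)); assert (K2 := Cmod_Im_le (w - z)).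
replace (Re (w - z)%C) with (Re w - Re z) in K1 by (unfold Re, Cminus, Cplus, Copp; simpl; ring).
replace (Im (w - z)%C) with (Im w - Im z) in K2 by (unfold Im, Cminus, Cplus, Copp; simpl; ring).
specialize (Hd (Re w) (Im w) ltac:(lra) ltac:(lra)).
match goal with |- Cmod ?u <= _ => replace u with
 (RtoC (f (Re w) (Im w) - f (Re z) (Im z) - (lx * (Re w - Re z) + ly * (Im w - Im z)))) end.
- rewrite Cmod_R; eapply Rle_trans; [exact Hd|].
  apply Rmult_le_compat_l; [lra|]; unfold Rmax; destruct Rle_dec; lra.
- destruct w as [a b], z as [c d']; apply injective_projections; simpl; unfold Re, Im; simpl; field.
Qed.

(** The derivatives are witnesses, any functions agreeing with the Wirtinger derivatives on [U], so
    that sum, product and quotient rules supply them by formulas. *)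
Fixpoint Ck (n : nat) (U : C -> Prop) (f : C -> C) : Prop :=
  match n with
  | O => forall z, U z -> ccont f z
  | S m => exists fa fb, (forall z, U z -> wd f z (fa z) (fb z)) /\ Ck m U fa /\ Ck m U fb
  end.

Lemma Ck_ccont (n : nat) (U : C -> Prop) (f : C -> C) (z : C) : Ck n U f -> U z -> ccont f z.
Proof.
destruct n; simpl; auto; intros [fa [fb [H _]]] Hz; eapply wd_ccont; auto.
Qed.

Lemma Ck_pred (n : nat) (U : C -> Prop) : forall f, Ck (S n) U f -> Ck n U f.
Proof.
induction n; intros f H.
- intros z Hz; now apply (Ck_ccont 1 U).
- destruct H as [fa [fb [H [Ha Hb]]]]; exists fa, fb; auto.
Qed.

Lemma Ck_plus (n : nat) (U : C -> Prop) : forall f g, Ck n U f -> Ck n U g ->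
  Ck n U (fun z => f z + g z)%C.
Proof.
induction n; intros f g; simpl.
- intros Hf Hg z Hz; apply ccont_plus; auto.
- intros [fa [fb [F [Fa Fb]]]] [ga [gb [G [Ga Gb]]]].
  exists (fun z => fa z + ga z)%C, (fun z => fb z + gb z)%C; repeat split; auto.
  intros z Hz; apply wd_plus; auto.
Qed.

Lemma Ck_mult (n : nat) (U : C -> Prop) : forall f g, Ck n U f -> Ck n U g ->
  Ck n U (fun z => f z * g z)%C.
Proof.
induction n; intros f g.
- intros Hf Hg z Hz; apply ccont_mult; auto.
- intros Hf Hg; assert (Pf := Ck_pred _ _ _ Hf); assert (Pg := Ck_pred _ _ _ Hg).
  destruct Hf as [fa [fb [F [Fa Fb]]]], Hg as [ga [gb [G [Ga Gb]]]].
  exists (fun z => fa z * g z + f z * ga z)%C, (fun z => fb z * g z + f z * gb z)%C.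
  repeat split; try (apply Ck_plus; auto).
  intros z Hz; apply wd_mult; auto.
Qed.

Lemma Ck_const (n : nat) (U : C -> Prop) : forall c, Ck n U (fun _ => c).
Proof.
induction n; intros c.
- intros z _; apply ccont_const.
- exists (fun _ => RtoC 0), (fun _ => RtoC 0); repeat split; auto; intros; apply wd_const.
Qed.

Lemma Ck_inv (n : nat) (U : C -> Prop) : forall f, (forall z, U z -> f z <> RtoC 0) ->
  Ck n U f -> Ck n U (fun z => / f z)%C.
Proof.
induction n; intros f N.
- intros Hf z Hz; apply (ccont_comp Cinv); auto; eapply wd_ccont, wd_Cinv, N, Hz.
- intros Hf; assert (Pf := IHn _ N (Ck_pred _ _ _ Hf)).
  destruct Hf as [fa [fb [F [Fa Fb]]]].
  exists (fun z => (-1) * fa z * (/ f z * / f z))%C, (fun z => (-1) * fb z * (/ f z * / f z))%C.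
  repeat split; try (apply Ck_mult; [apply Ck_mult; auto using Ck_const|apply Ck_mult; auto]).
  intros z Hz; eapply wd_eq; [apply wd_inv; auto| |]; field; auto.
Qed.

Lemma Ck_ext (n : nat) (U : C -> Prop) (f g : C -> C) : open U -> (forall z, U z -> f z = g z) ->
  Ck n U f -> Ck n U g.
Proof.
intros HU E.
assert (E' : forall z, U z -> near z (fun w => f w = g w)).
{ intros z Hz; generalize (proj1 (open_near U) HU z Hz); apply near_imp; auto. }
destruct n; simpl.
- intros H z Hz; apply (ccont_ext f); auto.
- intros [fa [fb [H1 H2]]]; exists fa, fb; split; auto; intros z Hz; apply (wd_ext f); auto.
Qed.

Lemma smooth_Ck (U : C -> Prop) (n : nat) : open U -> forall f : R -> R -> R,
  (forall m z, U z -> ex_diff_n f m (Re z) (Im z)) ->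
  Ck n U (fun z => RtoC (f (Re z) (Im z))).
Proof.
intros HU; induction n; intros f H.
- intros z Hz; destruct (H O z Hz) as [Hc _].
  intros eps e0; destruct (Hc (mkposreal eps e0)) as [d Hd]; exists d; split; [apply cond_pos|].
  intros w Hw; rewrite <- RtoC_minus, Cmod_R; apply Hd.
  + eapply Rle_lt_trans; [|exact Hw]; eapply Rle_trans; [|apply re_le_Cmod]; right; f_equal.
  + eapply Rle_lt_trans; [|exact Hw]; eapply Rle_trans; [|apply Cmod_Im_le]; right; f_equal.
- set (fx := fun x y => Derive (fun t => f t y) x); set (fy := fun x y => Derive (fun t => f x t) y).
  assert (Hx : forall m z, U z -> ex_diff_n fx m (Re z) (Im z))
   by (intros m z Hz; apply (H (S m) z Hz)).
  assert (Hy : forall m z, U z -> ex_diff_n fy m (Re z) (Im z))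
   by (intros m z Hz; apply (H (S m) z Hz)).
  exists (fun z => (RtoC (fx (Re z) (Im z)) + - Ci * RtoC (fy (Re z) (Im z))) * / 2)%C,
   (fun z => (RtoC (fx (Re z) (Im z)) + Ci * RtoC (fy (Re z) (Im z))) * / 2)%C.
  repeat split.
  + intros z Hz; eapply wd_eq; [apply (wd_real f z (fx (Re z) (Im z)) (fy (Re z) (Im z)))|..].
    (* Total differentiability from the partial derivatives: the x-partial exists nearby and is
       continuous at the point, and the y-partial exists there. *)
    * apply filterdiff_differentiable_pt_lim.
      apply (is_derive_filterdiff f (Re z) (Im z) fx (fy (Re z) (Im z))).
      -- destruct z as [a b]; generalize (HU (a, b) Hz); apply filter_imp; intros [x y] Hu.
         apply Derive_correct, (H 1%nat (x, y) Hu).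
      -- apply Derive_correct, (H 1%nat z Hz).
      -- apply continuity_2d_pt_filterlim; apply (Hx O z Hz).
    * unfold Cdiv; ring.
    * reflexivity.
  + apply Ck_mult; [|apply Ck_const]; apply Ck_plus; auto; apply Ck_mult; auto using Ck_const.
  + apply Ck_mult; [|apply Ck_const]; apply Ck_plus; auto; apply Ck_mult; auto using Ck_const.
Qed.

(** By uniqueness the local witnesses all coincide with [d_z f] and [d_zbar f], which therefore
    serve globally. *)
Lemma Ck1_local (V : C -> Prop) (f : C -> C) :
  (forall z, V z -> exists U, open U /\ U z /\ Ck 1 U f) -> Ck 1 V f.
Proof.
intros H; exists (d_z f), (d_zbar f); repeat split; intros z Hz;
 destruct (H z Hz) as [U [HU [Uz [fa [fb [D [Da Db]]]]]]].
- destruct (wd_wirtinger _ _ _ _ (D z Uz)) as [-> ->]; auto.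
- apply (ccont_ext fa); auto.
  generalize (proj1 (open_near U) HU z Uz); apply near_imp; intros w Hw.
  symmetry; apply (wd_wirtinger _ _ _ _ (D w Hw)).
- apply (ccont_ext fb); auto.
  generalize (proj1 (open_near U) HU z Uz); apply near_imp; intros w Hw.
  symmetry; apply (wd_wirtinger _ _ _ _ (D w Hw)).
Qed.

Lemma Ck_sub (n : nat) (U V : C -> Prop) : (forall z, V z -> U z) ->
  forall f, Ck n U f -> Ck n V f.
Proof.
intros S; induction n; intros f; simpl; auto.
intros [fa [fb [H [Ha Hb]]]]; exists fa, fb; repeat split; auto.
Qed.

Lemma wd_real_Re (p : R -> R) (z : C) (l : R) : is_derive p (Re z) l ->
  wd (fun w => RtoC (p (Re w))) z (RtoC l / 2) (RtoC l / 2).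
Proof.
intros H; eapply wd_eq; [apply (wd_real (fun x _ => p x) z l 0)|..].
- apply differentiable_pt_lim_proj1_0, is_derive_Reals, H.
- unfold Cdiv; ring.
- unfold Cdiv; ring.
Qed.

Definition pos_sq (t : R) : R := Rmax 0 t * Rmax 0 t.

Lemma is_derive_pos_sq (t : R) : is_derive pos_sq t (2 * Rmax 0 t).
Proof.
apply is_derive_eps; intros eps e0; exists eps; split; auto; intros h Hh.
assert (B : Rabs (pos_sq (t + h) - pos_sq t - h * (2 * Rmax 0 t)) <= Rabs h * Rabs h).
{ rewrite <- Rabs_mult, (Rabs_right (h * h)) by nra.
  unfold pos_sq, Rmax; repeat destruct Rle_dec; unfold Rabs; destruct Rcase_abs; nra. }
generalize (Rabs_pos h); nra.
Qed.

(** A C^1 transition from 1 to 0 is enough, since the Cauchy transform is differentiated only once.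
    The thresholds 1 and 4 are meant for squared moduli: they are radii in ratio 2, one dyadic
    step. *)
Definition cutoff (t : R) : R := pos_sq (4 - t) / (pos_sq (4 - t) + pos_sq (t - 1)).

Lemma cutoff_den (t : R) : 0 < pos_sq (4 - t) + pos_sq (t - 1).
Proof. unfold pos_sq, Rmax; repeat destruct Rle_dec; nra. Qed.

Lemma cutoff_1 (t : R) : t <= 1 -> cutoff t = 1.
Proof.
intros H; unfold cutoff; replace (pos_sq (t - 1)) with 0.
- generalize (cutoff_den t); replace (pos_sq (t - 1)) with 0; [intros; field; lra|].
  unfold pos_sq, Rmax; destruct Rle_dec; nra.
- unfold pos_sq, Rmax; destruct Rle_dec; nra.
Qed.

Lemma cutoff_0 (t : R) : 4 <= t -> cutoff t = 0.
Proof.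
intros H; unfold cutoff; replace (pos_sq (4 - t)) with 0.
- unfold Rdiv; ring.
- unfold pos_sq, Rmax; destruct Rle_dec; nra.
Qed.

Lemma cutoff_range (t : R) : 0 <= cutoff t <= 1.
Proof.
generalize (cutoff_den t); intros D.
assert (0 <= pos_sq (4 - t) /\ 0 <= pos_sq (t - 1)) by (unfold pos_sq; split; nra).
unfold cutoff; split.
- apply Rmult_le_pos; [lra|left; now apply Rinv_0_lt_compat].
- apply Rmult_le_reg_r with (pos_sq (4 - t) + pos_sq (t - 1)); auto.
  unfold Rdiv; rewrite Rmult_assoc, Rinv_l by lra; lra.
Qed.

Lemma cutoff_C1 : exists p, (forall t, is_derive cutoff t (p t)) /\ forall t, continuous p t.
Proof.
assert (Dp : forall t, is_derive (fun t => pos_sq (4 - t)) t (- (2 * Rmax 0 (4 - t)))).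
{ intros t; evar (l : R); replace (- (2 * Rmax 0 (4 - t))) with l.
  - apply (is_derive_comp pos_sq (fun t => 4 - t)); [apply is_derive_pos_sq|].
    auto_derive; reflexivity || auto.
  - unfold l, scal; simpl; unfold mult; simpl; ring. }
assert (Dm : forall t, is_derive (fun t => pos_sq (t - 1)) t (2 * Rmax 0 (t - 1))).
{ intros t; evar (l : R); replace (2 * Rmax 0 (t - 1)) with l.
  - apply (is_derive_comp pos_sq (fun t => t - 1)); [apply is_derive_pos_sq|].
    auto_derive; reflexivity || auto.
  - unfold l, scal; simpl; unfold mult; simpl; ring. }
eexists; split.
- intros t; apply is_derive_div; [apply Dp| |generalize (cutoff_den t); lra].
  apply (is_derive_plus (fun t => pos_sq (4 - t)) (fun t => pos_sq (t - 1))); [apply Dp|apply Dm].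
- assert (C1 : forall t, continuous (fun t => pos_sq (4 - t)) t)
   by (intros; apply @ex_derive_continuous; eexists; apply Dp).
  assert (C2 : forall t, continuous (fun t => pos_sq (t - 1)) t)
   by (intros; apply @ex_derive_continuous; eexists; apply Dm).
  assert (M : forall t, continuous (Rmax 0) t).
  { intros t; apply filterlim_locally; intros eps; exists eps; intros s Hs.
    eapply Rle_lt_trans; [|exact Hs].
    unfold abs, minus, plus, opp; simpl; unfold Rmax, Rabs.
    repeat destruct Rle_dec; repeat destruct Rcase_abs; lra. }
  assert (M1 : forall t, continuous (fun t => - (2 * Rmax 0 (4 - t))) t).
  { intros t; apply (continuous_opp (fun t => 2 * Rmax 0 (4 - t))).
    apply (continuous_scal_r 2 (fun t => Rmax 0 (4 - t))).
    apply (continuous_comp (fun t => 4 - t) (Rmax 0)); [|apply M].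
    apply (continuous_minus (fun _ => 4) (fun t => t)); [apply continuous_const|apply continuous_id]. }
  assert (M2 : forall t, continuous (fun t => 2 * Rmax 0 (t - 1)) t).
  { intros t; apply (continuous_scal_r 2 (fun t => Rmax 0 (t - 1))).
    apply (continuous_comp (fun t => t - 1) (Rmax 0)); [|apply M].
    apply (continuous_minus (fun t => t) (fun _ => 1)); [apply continuous_id|apply continuous_const]. }
  assert (D0 : forall t, continuous (fun t => pos_sq (4 - t) + pos_sq (t - 1)) t)
   by (intros; apply (continuous_plus (fun t => pos_sq (4 - t)) (fun t => pos_sq (t - 1))); auto).
  intros t; apply (continuous_mult (K := R_AbsRing)
   (fun t => - (2 * Rmax 0 (4 - t)) * (pos_sq (4 - t) + pos_sq (t - 1)) -
      pos_sq (4 - t) * (- (2 * Rmax 0 (4 - t)) + 2 * Rmax 0 (t - 1)))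
   (fun t => / (pos_sq (4 - t) + pos_sq (t - 1)) ^ 2)).
  + apply (continuous_minus (fun t => - (2 * Rmax 0 (4 - t)) * (pos_sq (4 - t) + pos_sq (t - 1)))
      (fun t => pos_sq (4 - t) * (- (2 * Rmax 0 (4 - t)) + 2 * Rmax 0 (t - 1)))).
    * apply (continuous_mult (K := R_AbsRing)); auto.
    * apply (continuous_mult (K := R_AbsRing)); auto.
      apply (continuous_plus (fun t => - (2 * Rmax 0 (4 - t))) (fun t => 2 * Rmax 0 (t - 1))); auto.
  + apply (continuous_comp (fun t => (pos_sq (4 - t) + pos_sq (t - 1)) ^ 2) Rinv).
    * apply (continuous_mult (K := R_AbsRing)); auto.
      apply (continuous_mult (K := R_AbsRing)); auto; apply continuous_const.
    * apply continuity_pt_filterlim, continuity_pt_inv; [apply derivable_continuous_pt, derivable_pt_id|].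
      apply pow_nonzero; generalize (cutoff_den t); lra.
Qed.

(** The squared modulus is z conj z, differentiable at 0 as well, where the modulus itself is
    not. *)
Definition bump (m : R) (z : C) : C := RtoC (cutoff (m * Cmod z ^ 2)).

Lemma Ck1_bump (m : R) : Ck 1 (fun _ => True) (bump m).
Proof.
destruct cutoff_C1 as [p [Dp Cp]].
assert (E : forall z, (RtoC m * (z * Cconj z))%C = RtoC (m * Cmod z ^ 2))
 by (intros; rewrite RtoC_mult, Cmod2_conj; reflexivity).
assert (Cid : forall w, ccont (fun w => w) w) by (intros; eapply wd_ccont, wd_id).
assert (Ccj : forall w, ccont Cconj w) by (intros; eapply wd_ccont, wd_conj).
assert (Cq : forall z, ccont (fun z => RtoC (p (m * Cmod z ^ 2)%R)) z).
{ intros z; apply (ccont_ext (fun z => RtoC (p (Re (RtoC m * (z * Cconj z))%C)))).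
  - exists 1; split; [lra|]; intros w _; now rewrite E.
  - apply (ccont_comp (fun w => RtoC (p (Re w)))).
    + apply (ccont_Re (fun t => RtoC (p t))), rcont_iff; split; [apply Cp|apply continuous_const].
    + apply ccont_scal, ccont_mult; auto. }
exists (fun z => RtoC (p (m * Cmod z ^ 2)%R) * (RtoC m * Cconj z))%C,
 (fun z => RtoC (p (m * Cmod z ^ 2)%R) * (RtoC m * z))%C; repeat split; intros z _.
- eapply wd_eq.
  + apply (wd_ext (fun z => RtoC (cutoff (Re (RtoC m * (z * Cconj z))%C)))).
    { exists 1; split; [lra|]; intros w _; unfold bump; now rewrite E. }
    apply (wd_comp (fun w => RtoC (cutoff (Re w)))).
    * apply (wd_real_Re cutoff); apply Dp.
    * apply wd_scal, wd_mult; [apply wd_id|apply wd_conj].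
  + rewrite E, re_RtoC.
    replace (Cconj (RtoC m * (RtoC 0 * Cconj z + z * RtoC 1))%C) with (RtoC m * Cconj z)%C
     by (apply injective_projections; simpl; ring).
    field; apply RtoC_neq0; lra.
  + rewrite E, re_RtoC.
    replace (Cconj (RtoC m * (RtoC 1 * Cconj z + z * RtoC 0))%C) with (RtoC m * z)%C
     by (apply injective_projections; simpl; ring).
    field; apply RtoC_neq0; lra.
- apply ccont_mult; auto; now apply ccont_scal.
- apply ccont_mult; auto; now apply ccont_scal.
Qed.

(** In each coordinate the intervals of radius [t n] about [s n] are nested, and a common point of
    all of them is the limit; the 2 puts the two coordinates together. *)
Lemma telescoping_limit (s : nat -> C) (t : nat -> R) : (forall n, 0 <= t n) ->
  (forall n, Cmod (s (S n) - s n) <= t n - t (S n)) ->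
  exists l, forall n, Cmod (s n - l) <= 2 * t n.
Proof.
intros T H.
destruct (nested_intervals (fun n => Re (s n) - t n) (fun n => 2 * t n)) as [x Hx].
{ intros n; generalize (Rle_trans _ _ _ (re_le_Cmod _) (H n)); unfold Re; simpl; unfold Rabs; destruct Rcase_abs; lra. }
{ intros n; generalize (Rle_trans _ _ _ (re_le_Cmod _) (H n)); unfold Re; simpl; unfold Rabs; destruct Rcase_abs; lra. }
{ intros n; generalize (T n); lra. }
destruct (nested_intervals (fun n => Im (s n) - t n) (fun n => 2 * t n)) as [y Hy].
{ intros n; generalize (Rle_trans _ _ _ (Cmod_Im_le _) (H n)); unfold Im; simpl; unfold Rabs; destruct Rcase_abs; lra. }
{ intros n; generalize (Rle_trans _ _ _ (Cmod_Im_le _) (H n)); unfold Im; simpl; unfold Rabs; destruct Rcase_abs; lra. }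
{ intros n; generalize (T n); lra. }
exists (x, y); intros n; eapply Rle_trans; [apply Cmod_le_abs_sum|].
generalize (Hx n) (Hy n); unfold Re, Im; simpl; unfold Rabs; repeat destruct Rcase_abs; lra.
Qed.

(** On this annulus - ln |z|^2 is at least 2 (n + 1) ln 2, hence at least n + 1 as ln 2 > 1/2, while
    1/|z| is at most 2^(n+3). *)
Lemma poincare_bound (z : C) (n : nat) : / 2 ^ (n + 3) <= Cmod z <= / 2 ^ (n + 1) ->
  Cmod z * poincare_coef z <= 2 ^ (n + 3) / (INR n + 1) ^ 2.
Proof.
intros [H1 H2]; set (m := Cmod z) in *.
assert (p3 : 0 < 2 ^ (n + 3)) by (apply pow_lt; lra).
assert (p1 : 0 < 2 ^ (n + 1)) by (apply pow_lt; lra).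
assert (m0 : 0 < m) by (eapply Rlt_le_trans; [|exact H1]; now apply Rinv_0_lt_compat).
assert (n0 : 0 < INR n + 1) by (generalize (pos_INR n); lra).
assert (Ln : INR n + 1 <= - ln (m ^ 2)).
{ assert (E1 : ln (m ^ 2) = 2 * ln m).
  { replace (m ^ 2) with (m * m) by ring; rewrite ln_mult by auto; ring. }
  assert (E2 : ln m <= - (INR (n + 1) * ln 2)).
  { replace (- (INR (n + 1) * ln 2)) with (ln (/ 2 ^ (n + 1))).
    - destruct H2 as [H2|H2]; [left; apply ln_increasing; auto|right; now rewrite H2].
    - rewrite ln_Rinv by auto; rewrite ln_pow by lra; reflexivity. }
  rewrite plus_INR in E2; simpl in E2; generalize ln_lt_2; intros; rewrite E1.
  assert ((INR n + 1) * / 2 <= (INR n + 1) * ln 2) by (apply Rmult_le_compat_l; lra).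
  lra. }
unfold poincare_coef; fold m.
assert (Q : (INR n + 1) ^ 2 <= (- ln (m ^ 2)) ^ 2) by (apply pow_incr; lra).
assert (Q0 : 0 < (INR n + 1) ^ 2) by (apply pow_lt; auto).
replace (m * / (m ^ 2 * (- ln (m ^ 2)) ^ 2)) with (/ m * / (- ln (m ^ 2)) ^ 2).
2:{ field; split; lra. }
apply Rmult_le_compat.
- left; now apply Rinv_0_lt_compat.
- left; apply Rinv_0_lt_compat; lra.
- rewrite <- (Rinv_inv (2 ^ (n + 3))); apply Rinv_le_contravar; auto.
  now apply Rinv_0_lt_compat.
- now apply Rinv_le_contravar.
Qed.

(** * The d-bar equation on the punctured disk *)

(** The square of 2^(n+2), so that [bump (dyadic n)] descends from 1 to 0 between the radii 2^-(n+2)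
    and 2^-(n+1). *)
Definition dyadic (n : nat) : R := 16 * 4 ^ n.

Lemma dyadic_sq (n : nat) : dyadic n = (4 * 2 ^ n) ^ 2.
Proof.
unfold dyadic; replace (4 ^ n) with (2 ^ n * 2 ^ n); [ring|].
rewrite <- Rpow_mult_distr; f_equal; ring.
Qed.

Lemma bump_dyadic_1 (n : nat) (z : C) : Cmod z <= / 2 ^ (n + 2) -> bump (dyadic n) z = RtoC 1.
Proof.
intros H; unfold bump; f_equal; apply cutoff_1.
rewrite dyadic_sq, <- Rpow_mult_distr.
replace 1 with (1 ^ 2) by ring; apply pow_incr.
assert (p : 0 < 2 ^ (n + 2)) by (apply pow_lt; lra).
replace (4 * 2 ^ n) with (2 ^ (n + 2)) by (rewrite pow_add; ring).
split; [apply Rmult_le_pos; [lra|apply Cmod_ge_0]|].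
apply Rmult_le_compat_l with (r := 2 ^ (n + 2)) in H; [|lra].
rewrite Rinv_r in H; lra.
Qed.

Lemma bump_dyadic_0 (n : nat) (z : C) : / 2 ^ (n + 1) <= Cmod z -> bump (dyadic n) z = RtoC 0.
Proof.
intros H; unfold bump; f_equal; apply cutoff_0.
rewrite dyadic_sq, <- Rpow_mult_distr.
replace 4 with (2 ^ 2) at 1 by ring; apply pow_incr; split; [lra|].
assert (p : 0 < 2 ^ (n + 1)) by (apply pow_lt; lra).
replace (4 * 2 ^ n) with (2 * 2 ^ (n + 1)) by (rewrite pow_add; ring).
apply Rmult_le_compat_l with (r := 2 ^ (n + 1)) in H; [|lra].
rewrite Rinv_r in H; lra.
Qed.

Lemma Ck_0_of_open (V : C -> Prop) (f : C -> C) (z : C) :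
  open V -> V z -> (forall w, V w -> f w = RtoC 0) -> exists U, open U /\ U z /\ Ck 1 U f.
Proof.
intros HV Vz H; exists V; split; [exact HV|split; [exact Vz|]].
apply (Ck_ext 1 V (fun _ => RtoC 0)); auto; [intros; symmetry; auto|apply Ck_const].
Qed.

Lemma open_punctured_disk : open punctured_disk.
Proof.
apply open_near; intros z [H1 H2].
assert (m := proj1 (Cmod_gt_0 z) H2).
exists (Rmin (1 - Cmod z) (Cmod z)); split; [apply Rmin_pos; lra|].
intros w Hw.
assert (W1 : Cmod (w - z) < 1 - Cmod z) by (eapply Rlt_le_trans; [exact Hw|apply Rmin_l]).
assert (W2 : Cmod (w - z) < Cmod z) by (eapply Rlt_le_trans; [exact Hw|apply Rmin_r]).
split.
- generalize (Cmod_triangle_inv w z); lra.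
- intros ->; replace (0 - z)%C with (- z)%C in W2 by ring; rewrite Cmod_opp in W2; lra.
Qed.

(** The right-hand side z F(z) is cut into dyadic annuli. On the n-th annulus
    the product of its size and its sup norm is O(1/n^2), which is the bound on
    its Cauchy transform, so the series converges uniformly, even at 0. *)
Lemma dbar_solution (F : C -> R) (K : R) : 0 < K ->
  Ck 1 punctured_disk (fun z => RtoC (F z)) ->
  (forall z, punctured_disk z -> Rabs (F z) <= K * poincare_coef z) ->
  exists (v : C -> C) (S : nat -> C -> C) (c : R), 0 < c /\ ccont v 0 /\
    (forall n z, Cmod (S n z - v z) <= c / (INR n + 1)) /\
    (forall n z, Cmod z < / 4 -> / 2 ^ (n + 1) < Cmod z -> exists A, wd (S n) z A (z * RtoC (F z))) /\
    (forall n z, ccont (S n) z).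
Proof.
intros K0 HF FK; generalize PI_RGT_0; intros P.
(* For m <= n this is z F cut off to 2^-(n+2) <= |z| <= 2^-(m+1). *)
set (G := fun m n z => (z * RtoC (F z) * (bump (dyadic m) z - bump (dyadic n) z))%C).
assert (p2 : forall n, 0 < 2 ^ n) by (intros; apply pow_lt; lra).
assert (B : forall m n, Ck 1 (fun _ => True) (fun z => bump (dyadic m) z - bump (dyadic n) z)%C).
{ intros m n; apply (Ck_ext 1 _ (fun z => bump (dyadic m) z + - 1 * bump (dyadic n) z)%C).
  - apply open_true.
  - intros; ring.
  - apply Ck_plus; [apply Ck1_bump|apply Ck_mult; [apply Ck_const|apply Ck1_bump]]. }
assert (Gfar : forall m n z, (m <= n)%nat -> / 2 ^ (m + 1) <= Cmod z -> G m n z = RtoC 0).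
{ intros m n z L H; unfold G; rewrite !bump_dyadic_0; [ring| |auto].
  eapply Rle_trans; [|exact H]; apply Rinv_le_contravar; auto.
  apply Rle_pow; lra || lia. }
assert (Gnear : forall m n z, (m <= n)%nat -> Cmod z <= / 2 ^ (n + 2) -> G m n z = RtoC 0).
{ intros m n z L H; unfold G; rewrite !bump_dyadic_1; [ring|auto|].
  eapply Rle_trans; [exact H|]; apply Rinv_le_contravar; auto.
  apply Rle_pow; lra || lia. }
assert (i1 : forall n, / 2 ^ (n + 1) < 1).
{ intros n; rewrite <- Rinv_1; apply Rinv_lt_contravar; [rewrite Rmult_1_l; auto|].
  apply Rlt_pow_R1; lra || lia. }
(* [F] is regular only on the punctured disk. That set and the two open sets inside and outside the
   annulus, where [G m n] vanishes, cover the plane, and C^1 regularity is local. *)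
assert (HG : forall m n, (m <= n)%nat -> Ck 1 (fun _ => True) (G m n)).
{ intros m n L; apply Ck1_local; intros z _.
  destruct (Rlt_le_dec (Cmod z) (/ 2 ^ (n + 2))) as [C1|C1].
  { apply (Ck_0_of_open (fun z => Cmod z < / 2 ^ (n + 2))); auto.
    - apply open_near; intros w Hw; exists (/ 2 ^ (n + 2) - Cmod w); split; [lra|].
      intros u Hu; generalize (Cmod_triangle_inv u w); lra.
    - intros w Hw; apply Gnear; auto; lra. }
  destruct (Rlt_le_dec (/ 2 ^ (m + 1)) (Cmod z)) as [C2|C2].
  { apply (Ck_0_of_open (fun z => / 2 ^ (m + 1) < Cmod z)); auto.
    - apply open_near; intros w Hw; exists (Cmod w - / 2 ^ (m + 1)); split; [lra|].
      intros u Hu; generalize (Cmod_triangle_inv w u); rewrite Cmod_minus_sym; lra.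
    - intros w Hw; apply Gfar; auto; lra. }
  exists punctured_disk; split; [apply open_punctured_disk|split].
  - split; [generalize (i1 m); lra|]; apply Cmod_gt_0.
    eapply Rlt_le_trans; [|exact C1]; now apply Rinv_0_lt_compat.
  - apply Ck_mult; [apply Ck_mult; auto|].
    + exists (fun _ => RtoC 1), (fun _ => RtoC 0); split; [intros; apply wd_id|].
      split; apply (Ck_const 0).
    + apply (Ck_sub 1 (fun _ => True)); auto. }
assert (Gc : forall m n z, (m <= n)%nat -> ccont (G m n) z)
 by (intros m n z L; apply (Ck_ccont 1 (fun _ => True)); auto).
set (S := fun n => cauchy_transform (G O n)).
(* [cauchy_transform_bound] gives 16 pi K 2^(n+3)/(n+1)^2 2^-(n+1) = 64 pi K/(n+1)^2 for the n-th
   increment. As n + 2 <= 2 (n + 1), doubling the constant makes it at most the telescoping c/(n+1)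
   - c/(n+2). *)
set (c := 128 * PI * K).
assert (c0 : 0 < c) by (unfold c; apply Rmult_lt_0_compat; lra).
assert (St : forall n z, Cmod (S (Datatypes.S n) z - S n z) <= c / (INR n + 1) - c / (INR (Datatypes.S n) + 1)).
{ intros n z; unfold S; rewrite <- cauchy_transform_minus by (intros; apply Gc; lia).
  assert (n0 : 0 < INR n + 1) by (generalize (pos_INR n); lra).
  set (b := K * (2 ^ (n + 3) / (INR n + 1) ^ 2)).
  eapply Rle_trans; [apply (cauchy_transform_bound _ _ b (/ 2 ^ (n + 1)))|].
  - intros w; apply ccont_minus; apply Gc; lia.
  - now apply Rinv_0_lt_compat.
  - intros w; replace (G O (Datatypes.S n) w - G O n w)%C with (G n (Datatypes.S n) w) by (unfold G; ring).
    assert (b0 : 0 <= b).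
    { unfold b; apply Rmult_le_pos; [lra|]; apply Rmult_le_pos; [left; auto|].
      left; apply Rinv_0_lt_compat, pow_lt; auto. }
    destruct (Rle_dec (/ 2 ^ (n + 1)) (Cmod w)) as [C1|C1].
    { rewrite Gfar, Cmod_0; auto. }
    destruct (Rle_dec (Cmod w) (/ 2 ^ (Datatypes.S n + 2))) as [C2|C2].
    { rewrite Gnear, Cmod_0; auto. }
    replace (Datatypes.S n + 2)%nat with (n + 3)%nat in C2 by lia.
    assert (Pw : punctured_disk w).
    { split; [generalize (i1 n); lra|]; apply Cmod_gt_0.
      assert (0 < / 2 ^ (n + 3)) by (now apply Rinv_0_lt_compat); lra. }
    unfold G, bump; rewrite <- RtoC_minus, !Cmod_mult, !Cmod_R.
    generalize (cutoff_range (dyadic n * Cmod w ^ 2)) (cutoff_range (dyadic (Datatypes.S n) * Cmod w ^ 2)).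
    intros R1 R2.
    apply Rle_trans with (Cmod w * Rabs (F w) * 1).
    + apply Rmult_le_compat_l; [apply Rmult_le_pos; [apply Cmod_ge_0|apply Rabs_pos]|].
      unfold Rabs; destruct Rcase_abs; lra.
    + rewrite Rmult_1_r; apply Rle_trans with (Cmod w * (K * poincare_coef w)).
      * apply Rmult_le_compat_l; [apply Cmod_ge_0|auto].
      * unfold b; replace (Cmod w * (K * poincare_coef w)) with (K * (Cmod w * poincare_coef w)) by ring.
        apply Rmult_le_compat_l; [lra|]; apply poincare_bound; lra.
  - intros w Hw.
    replace (G O (Datatypes.S n) w - G O n w)%C with (G n (Datatypes.S n) w) by (unfold G; ring).
    apply Gfar; auto.
  - assert (E : 16 * PI * b * / 2 ^ (n + 1) = c / (INR n + 1) * (/ 2 * / (INR n + 1))).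
    { unfold b, c; rewrite !pow_add; field; split; [lra|apply pow_nonzero; lra]. }
    rewrite E, S_INR.
    replace (c / (INR n + 1) - c / (INR n + 1 + 1)) with (c / (INR n + 1) * / (INR n + 1 + 1)) by (field; lra).
    apply Rmult_le_compat_l; [left; now apply Rdiv_lt_0_compat|].
    rewrite <- Rinv_mult; apply Rinv_le_contravar; generalize (pos_INR n); lra. }
assert (T0 : forall n, 0 <= c / (INR n + 1))
 by (intros n; left; apply Rdiv_lt_0_compat; auto; generalize (pos_INR n); lra).
set (v := fun z => proj1_sig (constructive_indefinite_description _
   (telescoping_limit (fun n => S n z) (fun n => c / (INR n + 1)) T0 (fun n => St n z)))).
assert (Hv : forall n z, Cmod (S n z - v z) <= 2 * (c / (INR n + 1))).
{ intros n z; unfold v; destruct (constructive_indefinite_description _ _) as [l Hl]; apply Hl. }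
assert (SC : forall n, (forall z, ccont (S n) z) /\
  forall z, Cmod z < 1 -> exists A, wd (S n) z A (G O n z)).
{ intros n; destruct (HG O n (Nat.le_0_l n)) as [ga [gb [D [Ha Hb]]]].
  assert (Gn : forall z, ccont (G O n) z) by (intros; apply Gc; lia).
  assert (W : forall z, wd (S n) z (cauchy_transform ga z) (cauchy_transform gb z)).
  { intros z; apply wd_cauchy_transform; auto. }
  split; [intros z; eapply wd_ccont, W|].
  intros z Hz; exists (cauchy_transform ga z); eapply wd_eq; [apply W|reflexivity|].
  apply (cauchy_transform_dbar (G O n) ga gb); auto.
  intros w Hw; apply Gfar; [lia|]; generalize (i1 O); lra. }
exists v, S, (2 * c); split; [lra|].
assert (Sc : forall n z, ccont (S n) z) by (intros; apply SC).
split; [|split; [|split]]; auto.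
- intros eps e0.
  destruct (archimed_cor1 (eps / (8 * c))) as [N [N1 N2]]; [apply Rdiv_lt_0_compat; lra|].
  assert (N3 : 2 * (c / (INR N + 1)) < eps / 4).
  { assert (0 < INR N) by now apply lt_0_INR.
    apply Rle_lt_trans with (2 * c * / INR N).
    - unfold Rdiv; rewrite <- Rmult_assoc; apply Rmult_le_compat_l; [lra|].
      apply Rinv_le_contravar; lra.
    - apply Rmult_lt_compat_l with (r := 2 * c) in N1; [|lra].
      replace (2 * c * (eps / (8 * c))) with (eps / 4) in N1 by (field; lra); lra. }
  generalize (Sc N (RtoC 0) (eps / 4) ltac:(lra)); apply near_imp; intros w Hw.
  replace (v w - v 0)%C with ((S N w - S N 0) - (S N w - v w) + (S N 0 - v 0))%C by ring.
  eapply Rle_lt_trans; [apply Cmod_triangle|].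
  eapply Rle_lt_trans; [apply Rplus_le_compat_r, Cmod_triangle_minus|].
  generalize (Hv N w) (Hv N (RtoC 0)); lra.
- intros n z; eapply Rle_trans; [apply Hv|]; right; unfold Rdiv; ring.
(* The radius 1/4 is where the outer cut-off [bump (dyadic 0)] starts to descend; within the range
   of |z| given here it is 1 and the inner one is 0, so that the cut-off source is z F itself. *)
- intros n z H1 H2; destruct (proj2 (SC n) z ltac:(lra)) as [A HA]; exists A.
  eapply wd_eq; [exact HA|reflexivity|].
  unfold G; rewrite bump_dyadic_1, bump_dyadic_0; [ring|lra|simpl; lra].
Qed.

(** * Curvature, exponential and logarithm *)

Lemma scal_scal {V : ModuleSpace C_Ring} (c d : C) (u : V) : c ** (d ** u) = (c * d)%C ** u.
Proof. exact (scal_assoc (c : C_Ring) (d : C_Ring) u). Qed.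

Lemma scal_1 {V : ModuleSpace C_Ring} (u : V) : RtoC 1 ** u = u.
Proof. exact (scal_one u). Qed.

Lemma scal_0 {V : ModuleSpace C_Ring} (u : V) : RtoC 0 ** u = zero.
Proof. exact (scal_zero_l u). Qed.

Lemma frame_neq0 {X} (L : line_bundle X) (i : chart L) (z : C) :
  chart_dom L i z -> frame L i z <> zero.
Proof.
intros Hz E; destruct (frame_basis _ L i z Hz zero) as [c [_ Hc]].
assert (H : forall d : C, zero = d ** frame L i z)
 by (intros d; rewrite E; symmetry; apply (scal_zero_r (d : C_Ring))).
apply C1_nz; now rewrite <- (Hc _ (H (RtoC 1))), <- (Hc _ (H (RtoC 0))).
Qed.

Lemma frame_scal_inj {X} (L : line_bundle X) (i : chart L) (z c d : C) :
  chart_dom L i z -> c ** frame L i z = d ** frame L i z -> c = d.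
Proof.
intros Hz E; destruct (frame_basis _ L i z Hz (c ** frame L i z)) as [k [_ Hk]].
now rewrite <- (Hk c eq_refl), <- (Hk d E).
Qed.

Lemma chart_dom_near {X} (L : line_bundle X) (i : chart L) (z : C) :
  chart_dom L i z -> near z (chart_dom L i).
Proof. intros H; exact (proj1 (open_near _) (proj1 (chart_open _ L i)) z H). Qed.

Definition hsq {X} {L : line_bundle X} (h : hermitian_metric L) (z : C) (u : fibre L z) : R :=
  Re (herm h z u u).

Lemma hsq_scal {X} {L : line_bundle X} (h : hermitian_metric L) (z : C) (c : C)
    (u : fibre L z) : X z -> hsq h z (c ** u) = Cmod c ^ 2 * hsq h z u.
Proof.
intros Hz; unfold hsq; assert (E : herm h z (c ** u) (c ** u) = (RtoC (Cmod c ^ 2) * herm h z u u)%C).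
{ etransitivity; [exact (herm_scal _ h z Hz c u (c ** u))|].
  rewrite (herm_conj _ h z Hz (c ** u) u), (herm_scal _ h z Hz c u u), Cmult_conj,
    <- (herm_conj _ h z Hz u u), Cmod2_conj; ring. }
rewrite E, re_scal_l; reflexivity.
Qed.

Lemma hsq_pos {X} {L : line_bundle X} (h : hermitian_metric L) (z : C) (u : fibre L z) :
  X z -> u <> zero -> 0 < hsq h z u.
Proof. intros Hz Hu; now apply (herm_pos _ h z Hz). Qed.

Lemma Rinv_ge_0 (x : R) : 0 <= x -> 0 <= / x.
Proof.
intros [H|<-]; [left; now apply Rinv_0_lt_compat|rewrite Rinv_0; lra].
Qed.

(** Locally F is minus the conj-z derivative of theta, the z-derivative of the log of the weight.
    Three derivatives of the smooth weight are used: two to form F and one for its C^1 regularity,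
    which the d-bar equation requires. *)
Lemma curvature_potential (L : line_bundle punctured_disk) (h : hermitian_metric L) (K : R) :
  curvature_bounded L h K -> exists F : C -> R,
    Ck 1 punctured_disk (fun z => RtoC (F z)) /\
    (forall z, punctured_disk z -> Rabs (F z) <= K * poincare_coef z) /\
    forall i, exists th,
      (forall z, chart_dom L i z -> exists A, wd th z A (- RtoC (F z))) /\
      (forall z, chart_dom L i z -> exists B,
        wd (fun z => RtoC (frame_weight h i z)) z (th z * RtoC (frame_weight h i z)) B).
Proof.
intros [f [Hf Kf]]; exists (fun z => f z * poincare_coef z).
assert (X : forall i, exists th tha thb,
  (forall z, chart_dom L i z -> exists B,
    wd (fun z => RtoC (frame_weight h i z)) z (th z * RtoC (frame_weight h i z)) B) /\
  (forall z, chart_dom L i z -> wd th z (tha z) (thb z)) /\ Ck 1 (chart_dom L i) thb /\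
  (forall z, chart_dom L i z -> (- 1 * thb z)%C = RtoC (f z * poincare_coef z))).
{ intros i; set (U := chart_dom L i).
  assert (HU : open U) by apply (chart_open _ L i).
  assert (C3 : Ck 3 U (fun z => RtoC (frame_weight h i z))).
  { apply (Ck_ext 3 U (fun z => RtoC (frame_weight h i (Re z, Im z)))); auto.
    - intros z _; now destruct z.
    - apply (smooth_Ck U 3 HU (fun x y => frame_weight h i (x, y))).
      intros m z Hz; exact (herm_smooth _ h i m z Hz). }
  assert (W0 : forall z, U z -> RtoC (frame_weight h i z) <> RtoC 0).
  { intros z Hz; apply RtoC_neq0; generalize (frame_weight_pos h i z Hz); lra. }
  assert (C2 := Ck_pred _ _ _ C3).
  destruct C3 as [fa [fb [D [Ca Cb]]]].
  set (th := fun z => (fa z * / RtoC (frame_weight h i z))%C).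
  assert (Cth : Ck 2 U th) by (apply Ck_mult; [exact Ca|apply Ck_inv; auto]).
  destruct Cth as [tha [thb [Dth [_ Cthb]]]].
  exists th, tha, thb; split; [|split; [|split]]; auto.
  - intros z Hz; exists (fb z); eapply wd_eq; [apply D; auto| |reflexivity].
    unfold th; field; auto.
  - intros z Hz; rewrite <- (Hf i z Hz); unfold curvature_coef.
    replace (d_zbar (chern_form h i) z) with (thb z); [ring|].
    symmetry; apply (wd_wirtinger _ _ (tha z)).
    apply (wd_ext th); [|apply Dth; auto].
    generalize (chart_dom_near L i z Hz); apply near_imp; intros w Hw.
    unfold th, chern_form, Cdiv; f_equal; symmetry; apply (wd_wirtinger _ _ _ _ (D w Hw)). }
split; [|split].
- apply Ck1_local; intros z Hz; destruct (chart_cover _ L z Hz) as [i Hi].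
  destruct (X i) as [th [tha [thb [_ [_ [Cb E]]]]]].
  exists (chart_dom L i); split; [apply (chart_open _ L i)|split; [exact Hi|]].
  apply (Ck_ext 1 _ (fun z => - 1 * thb z)%C); auto; [apply (chart_open _ L i)|].
  apply Ck_mult; auto using Ck_const.
- intros z Hz; rewrite Rabs_mult.
  assert (P : 0 <= poincare_coef z).
  { unfold poincare_coef; apply Rinv_ge_0, Rmult_le_pos; apply pow2_ge_0. }
  rewrite (Rabs_right (poincare_coef z)) by lra.
  apply Rmult_le_compat_r; auto.
- intros i; destruct (X i) as [th [tha [thb [D [Dt [_ E]]]]]]; exists th; split; auto.
  intros z Hz; exists (tha z); eapply wd_eq; [apply Dt; auto|reflexivity|].
  rewrite <- E by auto; ring.
Qed.

Definition cexp (w : C) : C := (RtoC (exp (Re w)) * cis (Im w))%C.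

Lemma wd_cexp (w : C) : wd cexp w (cexp w) 0.
Proof.
assert (Y : forall (p : R -> R) l, is_derive p (Im w) l ->
  wd (fun w => RtoC (p (Im w))) w (- Ci * RtoC l / 2) (Ci * RtoC l / 2)).
{ intros p l H; eapply wd_eq; [apply (wd_real (fun _ y => p y) w 0 l)|..].
  - assert (D := differentiable_pt_lim_proj1_0 p (Im w) (Re w) l (proj1 (is_derive_Reals _ _ _) H)).
    intros eps; destruct (D eps) as [d Hd]; exists d; intros u v Hu Hv.
    specialize (Hd v u Hv Hu); rewrite Rmax_comm.
    replace (0 * (u - Re w) + l * (v - Im w)) with (l * (v - Im w) + 0 * (u - Re w)) by ring.
    exact Hd.
  - unfold Cdiv; ring.
  - unfold Cdiv; ring. }
eapply wd_eq.
- apply (wd_ext (fun w => RtoC (exp (Re w)) * (RtoC (cos (Im w)) + Ci * RtoC (sin (Im w))))%C).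
  { exists 1; split; [lra|]; intros u _; unfold cexp, cis; f_equal.
    apply injective_projections; simpl; ring. }
  apply wd_mult.
  + apply (wd_real_Re exp), is_derive_exp.
  + apply wd_plus; [apply (Y cos), is_derive_cos|apply wd_scal, (Y sin), is_derive_sin].
- unfold cexp, cis; apply injective_projections; simpl; field.
- apply injective_projections; simpl; field.
Qed.

Lemma Cmod_cexp (w : C) : Cmod (cexp w) = exp (Re w).
Proof.
unfold cexp; rewrite Cmod_mult, Cmod_cis, Cmod_R, Rabs_right; [ring|].
generalize (exp_pos (Re w)); lra.
Qed.

Lemma cexp_neq0 (w : C) : cexp w <> RtoC 0.
Proof. apply Cmod_gt_0; rewrite Cmod_cexp; apply exp_pos. Qed.

Lemma cexp_plus (u w : C) : cexp (u + w)%C = (cexp u * cexp w)%C.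
Proof.
unfold cexp; rewrite re_plus, im_plus, exp_plus, RtoC_mult.
unfold cis; rewrite cos_plus, sin_plus; apply injective_projections; simpl; ring.
Qed.

Lemma cexp_0 : cexp 0 = RtoC 1.
Proof.
unfold cexp, cis; simpl; rewrite exp_0, cos_0, sin_0.
apply injective_projections; simpl; ring.
Qed.

Lemma polar_form (x y : R) : x * x + y * y = 1 -> exists t, - PI <= t <= PI /\ cis t = (x, y).
Proof.
intros H; assert (Hx : -1 <= x <= 1) by (split; nra).
assert (Q := acos_bound x).
destruct (Rle_dec 0 y) as [Hy|Hy].
- exists (acos x); split; [generalize PI_RGT_0; lra|].
  unfold cis; rewrite cos_acos, sin_acos by auto; f_equal.
  replace (1 - Rsqr x) with (Rsqr y) by (unfold Rsqr; lra); now apply sqrt_Rsqr.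
- exists (- acos x); split; [generalize PI_RGT_0; lra|].
  unfold cis; rewrite cos_neg, sin_neg, cos_acos, sin_acos by auto; f_equal.
  replace (1 - Rsqr x) with (Rsqr (- y)) by (unfold Rsqr; lra); rewrite sqrt_Rsqr by lra; ring.
Qed.

(** The bound on the imaginary part confines the chosen logarithms to one strip, the only place
    where growth is estimated later. *)
Lemma cexp_surj (z : C) : z <> RtoC 0 -> exists w, cexp w = z /\ - PI <= Im w <= PI.
Proof.
intros Hz; assert (m := proj1 (Cmod_gt_0 z) Hz).
destruct (polar_form (Re z / Cmod z) (Im z / Cmod z)) as [t [Ht E]].
- generalize (Cmod2_alt z); intros E.
  replace (Re z / Cmod z * (Re z / Cmod z) + Im z / Cmod z * (Im z / Cmod z)) with
   ((Re z ^ 2 + Im z ^ 2) / (Cmod z ^ 2)) by (field; lra).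
  rewrite <- E; field; lra.
- exists (ln (Cmod z), t); split; [|exact Ht].
  unfold cexp; change (Im (ln (Cmod z), t)) with t; change (Re (ln (Cmod z), t)) with (ln (Cmod z)).
  rewrite E, exp_ln by auto; apply injective_projections; simpl; unfold Re, Im; field; lra.
Qed.

Lemma cis_eq_1 (t : R) : cis t = RtoC 1 -> exists k : Z, t = 2 * PI * IZR k.
Proof.
unfold cis, RtoC; intros E; injection E; intros E1 E2.
assert (S : sin (t / 2) = 0).
{ assert (X : cos t = 1 - 2 * sin (t / 2) * sin (t / 2)).
  { replace t with (2 * (t / 2)) at 1 by field; apply cos_2a_sin. }
  nra. }
destruct (sin_eq_0_0 _ S) as [k Hk]; exists k; lra.
Qed.

Lemma cexp_inj (u w : C) : cexp u = cexp w ->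
  exists k : Z, u = (w + RtoC (2 * PI * IZR k) * Ci)%C.
Proof.
intros E.
assert (R : Re u = Re w) by (apply exp_inv; rewrite <- !Cmod_cexp; now f_equal).
assert (E1 : cexp (u - w) = RtoC 1).
{ unfold Cminus; rewrite cexp_plus, E, <- cexp_plus.
  replace (w + - w)%C with (RtoC 0) by ring; apply cexp_0. }
destruct (cis_eq_1 (Im u - Im w)) as [k Hk].
{ rewrite <- E1; unfold cexp, Cminus; rewrite re_plus, im_plus, re_opp, im_opp, R.
  replace (Re w + - Re w) with 0 by ring; rewrite exp_0.
  replace (Im u + - Im w) with (Im u - Im w) by ring; ring. }
exists k; apply injective_projections; simpl.
- unfold Re in R; rewrite R; ring.
- unfold Im in Hk; lra.
Qed.

Lemma cexp_period (w : C) (k : Z) : cexp (w + RtoC (2 * PI * IZR k) * Ci)%C = cexp w.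
Proof.
assert (E : cis (2 * PI * IZR k) = RtoC 1).
{ assert (X : sin (PI * IZR k) = 0) by (apply sin_eq_0_1; exists k; ring).
  unfold cis, RtoC; replace (2 * PI * IZR k) with (2 * (PI * IZR k)) by ring.
  rewrite cos_2a_sin, sin_2a, X; f_equal; ring. }
rewrite cexp_plus; transitivity (cexp w * RtoC 1)%C; [|ring]; f_equal.
unfold cexp; replace (Re (RtoC (2 * PI * IZR k) * Ci)%C) with 0 by (simpl; ring).
replace (Im (RtoC (2 * PI * IZR k) * Ci)%C) with (2 * PI * IZR k) by (simpl; ring).
rewrite exp_0, E; ring.
Qed.

(** A primitive of 1/z on a square about z0, small enough to avoid 0 and normalised at z0. The
    function exp(-l(z)) z has zero derivative, so it is constantly 1. *)
Lemma local_log (z0 w0 : C) : cexp w0 = z0 -> exists l, l z0 = w0 /\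
  near z0 (fun z => cexp (l z) = z /\ wd l z (/ z) 0).
Proof.
intros E0; assert (Z0 : z0 <> RtoC 0) by (rewrite <- E0; apply cexp_neq0).
assert (m := proj1 (Cmod_gt_0 z0) Z0); set (e := Cmod z0 / 4).
assert (N : forall z, square z0 e z -> z <> RtoC 0).
{ intros z [S1 S2] ->; assert (B := Cmod_le_abs_sum (z0 - 0)%C).
  unfold Re, Im, Cminus, Cplus, Copp in B, S1, S2; simpl in B, S1, S2.
  replace (fst z0 + - 0, snd z0 + - 0) with z0 in B.
  - rewrite Ropp_0, !Rplus_0_r in B; rewrite Rminus_0_l, Rabs_Ropp in S1, S2; unfold e in *; lra.
  - destruct z0; simpl; f_equal; ring. }
destruct (holomorphic_primitive Cinv z0 z0 e) as [G HG].
- intros z Hz; eapply wd_ccont, wd_Cinv; auto.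
- intros z Hz _; eexists; apply wd_Cinv; auto.
- set (l := fun z => (G z + (w0 - G z0))%C).
  assert (Dl : forall z, square z0 e z -> wd l z (/ z) 0).
  { intros z Hz; eapply wd_eq; [apply wd_plus; [apply (HG z Hz)|apply wd_const]| |]; ring. }
  exists l; split; [unfold l; ring|].
  assert (S0 : square z0 e z0) by (split; rewrite Rminus_diag, Rabs_R0; unfold e; lra).
  generalize (square_near _ _ _ S0); apply near_imp; intros z Hz; split; auto.
  assert (D : forall z, square z0 e z -> wd (fun z => cexp (- l z) * z)%C z 0 0).
  { intros u Hu; eapply wd_eq.
    - apply (wd_mult (fun z => cexp (- l z))%C (fun z => z)); [|apply wd_id].
      apply (wd_comp cexp (fun z => - l z)%C); [apply wd_cexp|apply wd_opp, Dl, Hu].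
    - cbn beta; rewrite Copp_conj, Cconj_RtoC; field; auto.
    - cbn beta; ring. }
  assert (K : (cexp (- l z0) * z0)%C = (cexp (- l z) * z)%C).
  { assert (X := rder_zero_const (fun s => (fun z => cexp (- l z) * z)%C (z0 + RtoC s * (z - z0))%C) 0 1).
    cbn beta in X.
    replace (z0 + RtoC 0 * (z - z0))%C with z0 in X by ring.
    replace (z0 + RtoC 1 * (z - z0))%C with z in X by ring.
    apply X; rewrite Rmin_left, Rmax_right by lra; intros t Ht.
    eapply rder_eq; [apply (wd_rder (fun z => cexp (- l z) * z)%C (fun s => z0 + RtoC s * (z - z0))%C);
      [apply D|apply rder_affine]|ring].
    destruct Hz as [Z1 Z2].
    replace (z0 + RtoC t * (z - z0))%C with ((fst z0 + t * (fst z - fst z0), snd z0 + t * (snd z - snd z0)) : C)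
     by (apply injective_projections; simpl; ring).
    unfold square, Re, Im in *; simpl.
    replace (fst z0 + t * (fst z - fst z0) - fst z0) with (t * (fst z - fst z0)) by ring.
    replace (snd z0 + t * (snd z - snd z0) - snd z0) with (t * (snd z - snd z0)) by ring.
    rewrite !Rabs_mult, (Rabs_right t) by lra.
    generalize (Rabs_pos (fst z - fst z0)) (Rabs_pos (snd z - snd z0)); nra. }
  assert (l0 : l z0 = w0) by (unfold l; ring).
  rewrite l0, <- E0, <- cexp_plus in K.
  replace (- w0 + w0)%C with (RtoC 0) in K by ring; rewrite cexp_0 in K.
  transitivity (cexp (l z) * (cexp (- l z) * z))%C; [rewrite <- K; ring|].
  rewrite Cmult_assoc, <- cexp_plus; replace (l z + - l z)%C with (RtoC 0) by ring.
  rewrite cexp_0; ring.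
Qed.

(** * Parallel frames over the logarithm of the punctured disk *)

Lemma functional_choice {A B : Type} (R : A -> B -> Prop) :
  (forall x, exists y, R x y) -> exists f, forall x, R x (f x).
Proof.
intros H; exists (fun x => proj1_sig (constructive_indefinite_description _ (H x))).
intros x; exact (proj2_sig (constructive_indefinite_description _ (H x))).
Qed.

Lemma near_ccont (f : C -> C) (w : C) (P : C -> Prop) :
  ccont f w -> near (f w) P -> near w (fun u => P (f u)).
Proof.
intros Hf [d [d0 H]]; generalize (Hf d d0); apply near_imp; auto.
Qed.

Lemma near_cexp (w : C) (P : C -> Prop) : near (cexp w) P -> near w (fun u => P (cexp u)).
Proof. apply near_ccont; eapply wd_ccont, wd_cexp. Qed.

Lemma near_square (w : C) (P : C -> Prop) : near w P ->
  exists e, 0 < e /\ forall u, square w e u -> P u.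
Proof.
intros [d [d0 H]]; exists (d / 2); split; [lra|]; intros u [U1 U2]; apply H.
eapply Rle_lt_trans; [apply Cmod_le_abs_sum|].
unfold Re, Im, Cminus, Cplus, Copp in *; simpl; unfold Rminus in *; lra.
Qed.

(** A section along the covering w |-> exp w is a function [E] of which only
    the values [E w (cexp w)] matter. *)
Definition csection (L : line_bundle punctured_disk) : Type := C -> forall z, fibre L z.

Definition cnorm {L : line_bundle punctured_disk} (h : hermitian_metric L)
    (E : csection L) (w : C) : R := hsq h (cexp w) (E w (cexp w)).

(** [E] is a local frame, parallel for the holomorphic connection
    (Chern connection) + v dw; equivalently d log |E|^2 / dw = - v. *)
Definition parallel_at {L : line_bundle punctured_disk} (h : hermitian_metric L)
    (v : C -> C) (E : csection L) (i : chart L) (c : C -> C) (w : C) : Prop :=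
  chart_dom L i (cexp w) /\ c w <> RtoC 0 /\ (exists D, wd c w D 0) /\
  E w (cexp w) = c w ** frame L i (cexp w) /\
  exists B, wd (fun w => RtoC (cnorm h E w)) w (- v (cexp w) * RtoC (cnorm h E w)) B.

(** Chart and coefficient function are fixed on a whole neighbourhood of each point, so that they
    can be differentiated. *)
Definition parallel_on {L : line_bundle punctured_disk} (h : hermitian_metric L)
    (v : C -> C) (E : csection L) (U : C -> Prop) : Prop :=
  forall w, U w -> exists i c, near w (parallel_at h v E i c).

Lemma parallel_ext (L : line_bundle punctured_disk) (h : hermitian_metric L) (v : C -> C)
    (E E' : csection L) (i : chart L) (c : C -> C) (w : C) :
  near w (fun u => E u (cexp u) = E' u (cexp u)) ->
  near w (parallel_at h v E i c) -> near w (parallel_at h v E' i c).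
Proof.
intros HE H; generalize (near_and _ _ _ (near_near _ _ HE) H); apply near_imp.
intros u [Hu [P1 [P2 [P3 [P4 [B P5]]]]]].
assert (Eu := near_self _ _ Hu); simpl in Eu.
repeat split; auto; [now rewrite <- Eu|].
exists B; eapply wd_eq.
- eapply wd_ext; [|exact P5]; revert Hu; apply near_imp; intros x Hx; unfold cnorm; now rewrite Hx.
- unfold cnorm; now rewrite Eu.
- reflexivity.
Qed.

Lemma chart_punctured (L : line_bundle punctured_disk) (i : chart L) (z : C) :
  chart_dom L i z -> punctured_disk z.
Proof. apply (chart_open _ L i). Qed.

Lemma parallel_scal (L : line_bundle punctured_disk) (h : hermitian_metric L) (v : C -> C)
    (E : csection L) (i : chart L) (c : C -> C) (l : C) (w : C) : l <> RtoC 0 ->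
  near w (parallel_at h v E i c) ->
  near w (parallel_at h v (fun u z => l ** E u z) i (fun u => l * c u)%C).
Proof.
intros Hl H; generalize (near_near _ _ H); apply near_imp; intros u Hu.
destruct (near_self _ _ Hu) as [P1 [P2 [[D P3] [P4 [B P5]]]]].
assert (N : near u (fun x => (RtoC (Cmod l ^ 2) * RtoC (cnorm h E x))%C =
  RtoC (cnorm h (fun u z => l ** E u z) x))).
{ revert Hu; apply near_imp; intros x [X1 _]; unfold cnorm.
  rewrite hsq_scal by (eapply chart_punctured, X1); now rewrite RtoC_mult. }
split; [exact P1|split; [now apply Cmult_neq_0|split; [|split]]].
- eexists; eapply wd_eq; [apply wd_scal, P3|reflexivity|ring].
- rewrite P4; apply scal_scal.
- eexists; eapply wd_eq.
  + eapply wd_ext; [exact N|apply wd_scal, P5].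
  + rewrite <- (near_self _ _ N); ring.
  + reflexivity.
Qed.

Lemma parallel_chart (L : line_bundle punctured_disk) (h : hermitian_metric L) (v : C -> C)
    (E : csection L) (i j : chart L) (c : C -> C) (w : C) :
  near w (parallel_at h v E i c) -> chart_dom L j (cexp w) ->
  exists c', near w (parallel_at h v E j c').
Proof.
intros H Hj; destruct (transition_holomorphic _ L j i) as [g [Hg G]].
exists (fun u => c u * g (cexp u))%C.
generalize (near_and _ _ _ H (near_cexp w _ (chart_dom_near L j _ Hj))); apply near_imp.
intros u [[P1 [P2 [[D P3] [P4 [B P5]]]]] Q].
assert (Gu := G (cexp u) Q P1).
assert (G0 : g (cexp u) <> RtoC 0).
{ intros Z; apply (frame_neq0 L i (cexp u) P1); rewrite Gu, Z; apply scal_0. }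
split; [exact Q|split; [now apply Cmult_neq_0|split; [|split]]].
- destruct (proj1 (holomorphic_wd _ _) Hg (cexp u) (conj Q P1)) as [d Hd].
  eexists; eapply wd_eq.
  + apply wd_mult; [exact P3|apply (wd_comp g cexp); [exact Hd|apply wd_cexp]].
  + reflexivity.
  + ring.
- rewrite P4, Gu; apply scal_scal.
- exists B; exact P5.
Qed.

Definition convex (U : C -> Prop) : Prop :=
  forall u w t, U u -> U w -> 0 <= t <= 1 -> U (u + RtoC t * (w - u))%C.

Lemma cnorm_pos (L : line_bundle punctured_disk) (h : hermitian_metric L) (v : C -> C)
    (E : csection L) (i : chart L) (c : C -> C) (w : C) :
  parallel_at h v E i c w -> 0 < cnorm h E w.
Proof.
intros [P1 [P2 [_ [P4 _]]]]; unfold cnorm; rewrite P4.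
rewrite hsq_scal by (eapply chart_punctured, P1).
apply Rmult_lt_0_compat; [apply pow_lt, Cmod_gt_0, P2|].
apply hsq_pos; [eapply chart_punctured, P1|now apply frame_neq0].
Qed.

(** The ratio of two parallel frames is holomorphic of constant modulus. *)
Lemma parallel_unique (L : line_bundle punctured_disk) (h : hermitian_metric L) (v : C -> C)
    (E1 E2 : csection L) (U : C -> Prop) : open U -> convex U -> (exists w, U w) ->
  parallel_on h v E1 U -> parallel_on h v E2 U ->
  exists l, l <> RtoC 0 /\ forall w, U w -> E2 w (cexp w) = l ** E1 w (cexp w).
Proof.
intros HU CU [w0 U0] G1 G2.
assert (R : forall w, U w -> exists i c1 c2, near w (fun u => U u /\
   parallel_at h v E1 i c1 u /\ parallel_at h v E2 i c2 u)).
{ intros w Hw; destruct (G1 w Hw) as [i [c1 H1]]; destruct (G2 w Hw) as [j [c2 H2]].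
  destruct (parallel_chart L h v E2 j i c2 w H2) as [c2' H2'].
  { apply (near_self _ _ H1). }
  exists i, c1, c2'; apply near_and; [now apply (proj1 (open_near U))|now apply near_and]. }
assert (Q : exists q : C -> C, forall w, U w -> q w <> RtoC 0 /\ E2 w (cexp w) = q w ** E1 w (cexp w)).
{ apply (functional_choice (fun w q => U w -> q <> RtoC 0 /\ E2 w (cexp w) = q ** E1 w (cexp w))).
  intros w; destruct (classic (U w)) as [Hw|Hw].
  2:{ exists (RtoC 0); tauto. }
  destruct (R w Hw) as [i [c1 [c2 H]]].
  destruct (near_self _ _ H) as [_ [[_ [P2 [_ [P4 _]]]] [_ [Q2 [_ [Q4 _]]]]]].
  exists (c2 w * / c1 w)%C; intros _; split.
  - apply Cmult_neq_0; auto; intros Z; apply C1_nz.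
    rewrite <- (Cinv_r (c1 w)), Z by auto; ring.
  - rewrite P4, Q4, scal_scal; f_equal; field; auto. }
destruct Q as [q Hq].
assert (Dq : forall w, U w -> wd q w 0 0).
{ intros w Hw; destruct (R w Hw) as [i [c1 [c2 H]]].
  destruct (near_self _ _ H) as [_ [[P1 [P2 [[D1 P3] [P4 [B1 P5]]]]] [Q1 [Q2 [[D2 Q3] [Q4 [B2 Q5]]]]]]].
  assert (X : near w (fun u => (c2 u * / c1 u)%C = q u)).
  { revert H; apply near_imp; intros u [Hu [[S1 [S2 [_ [S4 _]]]] [_ [_ [_ [T4 _]]]]]].
    assert (Z : (q u * c1 u)%C = c2 u).
    { apply (frame_scal_inj L i (cexp u)); auto.
      rewrite <- scal_scal, <- S4, <- T4; symmetry; apply (Hq u Hu). }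
    rewrite <- Z; field; auto. }
  assert (Dw : exists D, wd q w D 0).
  { eexists; eapply wd_ext; [exact X|]; eapply wd_eq; [apply wd_mult; [exact Q3|apply wd_inv; [exact P2|exact P3]]|reflexivity|].
    field; auto. }
  destruct Dw as [D HD].
  assert (Y : near w (fun u => (q u * Cconj (q u) * RtoC (cnorm h E1 u))%C = RtoC (cnorm h E2 u))).
  { revert H; apply near_imp; intros u [Hu [[S1 _] _]].
    unfold cnorm; rewrite (proj2 (Hq u Hu)), hsq_scal by (eapply chart_punctured, S1).
    rewrite RtoC_mult, Cmod2_conj; reflexivity. }
  (* Both norms satisfy the same equation with - v. Comparing the z-derivatives of |E2|^2 = |q|^2
     |E1|^2 cancels the terms in v and leaves q' conj(q) |E1|^2 = 0. *)
  assert (W : wd (fun u => RtoC (cnorm h E2 u)) w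
    (D * Cconj (q w) * RtoC (cnorm h E1 w) + q w * Cconj (q w) * (- v (cexp w) * RtoC (cnorm h E1 w)))
    (q w * Cconj D * RtoC (cnorm h E1 w) + q w * Cconj (q w) * B1)).
  { eapply wd_ext; [exact Y|]; eapply wd_eq.
    - apply wd_mult; [|exact P5]; apply wd_mult; [exact HD|].
      apply (wd_comp Cconj q); [apply wd_conj|exact HD].
    - cbn beta; rewrite Cconj_RtoC; ring.
    - cbn beta; ring. }
  destruct (wd_unique _ _ _ _ _ _ W Q5) as [Z _].
  rewrite <- (near_self _ _ Y) in Z.
  assert (Z2 : (D * (Cconj (q w) * RtoC (cnorm h E1 w)))%C = RtoC 0).
  { transitivity ((D * Cconj (q w) * RtoC (cnorm h E1 w) +
      q w * Cconj (q w) * (- v (cexp w) * RtoC (cnorm h E1 w))) -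
      (- v (cexp w) * (q w * Cconj (q w) * RtoC (cnorm h E1 w))))%C; [ring|rewrite Z; ring]. }
  assert (N1 : RtoC (cnorm h E1 w) <> RtoC 0).
  { apply RtoC_neq0; apply Rgt_not_eq, (cnorm_pos L h v E1 i c1); now apply near_self, near_imp with (2 := H). }
  assert (Nq : Cconj (q w) <> RtoC 0).
  { apply Cmod_gt_0; rewrite Cmod_conj; apply Cmod_gt_0, Hq, Hw. }
  assert (D0 : D = RtoC 0).
  { transitivity (D * (Cconj (q w) * RtoC (cnorm h E1 w)) * / (Cconj (q w) * RtoC (cnorm h E1 w)))%C.
    - field; auto.
    - rewrite Z2; ring. }
  now rewrite D0 in HD. }
exists (q w0); split; [apply Hq, U0|]; intros w Hw.
replace (q w0) with (q w); [apply Hq, Hw|].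
assert (X := rder_zero_const (fun s => q (w0 + RtoC s * (w - w0))%C) 0 1); cbn beta in X.
replace (w0 + RtoC 0 * (w - w0))%C with w0 in X by ring.
replace (w0 + RtoC 1 * (w - w0))%C with w in X by ring.
symmetry; apply X; rewrite Rmin_left, Rmax_right by lra; intros t Ht.
eapply rder_eq; [apply (wd_rder q (fun s => w0 + RtoC s * (w - w0))%C); [apply Dq, CU; auto|apply rder_affine]|ring].
Qed.

(** On the convex overlap the two frames differ by one constant, and the second is divided by it. *)
Lemma parallel_glue (L : line_bundle punctured_disk) (h : hermitian_metric L) (v : C -> C)
    (E1 E2 : csection L) (U V : C -> Prop) : open U -> open V ->
  convex (meet U V) -> (exists w, U w /\ V w) ->
  parallel_on h v E1 U -> parallel_on h v E2 V ->
  exists E, parallel_on h v E (fun w => U w \/ V w).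
Proof.
intros HU HV CUV NE G1 G2.
destruct (parallel_unique L h v E1 E2 (meet U V)) as [l [l0 Hl]]; auto.
- apply open_near; intros w [Hu Hv]; apply near_and; now apply open_near.
- intros w [Hw _]; auto.
- intros w [_ Hw]; auto.
- assert (l1 : (/ l)%C <> RtoC 0).
  { intros Z; apply C1_nz; rewrite <- (Cinv_r l), Z by auto; ring. }
  exists (fun w z => match excluded_middle_informative (U w) with
    | left _ => E1 w z | right _ => (/ l)%C ** E2 w z end).
  intros w [Hw|Hw].
  + destruct (G1 w Hw) as [i [c H]]; exists i, c; revert H; apply parallel_ext.
    generalize (proj1 (open_near U) HU w Hw); apply near_imp; intros u Hu.
    destruct excluded_middle_informative; tauto.
  + destruct (G2 w Hw) as [i [c H]]; exists i, (fun u => / l * c u)%C.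
    assert (H' := parallel_scal L h v E2 i c _ w l1 H); revert H'; apply parallel_ext.
    generalize (proj1 (open_near V) HV w Hw); apply near_imp; intros u Hu.
    destruct excluded_middle_informative as [Uu|Uu]; auto.
    rewrite (Hl u (conj Uu Hu)), scal_scal, Cinv_l by auto; apply scal_1.
Qed.

(** Since (z theta_i + v)(exp w) is a uniform limit of holomorphic functions,
    it has vanishing rectangle integrals and hence a primitive. *)
Lemma parallel_local (L : line_bundle punctured_disk) (h : hermitian_metric L)
    (F : C -> R) (v : C -> C) (S : nat -> C -> C) (K : R) (i : chart L) (th : C -> C) (w0 : C) :
  (forall z, chart_dom L i z -> exists A, wd th z A (- RtoC (F z))) ->
  (forall z, chart_dom L i z -> exists B,
     wd (fun z => RtoC (frame_weight h i z)) z (th z * RtoC (frame_weight h i z)) B) ->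
  0 < K -> (forall n z, Cmod (S n z - v z) <= K / (INR n + 1)) ->
  (forall n z, Cmod z < / 4 -> / 2 ^ (n + 1) < Cmod z -> exists A, wd (S n) z A (z * RtoC (F z))) ->
  (forall n z, ccont (S n) z) ->
  Cmod (cexp w0) < / 4 -> chart_dom L i (cexp w0) ->
  exists e E, 0 < e /\ parallel_on h v E (square w0 e).
Proof.
intros Dth DH K0 Sv DS Sc H4 Hi.
set (m := Cmod (cexp w0)) in *.
assert (m0 : 0 < m) by (apply Cmod_gt_0, cexp_neq0).
(* This yields 2^-(n+1) < |exp w0|, so that near exp w0 all [S k] with k >= n solve the d-bar
   equation. *)
destruct (pow_half_lt 1 m) as [n Hn]; [lra|exact m0|].
assert (p2 : forall n, 0 < 2 ^ n) by (intros; apply pow_lt; lra).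
assert (Hn' : / 2 ^ (n + 1) < m).
{ eapply Rle_lt_trans; [|exact Hn]; rewrite Rmult_1_l, pow_inv.
  apply Rinv_le_contravar; auto; apply Rle_pow; lra || lia. }
destruct (near_square w0 (fun w => chart_dom L i (cexp w) /\
   (Cmod (cexp w) < / 4 /\ / 2 ^ (n + 1) < Cmod (cexp w)))) as [e [e0 N]].
{ apply (near_cexp w0 (fun z => chart_dom L i z /\ (Cmod z < / 4 /\ / 2 ^ (n + 1) < Cmod z))).
  apply near_and; [now apply chart_dom_near|apply near_and].
  - exists (/ 4 - m); split; [lra|]; intros u Hu; generalize (Cmod_triangle_inv u (cexp w0)); fold m; lra.
  - exists (m - / 2 ^ (n + 1)); split; [lra|]; intros u Hu.
    generalize (Cmod_triangle_inv (cexp w0) u); rewrite Cmod_minus_sym; fold m; lra. }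
(* Holomorphic for k >= n: the conj-z derivative of z theta is - z F, which that of [S k]
   cancels. *)
set (gm := fun k w => (cexp w * th (cexp w) + S k (cexp w))%C).
set (g := fun w => (cexp w * th (cexp w) + v (cexp w))%C).
assert (Dgm : forall k w, (n <= k)%nat -> square w0 e w -> exists D, wd (gm k) w D 0).
{ intros k w Hk Hw; destruct (N w Hw) as [N1 [N2 N3]].
  destruct (Dth _ N1) as [A HA].
  destruct (DS k (cexp w) N2) as [A' HA'].
  { eapply Rle_lt_trans; [|exact N3]; apply Rinv_le_contravar; auto; apply Rle_pow; lra || lia. }
  eexists; eapply wd_eq.
  - apply (wd_comp (fun z => z * th z + S k z)%C cexp); [|apply wd_cexp].
    apply wd_plus; [apply (wd_mult (fun z => z) th); [apply wd_id|exact HA]|exact HA'].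
  - reflexivity.
  - cbn beta; ring. }
assert (vc : forall z, ccont v z).
{ intros z eps p.
  destruct (archimed_cor1 (eps / (4 * K))) as [k [N1 N2]]; [apply Rdiv_lt_0_compat; lra|].
  assert (k0 : 0 < INR k) by now apply lt_0_INR.
  assert (N3 : K / (INR k + 1) < eps / 4).
  { apply Rle_lt_trans with (K * / INR k).
    - apply Rmult_le_compat_l; [lra|]; apply Rinv_le_contravar; lra.
    - apply Rmult_lt_compat_l with (r := K) in N1; [|lra].
      replace (K * (eps / (4 * K))) with (eps / 4) in N1 by (field; lra); lra. }
  generalize (Sc k z (eps / 4) ltac:(lra)); apply near_imp; intros w Hw.
  replace (v w - v z)%C with ((S k w - S k z) - (S k w - v w) + (S k z - v z))%C by ring.
  eapply Rle_lt_trans; [apply Cmod_triangle|].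
  eapply Rle_lt_trans; [apply Rplus_le_compat_r, Cmod_triangle_minus|].
  generalize (Sv k w) (Sv k z); lra. }
assert (gc : forall w, square w0 e w -> ccont g w).
{ intros w Hw; destruct (Dth _ (proj1 (N w Hw))) as [A HA].
  assert (ce : ccont cexp w) by (eapply wd_ccont, wd_cexp).
  apply ccont_plus; [apply ccont_mult; auto; apply (ccont_comp th)|apply (ccont_comp v)]; auto.
  eapply wd_ccont, HA. }
destruct (primitive_on_square g w0 e gc) as [G HG].
{ intros a b c d ab cd S1 S2.
  assert (Sq : forall z, in_rect a b c d z -> square w0 e z)
   by (intros z Hz; exact (square_rect w0 e a b c d z S1 S2 Hz)).
  (* By Goursat the integral of [g] equals that of g - gm k, whose sup norm is at most K/(k + 1);
     letting k grow makes it vanish. *)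
  assert (B : forall k, (n <= k)%nat -> Cmod (rect_int g a b c d) <= 4 * (K / (INR k + 1)) * ((b - a) + (d - c))).
  { intros k Hk.
    assert (gk : forall z, in_rect a b c d z -> ccont (gm k) z).
    { intros z Hz; destruct (Dgm k z Hk (Sq z Hz)) as [D HD]; eapply wd_ccont, HD. }
    assert (R0 : rect_int (gm k) a b c d = RtoC 0) by (apply goursat; auto).
    replace (rect_int g a b c d) with (rect_int (fun z => g z - gm k z)%C a b c d).
    - apply rect_int_bound; auto.
      + intros z Hz; apply ccont_minus; auto.
      + intros z _; unfold g, gm; rewrite Cmod_minus_sym; eapply Rle_trans; [|apply (Sv k (cexp z))].
        right; f_equal; ring.
    - rewrite rect_int_minus, R0 by auto; ring. }
  apply Cmod_eq_0, Rle_antisym; [|apply Cmod_ge_0]; apply Rnot_lt_le; intros P.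
  set (r := Cmod (rect_int g a b c d)) in *.
  set (T := 4 * K * ((b - a) + (d - c)) + 1).
  assert (T0 : 0 < T).
  { unfold T; assert (0 <= K * ((b - a) + (d - c))) by (apply Rmult_le_pos; lra); lra. }
  destruct (archimed_cor1 (r / T)) as [k [N1 N2]]; [now apply Rdiv_lt_0_compat|].
  specialize (B (k + n)%nat ltac:(lia)).
  assert (k0 : 0 < INR k) by now apply lt_0_INR.
  assert (k1 : INR k <= INR (k + n) + 1) by (rewrite plus_INR; generalize (pos_INR n); lra).
  assert (B2 : r <= (T - 1) * / INR k).
  { eapply Rle_trans; [exact B|].
    replace (4 * (K / (INR (k + n) + 1)) * (b - a + (d - c))) with ((T - 1) * / (INR (k + n) + 1))
     by (unfold T; field; lra).
    apply Rmult_le_compat_l; [unfold T|now apply Rinv_le_contravar].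
    assert (0 <= K * ((b - a) + (d - c))) by (apply Rmult_le_pos; lra); lra. }
  apply Rmult_lt_compat_l with (r := T) in N1; auto.
  replace (T * (r / T)) with r in N1 by (field; lra).
  assert (0 < / INR k) by now apply Rinv_0_lt_compat. lra. }
(* [G] is a primitive of z theta + v in the variable w, and the log of the weight has w-derivative z
   theta. Hence d log |E|^2 / dw = - (z theta + v) + z theta = - v. *)
exists e, (fun w z => cexp (- G w) ** frame L i z); split; auto.
intros w Hw; exists i, (fun w => cexp (- G w)).
generalize (square_near _ _ _ Hw); apply near_imp; clear w Hw; intros w Hw.
destruct (N w Hw) as [N1 [N2 N3]].
assert (Dc : wd (fun w => cexp (- G w)) w (- g w * cexp (- G w)) 0).
{ eapply wd_eq; [apply (wd_comp cexp (fun w => - G w)%C); [apply wd_cexp|apply wd_opp, (HG w Hw)]| |].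
  - rewrite Copp_conj, Cconj_RtoC; ring.
  - ring. }
split; [exact N1|split; [apply cexp_neq0|split; [|split]]].
- eexists; exact Dc.
- reflexivity.
- destruct (DH _ N1) as [B HB].
  assert (X : near w (fun u => (cexp (- G u) * Cconj (cexp (- G u)) * RtoC (frame_weight h i (cexp u)))%C =
     RtoC (cnorm h (fun w z => cexp (- G w) ** frame L i z) u))).
  { generalize (square_near _ _ _ Hw); apply near_imp; intros u Hu; unfold cnorm.
    rewrite hsq_scal by (eapply chart_punctured, (N u Hu)).
    rewrite RtoC_mult, Cmod2_conj; reflexivity. }
  eexists; eapply wd_eq.
  + eapply wd_ext; [exact X|].
    apply wd_mult; [apply wd_mult; [exact Dc|]|].
    * apply (wd_comp Cconj (fun u => cexp (- G u))); [apply wd_conj|exact Dc].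
    * apply (wd_comp (fun z => RtoC (frame_weight h i z)) cexp); [exact HB|apply wd_cexp].
  + cbn beta; rewrite <- (near_self _ _ X), !Cconj_RtoC; unfold g; ring.
  + reflexivity.
Qed.

(** * Continuation over a half-plane *)

Definition orect (a b c d : R) (w : C) : Prop := a < Re w < b /\ c < Im w < d.

Lemma open_orect (a b c d : R) : open (orect a b c d).
Proof.
apply open_near; intros w [[H1 H2] [H3 H4]].
set (m := Rmin (Rmin (Re w - a) (b - Re w)) (Rmin (Im w - c) (d - Im w))).
assert (M1 : m <= Rmin (Re w - a) (b - Re w)) by apply Rmin_l.
assert (M2 : m <= Rmin (Im w - c) (d - Im w)) by apply Rmin_r.
generalize (Rmin_l (Re w - a) (b - Re w)) (Rmin_r (Re w - a) (b - Re w))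
 (Rmin_l (Im w - c) (d - Im w)) (Rmin_r (Im w - c) (d - Im w)); intros.
exists m; split; [repeat apply Rmin_pos; lra|]; intros u Hu.
assert (K1 := Rle_lt_trans _ _ _ (re_le_Cmod _) Hu).
assert (K2 := Rle_lt_trans _ _ _ (Cmod_Im_le _) Hu).
unfold orect, Re, Im, Cminus, Cplus, Copp in *; simpl in *.
revert K1 K2; unfold Rabs; repeat destruct Rcase_abs; lra.
Qed.

Lemma convex_orect (a b c d : R) : convex (orect a b c d).
Proof.
assert (X : forall p q x y t, p < x < q -> p < y < q -> 0 <= t <= 1 -> p < x + t * (y - x) < q).
{ intros p q x y t Hx Hy Ht; split; destruct (Rle_dec t (/ 2)); nra. }
intros u w t [U1 U2] [W1 W2] Ht; unfold orect.
replace (Re (u + RtoC t * (w - u))%C) with (Re u + t * (Re w - Re u)) by (unfold Re; simpl; ring).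
replace (Im (u + RtoC t * (w - u))%C) with (Im u + t * (Im w - Im u)) by (unfold Im; simpl; ring).
split; auto.
Qed.

Lemma meet_orect (a b c d a' b' c' d' : R) : convex (meet (orect a b c d) (orect a' b' c' d')).
Proof.
intros u w t [U1 U2] [W1 W2] Ht; split; apply convex_orect; auto.
Qed.

Lemma parallel_sub (L : line_bundle punctured_disk) (h : hermitian_metric L) (v : C -> C)
    (E : csection L) (U V : C -> Prop) : (forall w, V w -> U w) ->
  parallel_on h v E U -> parallel_on h v E V.
Proof. intros S H w Hw; auto. Qed.

(** Local frames are joined by rectangle induction: two in the bottom row, two in the top row, then
    the rows. All overlaps are rectangles, hence convex. *)
Lemma parallel_rect (L : line_bundle punctured_disk) (h : hermitian_metric L) (v : C -> C) (s0 : R) :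
  (forall w, Re w < s0 -> exists e E, 0 < e /\ parallel_on h v E (square w e)) ->
  forall a b c d, a < b -> b < s0 -> c < d -> exists E, parallel_on h v E (orect a b c d).
Proof.
intros loc a b c d ab bs cd.
(* Frames are required on an open rectangle slightly larger than the closed one; otherwise adjacent
   quarters would meet only along an edge. *)
assert (P : exists e E, 0 < e /\ parallel_on h v E (orect (a - e) (b + e) (c - e) (d + e))).
{ apply (rect_induction (fun a b c d => exists e E, 0 < e /\
    parallel_on h v E (orect (a - e) (b + e) (c - e) (d + e)))); auto.
  - intros a' b' c' d' A1 A2 A3 A4 A5 A6 m n
     [e1 [E1 [p1 H1]]] [e2 [E2 [p2 H2]]] [e3 [E3 [p3 H3]]] [e4 [E4 [p4 H4]]].
    set (e := Rmin (Rmin e1 e2) (Rmin e3 e4)).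
    generalize (Rmin_l (Rmin e1 e2) (Rmin e3 e4)) (Rmin_r (Rmin e1 e2) (Rmin e3 e4))
     (Rmin_l e1 e2) (Rmin_r e1 e2) (Rmin_l e3 e4) (Rmin_r e3 e4); fold e; intros.
    assert (e0 : 0 < e) by (repeat apply Rmin_pos; auto).
    assert (Hm : a' <= m <= b') by (unfold m; lra).
    assert (Hn : c' <= n <= d') by (unfold n; lra).
    assert (glue : forall F1 F2 a1 b1 c1 d1 a2 b2 c2 d2, a2 < b1 -> a1 < b1 -> a2 < b2 -> a1 < b2 ->
      c2 < d1 -> c1 < d1 -> c2 < d2 -> c1 < d2 ->
      parallel_on h v F1 (orect a1 b1 c1 d1) -> parallel_on h v F2 (orect a2 b2 c2 d2) ->
      exists F, parallel_on h v F (fun w => orect a1 b1 c1 d1 w \/ orect a2 b2 c2 d2 w)).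
    { intros F1 F2 a1 b1 c1 d1 a2 b2 c2 d2 X1 X2 X3 X4 X5 X6 X7 X8 G1 G2.
      apply (parallel_glue L h v F1 F2); auto using open_orect, meet_orect.
      assert (mid : forall p q p' q', p < q -> p' < q' -> p < q' -> p' < q ->
        exists x, p < x < q /\ p' < x < q').
      { intros p q p' q' Y1 Y2 Y3 Y4.
        destruct (Rle_dec p p'), (Rle_dec q q').
        - exists ((p' + q) / 2); lra.
        - exists ((p' + q') / 2); lra.
        - exists ((p + q) / 2); lra.
        - exists ((p + q') / 2); lra. }
      destruct (mid a1 b1 a2 b2) as [x Hx]; auto.
      destruct (mid c1 d1 c2 d2) as [y Hy]; auto.
      exists (x, y); unfold orect; simpl; tauto. }
    destruct (glue E1 E2 (a' - e) (m + e) (c' - e) (n + e) (m - e) (b' + e) (c' - e) (n + e)) as [F1 G1];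
     try lra; try (eapply parallel_sub; [|eassumption]; unfold orect; intros; lra).
    destruct (glue E3 E4 (a' - e) (m + e) (n - e) (d' + e) (m - e) (b' + e) (n - e) (d' + e)) as [F2 G2];
     try lra; try (eapply parallel_sub; [|eassumption]; unfold orect; intros; lra).
    destruct (glue F1 F2 (a' - e) (b' + e) (c' - e) (n + e) (a' - e) (b' + e) (n - e) (d' + e)) as [F G];
     try lra.
    { eapply parallel_sub; [|exact G1]; unfold orect; intros w Hw.
      destruct (Rlt_le_dec (Re w) (m + e)); [left|right]; lra. }
    { eapply parallel_sub; [|exact G2]; unfold orect; intros w Hw.
      destruct (Rlt_le_dec (Re w) (m + e)); [left|right]; lra. }
    exists e, F; split; auto.
    eapply parallel_sub; [|exact G]; unfold orect; intros w Hw.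
    destruct (Rlt_le_dec (Im w) (n + e)); [left|right]; lra.
  - intros x y Hx Hy; destruct (loc (x, y)) as [e [E [e0 H]]]; [unfold Re; simpl; lra|].
    exists (e / 2); split; [lra|]; intros a' b' c' d' A1 A2 A3 A4 A5 A6 S1 S2 _.
    exists (e / 4), E; split; [lra|].
    eapply parallel_sub; [|exact H]; intros w [W1 W2]; unfold square, Re, Im in *; simpl.
    split; unfold Rabs; destruct Rcase_abs; lra. }
destruct P as [e [E [e0 H]]]; exists E; eapply parallel_sub; [|exact H].
unfold orect; intros; lra.
Qed.

Lemma open_Re_lt (s : R) : open (fun w => Re w < s).
Proof.
apply open_near; intros w Hw; exists (s - Re w); split; [lra|]; intros u Hu.
assert (K1 := Rle_lt_trans _ _ _ (re_le_Cmod _) Hu).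
unfold Re, Cminus, Cplus, Copp in *; simpl in *; revert K1; unfold Rabs; destruct Rcase_abs; lra.
Qed.

Lemma parallel_neq0 (L : line_bundle punctured_disk) (h : hermitian_metric L) (v : C -> C)
    (E : csection L) (U : C -> Prop) (w : C) : parallel_on h v E U -> U w ->
  E w (cexp w) <> zero.
Proof.
intros H Hw Z; destruct (H w Hw) as [i [c Hc]].
destruct (near_self _ _ Hc) as [P1 [P2 [_ [P4 _]]]].
apply P2, (frame_scal_inj L i (cexp w)); auto.
rewrite <- P4, Z; symmetry; apply scal_0.
Qed.

Lemma scal_eq_self {V : ModuleSpace C_Ring} (l : C) (u : V) : u <> zero -> l ** u = u -> l = RtoC 1.
Proof.
intros N E; apply NNPP; intros Hl; apply N.
assert (Z : (l - 1)%C ** u = zero).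
{ transitivity (plus (l ** u) (opp u)).
  - rewrite <- (scal_1 u) at 3; rewrite <- (scal_opp_l (RtoC 1 : C_Ring) u).
    exact (scal_distr_r (l : C_Ring) (opp (RtoC 1 : C_Ring)) u).
  - rewrite E; exact (@plus_opp_r (ModuleSpace.AbelianGroup C_Ring V) u). }
rewrite <- (scal_1 u), <- (Cinv_l (l - 1)%C), <- scal_scal, Z by now apply Cminus_eq_contra.
apply (scal_zero_r (_ : C_Ring)).
Qed.

(** The half-plane is exhausted by growing rectangles. Their frames are rescaled to take the same
    value at the base point [w1], which forces them to agree on smaller rectangles, so that any
    rectangle containing a point may define the frame there. The gap between s1 and s0 is required
    by [parallel_rect]. *)
Lemma parallel_halfplane (L : line_bundle punctured_disk) (h : hermitian_metric L) (v : C -> C)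
    (s0 s1 : R) : s1 < s0 ->
  (forall w, Re w < s0 -> exists e E, 0 < e /\ parallel_on h v E (square w e)) ->
  exists E, parallel_on h v E (fun w => Re w < s1).
Proof.
intros s10 loc.
set (I := fun n => orect (s1 - 2 - INR n) s1 (- 1 - INR n) (1 + INR n)).
assert (HI : forall n, open (I n) /\ convex (I n)) by (intros; split; [apply open_orect|apply convex_orect]).
assert (mono : forall n m w, (n <= m)%nat -> I n w -> I m w).
{ intros n m w Hnm; apply le_INR in Hnm; unfold I, orect; lra. }
set (w1 := (s1 - 1, 0) : C).
assert (W1 : forall n, I n w1) by (intros n; generalize (pos_INR n); unfold I, orect, w1; simpl; lra).
destruct (functional_choice (fun n E => parallel_on h v E (I n))) as [En HEn].
{ intros n; apply (parallel_rect L h v s0 loc); generalize (pos_INR n); lra. }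
destruct (functional_choice (fun n l => l <> RtoC 0 /\
  En n w1 (cexp w1) = l ** En O w1 (cexp w1))) as [l Hl].
{ intros n; destruct (parallel_unique L h v (En O) (En n) (I O)) as [l [l0 Hl]]; auto; try apply HI.
  - exists w1; auto.
  - eapply parallel_sub; [|apply HEn]; intros w; apply mono; lia.
  - exists l; split; auto. }
set (E' := fun n (w : C) z => (/ l n)%C ** En n w z).
assert (HE' : forall n, parallel_on h v (E' n) (I n)).
{ intros n w Hw; destruct (HEn n w Hw) as [i [c H]]; exists i, (fun u => / l n * c u)%C.
  apply parallel_scal; auto; intros Z; apply C1_nz.
  rewrite <- (Cinv_r (l n)), Z by apply Hl; ring. }
assert (E1 : forall n, E' n w1 (cexp w1) = En O w1 (cexp w1)).
{ intros n; unfold E'; rewrite (proj2 (Hl n)), scal_scal, Cinv_l by apply Hl; apply scal_1. }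
assert (comp : forall n m w, (n <= m)%nat -> I n w -> E' m w (cexp w) = E' n w (cexp w)).
{ intros n m w Hnm Hw.
  destruct (parallel_unique L h v (E' n) (E' m) (I n)) as [q [q0 Hq]]; auto; try apply HI.
  - exists w1; auto.
  - eapply parallel_sub; [|apply HE']; intros u; now apply mono.
  - assert (Q1 := Hq w1 (W1 n)); rewrite !E1 in Q1.
    assert (q1 : q = RtoC 1).
    { apply (scal_eq_self q (En O w1 (cexp w1))); [|now symmetry].
      apply (parallel_neq0 L h v (En O) (I O)); auto. }
    rewrite (Hq w Hw), q1; apply scal_1. }
destruct (functional_choice (fun w n => Re w < s1 -> I n w)) as [idx Hidx].
{ intros w.
  destruct (INR_unbounded (Rabs (Re w - s1) + Rabs (Im w))) as [n Hn]; exists n; intros Hw.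
  unfold I, orect; revert Hn; unfold Rabs; repeat destruct Rcase_abs; lra. }
exists (fun w z => E' (idx w) w z); intros w Hw.
assert (Iw := Hidx w Hw).
destruct (HE' (idx w) w Iw) as [i [c H]]; exists i, c; revert H; apply parallel_ext.
generalize (proj1 (open_near (I (idx w))) (proj1 (HI _)) w Iw); apply near_imp; intros u Hu.
assert (Iu : I (idx u) u) by (apply Hidx; unfold I, orect in Hu; lra).
destruct (Nat.le_gt_cases (idx w) (idx u)) as [C1|C1].
- symmetry; apply comp; auto.
- apply comp; auto; lia.
Qed.

Lemma parallel_shift (L : line_bundle punctured_disk) (h : hermitian_metric L) (v : C -> C)
    (E : csection L) (i : chart L) (c : C -> C) (w tau : C) :
  (forall w, cexp (w + tau) = cexp w) ->
  near (w + tau)%C (parallel_at h v E i c) ->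
  near w (parallel_at h v (fun w => E (w + tau)%C) i (fun w => c (w + tau)%C)).
Proof.
intros P [d [d0 H]]; exists d; split; auto; intros u Hu.
destruct (H (u + tau)%C) as [P1 [P2 [[D P3] [P4 [B P5]]]]].
{ now replace (u + tau - (w + tau))%C with (u - w)%C by ring. }
assert (X : forall f A B, wd f (u + tau)%C A B -> wd (fun u => f (u + tau)%C) u A B).
{ intros f A' B' HA; eapply wd_eq.
  - apply (wd_comp f (fun u => u + tau)%C); [exact HA|apply wd_plus; [apply wd_id|apply wd_const]].
  - rewrite Cplus_conj, !Cconj_RtoC; ring.
  - rewrite Cplus_conj, !Cconj_RtoC; ring. }
rewrite (P u) in P1, P4.
split; [exact P1|split; [exact P2|split; [exists D; apply (X c), P3|split; [exact P4|]]]].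
exists B; eapply wd_eq.
- eapply wd_ext; [|exact (X _ _ _ P5)]; exists 1; split; [lra|]; intros x _.
  unfold cnorm; now rewrite (P x).
- unfold cnorm; now rewrite (P u).
- reflexivity.
Qed.

(** This identifies the conj-z derivative left existential in [parallel_at], so that the whole
    gradient of the norm is known. *)
Lemma wd_RtoC_conj (f : C -> R) (z A B : C) : wd (fun w => RtoC (f w)) z A B -> B = Cconj A.
Proof.
intros H.
assert (H' : wd (fun w => RtoC (f w)) z (Cconj B) (Cconj A)).
{ apply (wd_ext (fun w => Cconj (RtoC (f w)))).
  - exists 1; split; [lra|]; intros w _; apply Cconj_RtoC.
  - eapply wd_eq; [apply (wd_comp Cconj); [apply wd_conj|exact H]| |]; ring. }
apply (wd_unique _ _ _ _ _ _ H H').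
Qed.

(** Along horizontal lines ln |E|^2 has derivative - 2 Re v(exp w), which tends to - 2 Re v(0) as Re
    w goes to minus infinity. The mean value theorem compares a point with the vertical segment Re w
    = s2, where the values are bounded by compactness. *)
Lemma cnorm_growth (L : line_bundle punctured_disk) (h : hermitian_metric L) (v : C -> C)
    (E : csection L) (s1 eps : R) : parallel_on h v E (fun w => Re w < s1) ->
  ccont v 0 -> 0 < eps ->
  exists A s2, s2 < s1 /\ s2 < 0 /\ forall w, Re w < s2 -> - PI <= Im w <= PI ->
    0 < cnorm h E w /\
    Rabs (ln (cnorm h E w) + 2 * Re (v 0) * Re w) <= eps * Rabs (Re w) + A.
Proof.
intros H Hv e0; generalize PI_RGT_0; intros P.
destruct (Hv (eps / 2) ltac:(lra)) as [d [d0 Hd]].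
(* To the left of s2 one stays in the half-plane and has |exp w| < d, so that v is within eps/2 of
   v(0); - 1 makes Re w negative. *)
set (s2 := Rmin (Rmin (s1 - 1) (ln d - 1)) (- 1)).
assert (S1 : s2 <= Rmin (s1 - 1) (ln d - 1)) by apply Rmin_l.
assert (S2 : s2 <= - 1) by apply Rmin_r.
generalize (Rmin_l (s1 - 1) (ln d - 1)) (Rmin_r (s1 - 1) (ln d - 1)); intros S3 S4.
assert (W : forall w, Re w < s1 -> 0 < cnorm h E w /\
  wd (fun w => RtoC (cnorm h E w)) w (- v (cexp w) * RtoC (cnorm h E w))
   (Cconj (- v (cexp w) * RtoC (cnorm h E w)))).
{ intros w Hw; destruct (H w Hw) as [i [c Hc]]; apply near_self in Hc.
  split; [eapply cnorm_pos, Hc|].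
  destruct Hc as [_ [_ [_ [_ [B HB]]]]]; now rewrite <- (wd_RtoC_conj _ _ _ _ HB). }
assert (Hor : forall x y, x < s1 ->
  is_derive (fun x => ln (cnorm h E (x, y))) x (- 2 * Re (v (cexp (x, y))))).
{ intros x y Hx; destruct (W (x, y)) as [W1 W2]; [exact Hx|].
  assert (R1 := wd_rder _ (fun x => (x, y)) x _ _ _ W2 (rder_pair_l y x)).
  apply rder_iff in R1; destruct R1 as [R1 _].
  evar (q : R); replace (- 2 * Re (v (cexp (x, y)))) with q.
  - apply (is_derive_comp ln (fun x => cnorm h E (x, y))); [apply is_derive_ln, W1|exact R1].
  - unfold q, scal; simpl; unfold mult; simpl; unfold Re; field; lra. }
assert (Ver : forall y, exists q, is_derive (fun y => ln (cnorm h E (s2, y))) y q).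
{ intros y; destruct (W (s2, y)) as [W1 W2]; [simpl; lra|].
  assert (R1 := wd_rder _ (fun y => (s2, y)) y _ _ _ W2 (rder_pair_r s2 y)).
  apply rder_iff in R1; destruct R1 as [R1 _]; eexists.
  apply (is_derive_comp ln (fun y => cnorm h E (s2, y))); [apply is_derive_ln, W1|exact R1]. }
destruct (rcont_bounded (fun y => RtoC (ln (cnorm h E (s2, y)))) (- PI) PI) as [A HA]; [lra| |].
{ intros y; apply rcont_iff; split.
  - destruct (Ver y) as [q Hq]; apply @ex_derive_continuous; exists q; exact Hq.
  - apply continuous_const. }
exists (A + 2 * Rabs (Re (v 0)) * Rabs s2), s2; split; [lra|split; [lra|]].
intros [x y] Hx Hy; unfold Re, Im in Hx, Hy; simpl in Hx, Hy.
split; [apply W; simpl; lra|].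
change (Re (x, y)) with x.
destruct (MVT_gen (fun x => ln (cnorm h E (x, y))) x s2 (fun x => - 2 * Re (v (cexp (x, y))))) as [t [Ht Et]].
{ intros t Ht; rewrite Rmin_left, Rmax_right in Ht by lra; apply Hor; lra. }
{ intros t Ht; rewrite Rmin_left, Rmax_right in Ht by lra.
  apply continuity_pt_filterlim, (ex_derive_continuous (K := R_AbsRing) (V := R_NormedModule) (fun x => ln (cnorm h E (x, y)))); exists (- 2 * Re (v (cexp (t, y)))); apply (Hor t y); lra. }
rewrite Rmin_left, Rmax_right in Ht by lra; cbn beta in Et.
assert (V : Rabs (Re (v (cexp (t, y))) - Re (v 0)) < eps / 2).
{ eapply Rle_lt_trans; [|apply (Hd (cexp (t, y)))].
  - eapply Rle_trans; [|apply re_le_Cmod]; right; f_equal.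
  - replace (cexp (t, y) - 0)%C with (cexp (t, y)) by ring.
    rewrite Cmod_cexp; unfold Re; simpl; rewrite <- (exp_ln d d0).
    apply exp_increasing; lra. }
assert (B := HA y Hy); rewrite Cmod_R in B.
replace (ln (cnorm h E (x, y)) + 2 * Re (v 0) * x) with
 (ln (cnorm h E (s2, y)) + 2 * (Re (v (cexp (t, y))) - Re (v 0)) * (s2 - x) + 2 * Re (v 0) * s2) by lra.
eapply Rle_trans; [apply Rabs_triang|].
eapply Rle_trans; [apply Rplus_le_compat_r, Rabs_triang|].
rewrite !Rabs_mult, (Rabs_right 2), (Rabs_right (s2 - x)), (Rabs_left x) by lra.
assert (2 * Rabs (Re (v (cexp (t, y))) - Re (v 0)) * (s2 - x) <= 2 * (eps / 2) * (s2 - x)).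
{ apply Rmult_le_compat_r; lra. }
assert (eps * (s2 - x) <= eps * - x) by (apply Rmult_le_compat_l; lra).
lra.
Qed.

(** * Monodromy and growth *)

Definition holomorphic_frame_at {L : line_bundle punctured_disk} (e : forall z, fibre L z)
    (i : chart L) (c : C -> C) (z : C) : Prop :=
  chart_dom L i z /\ c z <> RtoC 0 /\ (exists D, wd c z D 0) /\ e z = c z ** frame L i z.

(** Translation by 2 pi i yields another parallel frame, so by uniqueness it acts as a constant;
    [mu] is a logarithm of that constant divided by 2 pi i. The point [z] is a separate variable
    because the fibres over [cexp w] and over [cexp] of the translate are different types until the
    two points are identified. *)
Lemma parallel_monodromy (L : line_bundle punctured_disk) (h : hermitian_metric L) (v : C -> C)
    (E : csection L) (s1 : R) : parallel_on h v E (fun w => Re w < s1) ->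
  exists mu, forall (k : Z) w, Re w < s1 -> forall z, z = cexp w ->
    E (w + RtoC (2 * PI * IZR k) * Ci)%C z = cexp (mu * (RtoC (2 * PI * IZR k) * Ci)) ** E w z.
Proof.
intros H.
set (t := fun k : Z => (RtoC (2 * PI * IZR k) * Ci)%C).
assert (Rt : forall k w, Re (w + t k)%C = Re w) by (intros; unfold t, Re; simpl; ring).
assert (Ct : forall k w, cexp (w + t k) = cexp w) by (intros; apply cexp_period).
assert (HU := open_Re_lt s1).
destruct (parallel_unique L h v E (fun w => E (w + t 1%Z)%C) (fun w => Re w < s1)) as [l [l0 Hl]]; auto.
{ intros u w s Hu Hw Hs.
  replace (Re (u + RtoC s * (w - u))%C) with (Re u + s * (Re w - Re u)) by (unfold Re; simpl; ring).
  destruct (Rle_dec s (/ 2)); nra. }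
{ exists (RtoC (s1 - 1)); simpl; lra. }
{ intros w Hw; destruct (H (w + t 1%Z)%C) as [i [c Hc]]; [now rewrite Rt|].
  exists i, (fun w => c (w + t 1%Z)%C); now apply parallel_shift. }
destruct (cexp_surj l l0) as [q [Hq _]].
assert (N1 : RtoC (2 * PI) <> RtoC 0) by (apply RtoC_neq0; generalize PI_RGT_0; lra).
exists (q / (RtoC (2 * PI) * Ci))%C.
set (mu := (q / (RtoC (2 * PI) * Ci))%C).
assert (M : forall k, (mu * t k)%C = (RtoC (IZR k) * q)%C).
{ intros k; unfold mu, t; rewrite (RtoC_mult (2 * PI) (IZR k)); field; split; auto; apply Ci_nz. }
(* Nonnegative multiples by induction; a negative multiple follows by applying the opposite one at
   the translated point. *)
assert (Nat : forall (n : nat) w, Re w < s1 -> forall z, z = cexp w ->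
   E (w + t (Z.of_nat n))%C z = cexp (mu * t (Z.of_nat n)) ** E w z).
{ intros n; induction n; intros w Hw z Hz.
  - replace (w + t (Z.of_nat 0))%C with w by (unfold t; simpl; rewrite Rmult_0_r; ring).
    rewrite M; simpl; rewrite Cmult_0_l, cexp_0; symmetry; apply scal_1.
  - rewrite M, Nat2Z.inj_succ, succ_IZR, RtoC_plus, Cmult_plus_distr_r, cexp_plus, <- M, Cmult_1_l, Hq.
    replace (w + t (Z.succ (Z.of_nat n)))%C with ((w + t (Z.of_nat n)) + t 1%Z)%C.
    2:{ unfold t; rewrite succ_IZR, Rmult_plus_distr_l, RtoC_plus; ring. }
    assert (X : z = cexp (w + t (Z.of_nat n))) by (rewrite Ct; exact Hz).
    rewrite Cmult_comm, <- scal_scal, <- IHn by auto.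
    rewrite X; apply Hl; now rewrite Rt. }
intros k w Hw z Hz; fold (t k).
destruct (Z_le_dec 0 k) as [K|K].
- rewrite <- (Z2Nat.id k K); now apply Nat.
- set (n := Z.to_nat (- k)).
  assert (Kn : k = (- Z.of_nat n)%Z) by (unfold n; rewrite Z2Nat.id; lia).
  assert (X := Nat n (w + t k)%C).
  rewrite Rt, Ct in X; specialize (X Hw z Hz).
  replace (w + t k + t (Z.of_nat n))%C with w in X.
  2:{ unfold t; rewrite Kn, opp_IZR, Ropp_mult_distr_r_reverse, RtoC_opp; ring. }
  rewrite X, scal_scal, <- cexp_plus.
  replace (mu * t k + mu * t (Z.of_nat n))%C with (RtoC 0).
  2:{ rewrite !M, Kn, opp_IZR, RtoC_opp; ring. }
  rewrite cexp_0; symmetry; apply scal_1.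
Qed.

(** Both bounds on the norm express one fact: ln |e|^2 differs from 2 b ln |z| by at most 2 eps |ln
    |z|| plus a constant. *)
Lemma puncture_frame (L : line_bundle punctured_disk) (h : hermitian_metric L) (K a : R) :
  0 < K -> curvature_bounded L h K ->
  exists (e : forall z, fibre L z) (rho b : R), 0 < rho < 1 /\ - a <= b < - a + 1 /\
    (forall z, z <> RtoC 0 -> Cmod z < rho -> exists i c, near z (holomorphic_frame_at e i c)) /\
    (forall eps, 0 < eps -> exists M, 0 < M /\ near 0 (fun z => z <> RtoC 0 ->
       hnorm h z (e z) <= M * Rpower (Cmod z) (b - eps) /\
       Rpower (Cmod z) (b + eps) <= M * hnorm h z (e z))).
Proof.
intros K0 curv; destruct (curvature_potential L h K curv) as [F [F1 [F2 F3]]].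
destruct (dbar_solution F K K0 F1 F2) as [v [S [c0 [c00 [vc [Sv [DS Sc]]]]]]].
set (s0 := ln (/ 4)); set (s1 := s0 - 1).
assert (Es0 : exp s0 = / 4) by (apply exp_ln; lra).
assert (rho1 : exp s1 < / 4) by (rewrite <- Es0; apply exp_increasing; unfold s1; lra).
destruct (parallel_halfplane L h v s0 s1) as [E HE]; [unfold s1; lra| |].
{ intros w Hw.
  assert (C4 : Cmod (cexp w) < / 4) by (rewrite Cmod_cexp, <- Es0; now apply exp_increasing).
  destruct (chart_cover _ L (cexp w)) as [i Hi].
  { split; [lra|apply cexp_neq0]. }
  destruct (F3 i) as [th [T1 T2]].
  apply (parallel_local L h F v S c0 i th w); auto. }
destruct (parallel_monodromy L h v E s1 HE) as [mu0 Hmu0].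
(* The exponent will be b = - Re v(0) - Re mu with mu = mu0 + k, so a + b = x - k. With k the
   integer part of x this lies in [0, 1). *)
set (x := a - (Re (v 0) + Re mu0)).
set (k := (up x - 1)%Z).
assert (Hk : 0 <= x - IZR k < 1).
{ unfold k; rewrite minus_IZR; generalize (archimed x); lra. }
(* An integer shift leaves the multipliers unchanged, since exp(2 pi i k j) = 1. *)
set (mu := (mu0 + RtoC (IZR k))%C).
assert (Hmu : forall (j : Z) w, Re w < s1 -> forall z, z = cexp w ->
    E (w + RtoC (2 * PI * IZR j) * Ci)%C z = cexp (mu * (RtoC (2 * PI * IZR j) * Ci)) ** E w z).
{ intros j w Hw z Hz; rewrite (Hmu0 j w Hw z Hz); f_equal.
  unfold mu; rewrite <- (cexp_period (mu0 * (RtoC (2 * PI * IZR j) * Ci)) (k * j)); f_equal.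
  rewrite mult_IZR, !RtoC_mult; ring. }
(* A logarithm chosen point by point, with no continuity; [He] shows that [e] does not depend on the
   choice. *)
destruct (functional_choice (fun z w => z <> RtoC 0 -> cexp w = z /\ - PI <= Im w <= PI)) as [lg Hlg].
{ intros z; destruct (Ceq_dec z 0) as [Z|Z]; [exists (RtoC 0); tauto|].
  destruct (cexp_surj z Z) as [w Hw]; exists w; auto. }
set (e := fun z => cexp (- mu * lg z) ** E (lg z) z).
assert (He : forall z w, cexp w = z -> Re w < s1 -> e z = cexp (- mu * w) ** E w z).
{ intros z w Hz Hw; unfold e.
  assert (Z0 : z <> RtoC 0) by (rewrite <- Hz; apply cexp_neq0).
  destruct (Hlg z Z0) as [L1 _].
  destruct (cexp_inj (lg z) w) as [j Hj]; [congruence|].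
  rewrite Hj, (Hmu j w Hw z) by auto; rewrite scal_scal, <- cexp_plus; do 2 f_equal; ring. }
set (b := - (Re (v 0) + Re mu)).
assert (Hb : b = - a + (x - IZR k)).
{ unfold b, mu, x; rewrite re_plus, re_RtoC; ring. }
assert (Rlg : forall z, z <> RtoC 0 -> Re (lg z) = ln (Cmod z)).
{ intros z Hz; destruct (Hlg z Hz) as [L1 _]; rewrite <- L1 at 2; now rewrite Cmod_cexp, ln_exp. }
exists e, (exp s1), b; split; [split; [apply exp_pos|lra]|split; [lra|split]].
- intros z0 Z0 Hz.
  destruct (Hlg z0 Z0) as [L1 _].
  (* Holomorphy is checked with a holomorphic branch of the logarithm near z0. *)
  destruct (local_log z0 (lg z0) L1) as [l [l0 Hl]].
  assert (Hs : Re (lg z0) < s1).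
  { rewrite Rlg by auto; rewrite <- (ln_exp s1); apply ln_increasing; auto; now apply Cmod_gt_0. }
  destruct (HE (lg z0) Hs) as [i [c Hc]].
  exists i, (fun z => cexp (- mu * l z) * c (l z))%C.
  assert (lc : ccont l z0).
  { eapply wd_ccont, (near_self _ _ Hl). }
  assert (N1 : near z0 (fun z => parallel_at h v E i c (l z))).
  { apply (near_ccont l); auto; now rewrite l0. }
  assert (N2 : near z0 (fun z => Re (l z) < s1)).
  { apply (near_ccont l z0 (fun w => Re w < s1)); auto; rewrite l0.
    exact (proj1 (open_near _) (open_Re_lt s1) (lg z0) Hs). }
  generalize (near_and _ _ _ Hl (near_and _ _ _ N1 N2)); apply near_imp.
  intros z [[H1 H2] [[P1 [P2 [[D P3] [P4 _]]]] H3]].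
  rewrite H1 in P1, P4.
  split; [exact P1|split; [|split]].
  + apply Cmult_neq_0; auto; apply cexp_neq0.
  + eexists; eapply wd_eq.
    * apply wd_mult.
      -- apply (wd_comp cexp (fun z => - mu * l z)%C); [apply wd_cexp|apply wd_scal, H2].
      -- apply (wd_comp c l); [exact P3|exact H2].
    * reflexivity.
    * cbn beta; ring.
  + rewrite (He z (l z) H1 H3), P4; apply scal_scal.
- intros eps e0.
  (* The precision is 2 eps because [cnorm] is the square of the norm. *)
  destruct (cnorm_growth L h v E s1 (2 * eps) HE vc ltac:(lra)) as [A [s2 [S1 [S2 G]]]].
  (* The factor exp(- mu w) also contributes Im mu Im w, bounded because the chosen logarithms lie
     in the strip |Im w| <= pi. *)
  set (A' := A + 2 * Rabs (Im mu) * PI).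
  exists (exp (A' / 2)); split; [apply exp_pos|].
  exists (Rmin (exp s2) 1); split; [apply Rmin_pos; [apply exp_pos|lra]|].
  intros z Hz Z0; replace (z - 0)%C with z in Hz by ring.
  assert (m := proj1 (Cmod_gt_0 z) Z0).
  destruct (Hlg z Z0) as [L1 L2].
  set (w := lg z) in *; set (s := Re w) in *.
  assert (Es : s = ln (Cmod z)) by (apply Rlg; auto).
  assert (Hs : s < s2).
  { rewrite Es, <- (ln_exp s2); apply ln_increasing; auto.
    eapply Rlt_le_trans; [exact Hz|apply Rmin_l]. }
  destruct (G w Hs L2) as [N0 NG]; fold s in NG.
  assert (Pz : punctured_disk z).
  { split; auto; eapply Rlt_le_trans; [exact Hz|apply Rmin_r]. }
  assert (Hq : hsq h z (e z) = exp (2 * (- Re (mu * w)%C)) * cnorm h E w).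
  { unfold e; fold w; rewrite hsq_scal by exact Pz.
    rewrite Cmod_cexp; f_equal.
    - replace (2 * - Re (mu * w)%C) with (- Re (mu * w)%C + - Re (mu * w)%C) by ring.
      rewrite exp_plus; replace (Re (- mu * w)%C) with (- Re (mu * w)%C) by (unfold Re; simpl; ring); ring.
    - unfold cnorm; now rewrite L1. }
  assert (X0 : 0 < hsq h z (e z)) by (rewrite Hq; apply Rmult_lt_0_compat; auto; apply exp_pos).
  assert (Hln : ln (hsq h z (e z)) = 2 * (- Re (mu * w)%C) + ln (cnorm h E w)).
  { rewrite Hq, ln_mult, ln_exp; auto; apply exp_pos. }
  assert (Hn : hnorm h z (e z) = exp (ln (hsq h z (e z)) / 2)).
  { unfold hnorm; fold (hsq h z (e z)).
    rewrite <- (exp_ln (hsq h z (e z))) at 1 by exact X0.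
    replace (exp (ln (hsq h z (e z)))) with (Rsqr (exp (ln (hsq h z (e z)) / 2))).
    - apply sqrt_Rsqr; left; apply exp_pos.
    - unfold Rsqr; rewrite <- exp_plus; f_equal; field. }
  assert (Y : Rabs (ln (hsq h z (e z)) - 2 * b * s) <= 2 * eps * - s + A').
  { rewrite Hln; replace (Re (mu * w)%C) with (Re mu * s - Im mu * Im w) by (unfold s, Re, Im; simpl; ring).
    replace (2 * - (Re mu * s - Im mu * Im w) + ln (cnorm h E w) - 2 * b * s) with
     ((ln (cnorm h E w) + 2 * Re (v 0) * s) + 2 * Im mu * Im w) by (unfold b; ring).
    eapply Rle_trans; [apply Rabs_triang|].
    rewrite (Rabs_left s) in NG by lra.
    rewrite !Rabs_mult, (Rabs_right 2) by lra.
    assert (Rabs (Im w) <= PI) by (unfold Rabs; destruct Rcase_abs; lra).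
    assert (2 * Rabs (Im mu) * Rabs (Im w) <= 2 * Rabs (Im mu) * PI).
    { apply Rmult_le_compat_l; [generalize (Rabs_pos (Im mu)); lra|auto]. }
    unfold A'; lra. }
  unfold Rpower; rewrite Hn, <- Es, <- !exp_plus.
  assert (B1 := Rle_trans _ _ _ (Rle_abs _) Y).
  rewrite <- Rabs_Ropp in Y; assert (B2 := Rle_trans _ _ _ (Rle_abs _) Y).
  assert (expm : forall p q, p <= q -> exp p <= exp q).
  { intros p q [J|J]; [left; now apply exp_increasing|right; now rewrite J]. }
  split; apply expm; lra.
Qed.

(** * The prolongation as a sheaf *)

Lemma hnorm_scal {X} {L : line_bundle X} (h : hermitian_metric L) (z c : C) (u : fibre L z) :
  X z -> hnorm h z (c ** u) = Cmod c * hnorm h z u.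
Proof.
intros Hz; unfold hnorm; fold (hsq h z (c ** u)) (hsq h z u).
rewrite hsq_scal, sqrt_mult_alt, sqrt_pow2 by (auto using Cmod_ge_0, pow2_ge_0); reflexivity.
Qed.

Lemma hnorm_ge_0 {X} {L : line_bundle X} (h : hermitian_metric L) (z : C) (u : fibre L z) :
  0 <= hnorm h z u.
Proof. apply sqrt_pos. Qed.

(** In rank one both vectors are multiples of a frame vector, so the inequality is the one for
    [Cmod]. *)
Lemma hnorm_plus {X} {L : line_bundle X} (h : hermitian_metric L) (z : C) (u v : fibre L z) :
  X z -> hnorm h z (plus u v) <= hnorm h z u + hnorm h z v.
Proof.
intros Hz; destruct (chart_cover _ L z Hz) as [i Hi].
destruct (frame_basis _ L i z Hi u) as [c [-> _]], (frame_basis _ L i z Hi v) as [d [-> _]].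
replace (plus (c ** frame L i z) (d ** frame L i z)) with ((c + d)%C ** frame L i z)
 by exact (scal_distr_r (c : C_Ring) (d : C_Ring) (frame L i z)).
rewrite !hnorm_scal, <- Rmult_plus_distr_r by auto.
apply Rmult_le_compat_r; [apply hnorm_ge_0|apply Cmod_triangle].
Qed.

(** In a chart the coefficients are chosen point by point; near each point they equal c times a
    transition function, hence are holomorphic. *)
Lemma holomorphic_section_local (L : line_bundle punctured_disk) (U : C -> Prop)
    (s : forall z, fibre L z) :
  (forall z, U z -> exists i c, (exists D, wd c z D 0) /\
     near z (fun w => chart_dom L i w /\ s w = c w ** frame L i w)) ->
  holomorphic_section L U s.
Proof.
intros H j.
destruct (functional_choice (fun w c => chart_dom L j w -> s w = c ** frame L j w)) as [f Hf].
{ intros w; destruct (classic (chart_dom L j w)) as [Hw|Hw]; [|exists (RtoC 0); tauto].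
  destruct (frame_basis _ L j w Hw (s w)) as [c [Hc _]]; exists c; auto. }
exists f; split; [|intros z _ Hz; now apply Hf].
apply holomorphic_wd; intros z [Uz Jz].
destruct (H z Uz) as [i [c [[D HD] N]]].
destruct (transition_holomorphic _ L j i) as [g [Hg G]].
destruct (proj1 (holomorphic_wd _ _) Hg z) as [D' HD'].
{ split; [exact Jz|exact (proj1 (near_self _ _ N))]. }
eexists; apply (wd_ext (fun w => c w * g w)%C).
- generalize (near_and _ _ _ N (chart_dom_near L j z Jz)); apply near_imp.
  intros w [[W1 W2] W3]; apply (frame_scal_inj L j w); auto.
  rewrite <- (Hf w W3), W2, (G w W3 W1); symmetry; apply scal_scal.
- eapply wd_eq; [exact (wd_mult _ _ _ _ _ _ _ HD HD')|reflexivity|ring].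
Qed.

Lemma holomorphic_section_coef (L : line_bundle punctured_disk) (U : C -> Prop)
    (s : forall z, fibre L z) (z : C) (i : chart L) : open U ->
  holomorphic_section L U s -> U z -> chart_dom L i z ->
  exists c, (exists D, wd c z D 0) /\
    near z (fun w => chart_dom L i w /\ s w = c w ** frame L i w).
Proof.
intros HU H Uz Iz; destruct (H i) as [f [F1 F2]]; exists f; split.
- exact (proj1 (holomorphic_wd _ _) F1 z (conj Uz Iz)).
- generalize (near_and _ _ _ (proj1 (open_near U) HU z Uz) (chart_dom_near L i z Iz)).
  apply near_imp; intros w [W1 W2]; auto.
Qed.

Lemma locally'_near (P : C -> Prop) :
  locally' (RtoC 0 : C_UniformSpace) P <-> near 0 (fun z => z <> RtoC 0 -> P z).
Proof. unfold locally', within; symmetry; apply near_locally. Qed.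

Lemma open_meet (U V : C -> Prop) : open U -> open V -> open (meet U V).
Proof.
intros HU HV; apply open_near; intros z [Uz Vz]; apply near_and; now apply open_near.
Qed.

Lemma near_0_punctured (P : C -> Prop) : near 0 P ->
  near 0 (fun z => z <> RtoC 0 -> punctured_disk z /\ P z).
Proof.
intros H.
assert (N : near 0 (fun z => Cmod z < 1)).
{ exists 1; split; [lra|]; intros w; now replace (w - 0)%C with w by ring. }
generalize (near_and _ _ _ N H); apply near_imp; intros z [Z1 Z2] Z0; repeat split; auto.
Qed.

Lemma holomorphic_bounded (U : C -> Prop) (f : C -> C) (z : C) :
  holomorphic_on U f -> U z -> exists B, 0 <= B /\ near z (fun w => Cmod (f w) <= B).
Proof.
intros H Hz; destruct (proj1 (holomorphic_wd _ _) H z Hz) as [D HD].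
exists (Cmod (f z) + 1); split; [generalize (Cmod_ge_0 (f z)); lra|].
generalize (wd_ccont _ _ _ _ HD 1 Rlt_0_1); apply near_imp; intros w Hw.
generalize (Cmod_triangle (f w - f z) (f z)).
replace (f w - f z + f z)%C with (f w) by ring; lra.
Qed.

(** Holomorphy is local on the punctured disk and growth depends only on the germ at 0, so both pass
    through restriction and gluing. Multiplication by holomorphic functions preserves growth since
    they are bounded near 0. *)
Lemma prolongation_sheaf (L : line_bundle punctured_disk) (h : hermitian_metric L) (a : R) :
  is_module_sheaf disk (prolongation L h a).
Proof.
split.
- intros U [HU _] s t E [H1 H2]; split.
  + intros i; destruct (H1 i) as [f [F1 F2]]; exists f; split; auto.
    intros z Hz Iz; rewrite <- (E z); auto; apply Hz.
  + intros U0 eps e0; destruct (H2 U0 eps e0) as [M HM]; exists M.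
    apply locally'_near; apply locally'_near in HM.
    generalize (near_0_punctured _ (near_and _ _ _ (proj1 (open_near U) HU _ U0) HM)).
    apply near_imp; intros z Hz Z0; destruct (Hz Z0) as [Pz [Uz Bz]].
    rewrite <- (E z); auto.
- intros U [HU _]; split.
  + intros i; exists (fun _ => RtoC 0); split.
    * apply holomorphic_wd; intros z _; eexists; apply wd_const.
    * intros z _ _; symmetry; apply scal_0.
  + intros U0 eps e0; exists 0; apply locally'_near.
    generalize (near_0_punctured _ (proj1 (open_near U) HU _ U0)).
    apply near_imp; intros z Hz Z0; destruct (Hz Z0) as [Pz _].
    assert (E : hnorm h z (zero : fibre L z) = 0).
    { rewrite <- (scal_0 (zero : fibre L z)), hnorm_scal, Cmod_0 by exact Pz; ring. }
    simpl in E |- *; rewrite E; lra.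
- intros U [HU _] s t [S1 S2] [T1 T2]; split.
  + intros i; destruct (S1 i) as [f [F1 F2]], (T1 i) as [g [G1 G2]].
    exists (fun z => f z + g z)%C; split.
    * apply holomorphic_wd; intros z Hz.
      destruct (proj1 (holomorphic_wd _ _) F1 z Hz) as [D HD], (proj1 (holomorphic_wd _ _) G1 z Hz) as [D' HD'].
      eexists; eapply wd_eq; [exact (wd_plus _ _ _ _ _ _ _ HD HD')|reflexivity|ring].
    * intros z Hz Iz; unfold sec_plus; rewrite F2, G2 by auto.
      symmetry; exact (scal_distr_r (f z : C_Ring) (g z : C_Ring) (frame L i z)).
  + intros U0 eps e0; destruct (S2 U0 eps e0) as [M HM], (T2 U0 eps e0) as [N HN].
    exists (M + N); apply locally'_near; apply locally'_near in HM; apply locally'_near in HN.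
    generalize (near_0_punctured _ (near_and _ _ _ HM HN)).
    apply near_imp; intros z Hz Z0; destruct (Hz Z0) as [Pz [Bs Bt]].
    eapply Rle_trans; [apply hnorm_plus, Pz|]; specialize (Bs Z0); specialize (Bt Z0).
    simpl in *; lra.
- intros U [HU _] f s Hf [S1 S2]; split.
  + intros i; destruct (S1 i) as [g [G1 G2]]; exists (fun z => f z * g z)%C; split.
    * apply holomorphic_wd; intros z Hz.
      destruct (proj1 (holomorphic_wd _ _) Hf z (proj1 (proj1 Hz))) as [D HD].
      destruct (proj1 (holomorphic_wd _ _) G1 z Hz) as [D' HD'].
      eexists; eapply wd_eq; [exact (wd_mult _ _ _ _ _ _ _ HD HD')|reflexivity|ring].
    * intros z Hz Iz; unfold sec_scal; rewrite G2 by auto; apply scal_scal.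
  + intros U0 eps e0; destruct (S2 U0 eps e0) as [M HM].
    destruct (holomorphic_bounded U f 0 Hf U0) as [B [B0 HB]].
    exists (B * M); apply locally'_near; apply locally'_near in HM.
    generalize (near_0_punctured _ (near_and _ _ _ HM HB)).
    apply near_imp; intros z Hz Z0; destruct (Hz Z0) as [Pz [Bs Bf]].
    eapply Rle_trans; [right; exact (hnorm_scal h z (f z) (s z) Pz)|]; rewrite Rmult_assoc.
    eapply Rle_trans; [apply Rmult_le_compat_r; [apply hnorm_ge_0|exact Bf]|].
    apply Rmult_le_compat_l; auto.
- intros U V _ [HV VU] s [S1 S2]; split; [|auto].
  intros i; destruct (S1 i) as [f [F1 F2]]; exists f; split.
  + intros z [[Vz Pz] Iz]; apply F1; repeat split; auto; apply Pz.
  + intros z [Vz Pz] Iz; apply F2; auto; split; auto.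
- intros J U s HU Hs Ecomp.
  (* At each point some member of the cover containing it supplies the value; compatibility makes
     the choice irrelevant off 0. *)
  set (t := fun z => match excluded_middle_informative (exists j, U j z) with
    | left H => s (proj1_sig (constructive_indefinite_description _ H)) z
    | right _ => zero end).
  assert (Ht : forall j z, U j z -> punctured_disk z -> t z = s j z).
  { intros j z Hz Pz; unfold t; destruct excluded_middle_informative as [H|H].
    - destruct (constructive_indefinite_description _ H) as [k Hk]; simpl.
      apply (Ecomp k j); auto; split; auto.
    - exfalso; eauto. }
  exists t; split; [|intros j z Hz Pz; now apply Ht].
  split.
  + apply holomorphic_section_local; intros z [[j Uz] Pz].
    destruct (chart_cover _ L z Pz) as [i Hi].
    assert (HO : open (meet (U j) punctured_disk))
     by (apply open_meet; [apply HU|apply open_punctured_disk]).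
    destruct (holomorphic_section_coef L _ (s j) z i HO (proj1 (Hs j)) (conj Uz Pz) Hi) as [c [Hc N]].
    exists i, c; split; auto.
    generalize (near_and _ _ _ N (proj1 (open_near _) HO z (conj Uz Pz))); apply near_imp.
    intros w [[W1 W2] [W3 W4]]; split; auto; now rewrite (Ht j w).
  (* A single member of the cover containing 0 suffices: [t] agrees with its section on a punctured
     neighbourhood. *)
  + intros [j U0] eps e0; destruct (proj2 (Hs j) U0 eps e0) as [M HM]; exists M.
    apply locally'_near; apply locally'_near in HM.
    generalize (near_0_punctured _ (near_and _ _ _ (proj1 (open_near _) (proj1 (HU j)) _ U0) HM)).
    apply near_imp; intros z Hz Z0; destruct (Hz Z0) as [Pz [Uz Bz]].
    rewrite (Ht j z); auto.
Qed.

Lemma holomorphic_mult_frame (L : line_bundle punctured_disk) (e : forall z, fibre L z)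
    (W : C -> Prop) (f : C -> C) : holomorphic_on W f ->
  (forall z, W z -> punctured_disk z -> exists i c, near z (holomorphic_frame_at e i c)) ->
  holomorphic_section L (meet W punctured_disk) (fun z => f z ** e z).
Proof.
intros Hf He; apply holomorphic_section_local; intros z [Wz Pz].
destruct (He z Wz Pz) as [i [c N]]; exists i, (fun z => f z * c z)%C; split.
- destruct (proj1 (holomorphic_wd _ _) Hf z Wz) as [D HD].
  destruct (near_self _ _ N) as [_ [_ [[D' HD'] _]]].
  eexists; eapply wd_eq; [exact (wd_mult _ _ _ _ _ _ _ HD HD')|reflexivity|ring].
- revert N; apply near_imp; intros w [W1 [_ [_ W4]]]; split; auto.
  rewrite W4; apply scal_scal.
Qed.

Lemma holomorphic_frame_neq0 (L : line_bundle punctured_disk) (e : forall z, fibre L z)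
    (i : chart L) (c : C -> C) (z : C) : holomorphic_frame_at e i c z -> e z <> zero.
Proof.
intros [H1 [H2 [_ H4]]] Z; apply H2, (frame_scal_inj L i z); auto.
rewrite <- H4, Z; symmetry; apply scal_0.
Qed.

Lemma scal_inj {V : ModuleSpace C_Ring} (c d : C) (u : V) : u <> zero -> c ** u = d ** u -> c = d.
Proof.
intros N E; apply Ceq_minus, NNPP; intros Hc; apply N.
assert (Z : (c - d)%C ** u = zero).
{ transitivity (plus (c ** u) (opp (d ** u))).
  - rewrite <- (scal_opp_l (d : C_Ring) u).
    exact (scal_distr_r (c : C_Ring) (opp (d : C_Ring)) u).
  - rewrite E; exact (@plus_opp_r (ModuleSpace.AbelianGroup C_Ring V) _). }
rewrite <- (scal_1 u), <- (Cinv_l (c - d)%C), <- scal_scal, Z by exact Hc.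
apply (scal_zero_r (_ : C_Ring)).
Qed.

Lemma section_coef (L : line_bundle punctured_disk) (e : forall z, fibre L z)
    (W : C -> Prop) (s : forall z, fibre L z) : open W ->
  (forall z, W z -> punctured_disk z -> exists i c, near z (holomorphic_frame_at e i c)) ->
  holomorphic_section L (meet W punctured_disk) s ->
  exists F, forall z, W z -> punctured_disk z -> s z = F z ** e z /\ exists D, wd F z D 0.
Proof.
intros HW He Hs.
assert (X : forall z, W z -> punctured_disk z -> exists F, (exists D, wd F z D 0) /\
  near z (fun w => s w = F w ** e w /\ e w <> zero)).
{ intros z Wz Pz; destruct (He z Wz Pz) as [i [c N]].
  destruct (near_self _ _ N) as [I1 [I2 [[D HD] I4]]].
  destruct (holomorphic_section_coef L (meet W punctured_disk) s z i) as [d [[D' HD'] N']]; auto.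
  { apply open_meet; auto; apply open_punctured_disk. }
  { split; auto. }
  exists (fun w => d w * / c w)%C; split.
  - eexists; eapply wd_eq; [apply wd_mult; [exact HD'|apply wd_inv; [exact I2|exact HD]]|reflexivity|].
    field; auto.
  - generalize (near_and _ _ _ N N'); apply near_imp; intros w [W1 [W2 W3]]; split.
    + destruct W1 as [J1 [J2 [_ J4]]]; rewrite W3, J4, scal_scal; f_equal; field; auto.
    + eapply holomorphic_frame_neq0, W1. }
destruct (functional_choice (fun z c => W z -> punctured_disk z -> s z = c ** e z)) as [F HF].
{ intros z; destruct (classic (W z /\ punctured_disk z)) as [[Wz Pz]|N].
  - destruct (X z Wz Pz) as [f [_ N]]; exists (f z); intros _ _; apply (near_self _ _ N).
  - exists (RtoC 0); tauto. }
exists F; intros z Wz Pz; split; auto.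
destruct (X z Wz Pz) as [f [[D HD] N]]; exists D; eapply wd_ext; [|exact HD].
generalize (near_and _ _ _ N (near_and _ _ _ (proj1 (open_near W) HW z Wz)
  (proj1 (open_near _) open_punctured_disk z Pz))); apply near_imp.
intros w [[W1 W2] [W3 W4]]; apply (scal_inj _ _ (e w)); auto.
rewrite <- W1; auto.
Qed.

Lemma Rpower_small (q eta : R) : 0 < q -> 0 < eta ->
  exists d, 0 < d /\ forall x, 0 < x < d -> Rpower x q <= eta.
Proof.
intros q0 e0; exists (Rpower eta (/ q)); split; [apply exp_pos|]; intros x Hx.
apply Rle_trans with (Rpower (Rpower eta (/ q)) q); [apply Rle_Rpower_l; lra|].
rewrite Rpower_mult, Rinv_l, Rpower_1 by lra; lra.
Qed.

Lemma Rpower_le_exponent (x p q : R) : 0 < x < 1 -> p <= q -> Rpower x q <= Rpower x p.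
Proof.
intros Hx Hpq; unfold Rpower.
assert (L : ln x < 0) by (rewrite <- ln_1; apply ln_increasing; lra).
destruct (Req_dec (q * ln x) (p * ln x)) as [->|N]; [lra|].
left; apply exp_increasing; nra.
Qed.

(** Multiplication by a holomorphic frame. The lemma serves both around the puncture and on charts
    away from it, where the condition at 0 is vacuous. *)
Lemma iso_from_frame (L : line_bundle punctured_disk) (h : hermitian_metric L) (a : R)
    (e : forall z, fibre L z) (V : C -> Prop) :
  (forall z, V z -> z <> RtoC 0 -> punctured_disk z) ->
  (forall z, V z -> punctured_disk z -> exists i c, near z (holomorphic_frame_at e i c)) ->
  (V 0 -> exists b, - a <= b < - a + 1 /\
    forall eps, 0 < eps -> exists M, 0 < M /\ near 0 (fun z => z <> RtoC 0 ->
       hnorm h z (e z) <= M * Rpower (Cmod z) (b - eps) /\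
       Rpower (Cmod z) (b + eps) <= M * hnorm h z (e z))) ->
  is_iso_from_O V (prolongation L h a) (fun _ f z => f z ** e z).
Proof.
intros VP He H0; split.
- intros W [HW WV] f Hf; split; [apply holomorphic_mult_frame; auto|].
  intros W0 eps e0; destruct (H0 (WV _ W0)) as [b [Hb G]].
  destruct (G eps e0) as [M [M0 HM]].
  destruct (holomorphic_bounded W f 0 Hf W0) as [B [B0 HB]].
  exists (B * M); apply locally'_near.
  generalize (near_0_punctured _ (near_and _ _ _ HM HB)).
  apply near_imp; intros z Hz Z0; destruct (Hz Z0) as [Pz [Bs Bf]].
  destruct (Bs Z0) as [Bs1 _].
  rewrite hnorm_scal by exact Pz; rewrite Rmult_assoc.
  apply Rmult_le_compat; auto using Cmod_ge_0, hnorm_ge_0.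
  eapply Rle_trans; [exact Bs1|]; apply Rmult_le_compat_l; [lra|].
  (* From -a <= b the exponent b - eps is at least - (a + eps), and |z| < 1. *)
  apply Rpower_le_exponent; [|lra].
  split; [now apply Cmod_gt_0|apply Pz].
- intros W _ f g _ _ E z Wz _; now rewrite E.
- intros W _ f g _ _ z _ _; exact (scal_distr_r (f z : C_Ring) (g z : C_Ring) (e z)).
- intros W _ c f _ _ z _ _; unfold sec_scal; symmetry; apply scal_scal.
- intros W W' _ _ f _ z _ _; reflexivity.
- intros W [HW WV] f g Hf Hg E.
  assert (E1 : forall z, W z -> z <> RtoC 0 -> f z = g z).
  { intros z Wz Z0; assert (Pz := VP z (WV z Wz) Z0).
    destruct (He z (WV z Wz) Pz) as [i [c N]].
    apply (scal_inj _ _ (e z)); [eapply holomorphic_frame_neq0, (near_self _ _ N)|].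
    exact (E z Wz Pz). }
  (* Sections are compared only off 0, so equality of the coefficients at 0 comes from their
     continuity. *)
  intros z Wz; destruct (Ceq_dec z 0) as [->|Z0]; auto.
  destruct (proj1 (holomorphic_wd _ _) Hf 0 Wz) as [D HD], (proj1 (holomorphic_wd _ _) Hg 0 Wz) as [D' HD'].
  assert (Cc := ccont_minus _ _ _ (wd_ccont _ _ _ _ HD) (wd_ccont _ _ _ _ HD')).
  apply Ceq_minus, Cmod_eq_0, Rle_antisym; [|apply Cmod_ge_0]; apply Rnot_lt_le; intros P.
  destruct (near_and _ _ _ (Cc _ P) (proj1 (open_near W) HW _ Wz)) as [d [d0 Hd]].
  destruct (Hd (RtoC (d / 2))) as [X1 X2].
  { replace (RtoC (d / 2) - 0)%C with (RtoC (d / 2)) by ring; rewrite Cmod_R, Rabs_right; lra. }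
  rewrite (E1 (RtoC (d / 2))) in X1; auto.
  2:{ apply RtoC_neq0; lra. }
  rewrite Cmod_minus_sym in X1.
  replace (f 0 - g 0 - (g (RtoC (d / 2)) - g (RtoC (d / 2))))%C with (f 0 - g 0)%C in X1 by ring; lra.
- intros W [HW WV] s [Hs Gs].
  destruct (section_coef L e W s) as [F HF]; auto.
  destruct (classic (W 0)) as [W0|W0].
  2:{ exists F; split.
    - apply holomorphic_wd; intros z Wz; apply HF; auto.
      apply VP; auto; intros ->; auto.
    - intros z Wz Pz; symmetry; now apply HF. }
  destruct (H0 (WV _ W0)) as [b [Hb G]].
  destruct (proj1 (open_near W) HW _ W0) as [r [r0 Hr]].
  destruct (removable_singularity F 0 r) as [v Hv]; auto.
  { intros z Hz Z0; apply HF; auto. }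
  { intros eta p0.
    (* Positive because b < - a + 1. The coefficient is O(|z|^(- (a + eps) - (b + eps))), so z times
       it is O(|z|^(1 - a - b - 2 eps)) = O(|z|^(2 eps)). *)
    set (eps := (1 - a - b) / 4); assert (e0 : 0 < eps) by (unfold eps; lra).
    destruct (G eps e0) as [M [M0 HM]]; destruct (Gs W0 eps e0) as [N HN].
    apply locally'_near in HN.
    set (T := M * (Rabs N + 1)).
    assert (T0 : 0 < T) by (apply Rmult_lt_0_compat; auto; generalize (Rabs_pos N); lra).
    destruct (Rpower_small (2 * eps) (eta / T)) as [d [d0 Hd]]; [lra|now apply Rdiv_lt_0_compat|].
    assert (ND : near 0 (fun z => Cmod z < d)).
    { exists d; split; auto; intros z; now replace (z - 0)%C with z by ring. }
    generalize (near_0_punctured _ (near_and _ _ _ HM (near_and _ _ _ HN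
      (near_and _ _ _ ND (proj1 (open_near W) HW _ W0))))).
    apply near_imp; intros z Hz Z0; destruct (Hz Z0) as [Pz [B1 [B2 [B3 Wz]]]].
    destruct (B1 Z0) as [_ B4]; specialize (B2 Z0).
    destruct (HF z Wz Pz) as [Es _]; rewrite Es, hnorm_scal in B2 by exact Pz.
    replace (z - 0)%C with z by ring; rewrite Cmod_mult.
    assert (m := proj1 (Cmod_gt_0 z) Z0); set (x := Cmod z) in *.
    assert (Fb : Cmod (F z) * Rpower x (b + eps) <= T * Rpower x (- (a + eps))).
    { apply Rle_trans with (Cmod (F z) * (M * hnorm h z (e z))).
      - apply Rmult_le_compat_l; auto using Cmod_ge_0.
      - apply Rle_trans with (M * (N * Rpower x (- (a + eps)))).
        + replace (Cmod (F z) * (M * hnorm h z (e z))) with (M * (Cmod (F z) * hnorm h z (e z))) by ring.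
          apply Rmult_le_compat_l; lra.
        + unfold T; rewrite Rmult_assoc; apply Rmult_le_compat_l; [lra|].
          apply Rmult_le_compat_r; [left; apply exp_pos|].
          generalize (Rle_abs N); lra. }
    apply Rle_trans with (T * Rpower x (2 * eps)).
    - apply Rmult_le_reg_r with (Rpower x (b + eps)); [apply exp_pos|].
      rewrite !Rmult_assoc, <- Rpower_plus.
      apply Rle_trans with (x * (T * Rpower x (- (a + eps)))).
      + apply Rmult_le_compat_l; [lra|exact Fb].
      + right; rewrite <- (Rpower_1 x) at 1 by exact m.
        replace (Rpower x 1 * (T * Rpower x (- (a + eps)))) with
          (T * (Rpower x 1 * Rpower x (- (a + eps)))) by ring.
        rewrite <- Rpower_plus; do 2 f_equal; unfold eps; field.
    - apply Rle_trans with (T * (eta / T)); [|right; field; lra].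
      apply Rmult_le_compat_l; [lra|]; apply Hd; auto. }
  cbv zeta in Hv.
  set (g := fun z => match excluded_middle_informative (z = RtoC 0) with
     | left _ => v | right _ => F z end) in *.
  assert (Gn : forall z, z <> RtoC 0 -> g z = F z)
   by (intros z Z0; unfold g; destruct excluded_middle_informative; tauto).
  exists g; split.
  + apply holomorphic_wd; intros z Wz; destruct (Ceq_dec z 0) as [->|Z0].
    * apply Hv; replace (0 - 0)%C with (RtoC 0) by ring; rewrite Cmod_0; exact r0.
    * destruct (HF z Wz (VP z (WV z Wz) Z0)) as [_ [D HD]]; exists D; eapply wd_ext; [|exact HD].
      exists (Cmod z); split; [now apply Cmod_gt_0|]; intros w Hw; symmetry; apply Gn; intros ->.
      replace (0 - z)%C with (- z)%C in Hw by ring; rewrite Cmod_opp in Hw; lra.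
  + intros z Wz Pz; rewrite Gn by apply Pz; symmetry; now apply HF.
Qed.

Theorem proposition1p5 (L : line_bundle punctured_disk) (h : hermitian_metric L)
    (K : R) (K_pos : (0 < K)%R) (curv : curvature_bounded L h K) (a : R) :
  is_holomorphic_line_bundle disk (prolongation L h a).
Proof.
split; [apply prolongation_sheaf|].
intros p Hp; destruct (Ceq_dec p 0) as [->|P0].
- destruct (puncture_frame L h K a K_pos curv) as [e [rho [b [Hrho [Hb [He G]]]]]].
  exists (fun z => Cmod z < rho); split; [|split].
  + split.
    * apply open_near; intros z Hz; exists (rho - Cmod z); split; [lra|]; intros w Hw.
      generalize (Cmod_triangle_inv w z); lra.
    * unfold disk; intros; lra.
  + rewrite Cmod_0; lra.
  + exists (fun _ f z => f z ** e z); apply iso_from_frame.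
    * intros z Hz Z0; split; auto; lra.
    * intros z Hz [_ Z0]; now apply He.
    * intros _; exists b; split; auto.
- assert (Pp : punctured_disk p) by (split; auto).
  destruct (chart_cover _ L p Pp) as [i Hi].
  exists (chart_dom L i); split; [|split; [exact Hi|]].
  + split; [apply (chart_open _ L i)|]; intros z Hz; apply (chart_punctured L i z Hz).
  + exists (fun _ f z => f z ** frame L i z); apply iso_from_frame.
    * intros z Hz _; exact (chart_punctured L i z Hz).
    * intros z Hz _; exists i, (fun _ => RtoC 1).
      generalize (chart_dom_near L i z Hz); apply near_imp; intros w Hw.
      split; [exact Hw|split; [apply C1_nz|split]].
      -- eexists; apply wd_const.
      -- symmetry; apply scal_1.
    * intros H0; exfalso; now apply (chart_punctured L i 0 H0).
Qed.
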